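(* For each $n \ge 1$ let $p_n(z) = \sum_{k=0}^{n} a_k z^k$, where the $a_k$ are i.i.d. standard complex Gaussian random variables $N_{\mathbb{C}}(0,1)$, let $\Lambda_n = \{z \in \mathbb{C} : |p_n(z)| = 1\}$, and let $b_0(\Lambda_n)$ be the number of connected components of $\Lambda_n$. Then $\mathbb{E}\, b_0(\Lambda_n) \sim n$ as $n \to \infty$, i.e. $$\lim_{n\to\infty} \frac{\mathbb{E}\, b_0(\Lambda_n)}{n} = 1 .$$
   Context: A random variable has the standard complex Gaussian distribution $N_{\mathbb{C}}(0,1)$ if it has density $\frac{1}{\pi} e^{-|z|^2}$ on $\mathbb{C}$ with respect to Lebesgue measure. *)

(* Defs.v *)
From HB Require Import structures.
From mathcomp Require Import all_boot all_order all_algebra.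
From mathcomp Require Import finmap complex.
From mathcomp Require Import all_classical all_reals all_analysis.

Set Implicit Arguments.
Unset Strict Implicit.
Unset Printing Implicit Defensive.

Import Order.TTheory GRing.Theory Num.Theory.
Import numFieldNormedType.Exports.

Local Open Scope classical_set_scope.
Local Open Scope ring_scope.
Local Open Scope complex_scope.

(* R[i]^o carries the topology of the modulus `|.|, as for any numFieldType. *)
HB.instance Definition _ (R : realType) :=
  PseudoPointedMetric.copy R[i] (R[i])^o.

Section ComplexMeasurable.
Context {R : realType}.

Definition complex_to_pair (z : R[i]) :
    measurableTypeR R * measurableTypeR R := (complex.Re z, complex.Im z).

Definition pair_to_complex (x : measurableTypeR R * measurableTypeR R) :
    R[i] := x.1 +i* x.2.

(* Pulling back the product sigma-algebra of R * R along (Re, Im) gives the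
   Borel sets of the topology of the modulus. *)
HB.instance Definition _ :=
  Measurable.copy R[i] (g_sigma_algebra_preimageType complex_to_pair).

Lemma measurable_complex_to_pair : measurable_fun [set: R[i]] complex_to_pair.
Proof. by move=> _ B mB; exists B => //; rewrite setTI. Qed.

Lemma measurable_pair_to_complex : measurable_fun setT pair_to_complex.
Proof.
move=> _ _ [B mB <-]; rewrite !setTI.
by rewrite (_ : _ @^-1` _ = B) //; apply/seteqP; split=> -[x y].
Qed.

HB.instance Definition _ :=
  isMeasurableFun.Build _ _ _ _ pair_to_complex measurable_pair_to_complex.

Definition complex_lebesgue_measure : set R[i] -> \bar R :=
  pushforward (@lebesgue_measure R \x @lebesgue_measure R)%E pair_to_complex.

Let complex_lebesgue_measure0 : complex_lebesgue_measure set0 = 0%E.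
Proof.
by rewrite /complex_lebesgue_measure /pushforward preimage_set0 measure0.
Qed.

Let complex_lebesgue_measure_ge0 A : (0 <= complex_lebesgue_measure A)%E.
Proof. exact: measure_ge0. Qed.

Let complex_lebesgue_measure_sigma_additive :
  semi_sigma_additive complex_lebesgue_measure.
Proof.
move=> F mF tF mUF; rewrite /complex_lebesgue_measure /pushforward.
rewrite preimage_bigcup.
apply: measure_semi_sigma_additive.
- move=> n; rewrite -[X in measurable X]setTI.
  exact: measurable_pair_to_complex.
- apply/trivIsetP => /= i j _ _ ij; rewrite -preimage_setI.
  by move/trivIsetP : tF => /(_ _ _ _ _ ij) ->//; rewrite preimage_set0.
- rewrite -preimage_bigcup -[X in measurable X]setTI.
  exact: measurable_pair_to_complex.
Qed.

HB.instance Definition _ := isMeasure.Build _ _ _ complex_lebesgue_measure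
  complex_lebesgue_measure0 complex_lebesgue_measure_ge0
  complex_lebesgue_measure_sigma_additive.

End ComplexMeasurable.

Section GaussianPolynomials.
Context d (T : measurableType d) (R : realType) (P : probability T R).

Definition complex_gaussian_pdf (z : R[i]) : R :=
  pi^-1 * expR (- (Normc.normc z ^+ 2)).

Definition std_complex_gaussian (X : {RV P >-> R[i]}) : Prop :=
  forall A : set R[i], measurable A ->
    distribution P X A =
    (\int[complex_lebesgue_measure]_(z in A) (complex_gaussian_pdf z)%:E)%E.

Definition mutually_independent d' (T' : measurableType d') (I : finType)
    (X : I -> {RV P >-> T'}) : Prop :=
  forall (J : {set I}) (A : I -> set T'),
    (forall i, i \in J -> measurable (A i)) ->
    P (\bigcap_(i in [set` J]) X i @^-1` A i) =
    (\prod_(i in J) P (X i @^-1` A i))%E.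

Definition random_poly n (a : 'I_n.+1 -> {RV P >-> R[i]}) (w : T) :
    {poly R[i]} :=
  \sum_(k < n.+1) a k w *: 'X^k.

End GaussianPolynomials.
Arguments std_complex_gaussian {d T R} P X.
Arguments mutually_independent {d T R} P {d' T' I} X.

Definition lemniscate (R : realType) (p : {poly R[i]}) : set R[i] :=
  [set z | `|p.[z]| = 1].

(* +oo if there are infinitely many components. *)
Definition betti0 (R : realType) (U : topologicalType) (A : set U) : \bar R :=
  counting [set connected_component A x | x in A].

(* Main.v *)
(** Upper bound: a relatively clopen part of the lemniscate contains a root of
[p = 1] (maximise [Re p] on it and use that [p] is open), so [betti0 <= n].

Lower bound: a root [z] of [p] at which [|p'(z)|] is not too small and
[|p''(z)|] is not too large is surrounded by a small circle on which
[|p| > 1]; such "good" roots lie on distinct components of the lemniscate, and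
it suffices that all but [o(n)] of the [n] roots are good with high probability.
By Landau's inequality all but [O(n/s)] roots lie in the annulus
[||z| - 1| <= tau], where [n = s^96] and [tau = s^-94]. Cover it by
[O(tau/delta^2)] discs of radius [5 delta], [delta = s^-144]. Up to an event of
small probability each disc carries at most 4 roots (Landau again, around its
centre), and a disc carries a root that is not good only if at its centre [p]
and [z p'] are both small or [p''] is huge.

The probabilities follow from the Laplace transform of a quadratic form in two
linear forms [sum_j c_j om_j a_j], [sum_j d_j om_j a_j], computed by
conditioning on the coefficients one at a time: it is the inverse of a
polynomial in the variances, whose leading term is the Gram determinant. By
Lagrange's identity the Gram determinant of [p(z)] and [z p'(z)] is of order
[m^4] with [m ~ 1/tau], which makes the expected number of bad discs [o(n/s)]. *)

Require Import Defs.
From HB Require Import structures.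
From mathcomp Require Import all_boot all_order all_algebra.
From mathcomp Require Import finmap complex.
From mathcomp Require Import all_classical all_reals all_analysis.
From mathcomp Require Import measurable_realfun.
From mathcomp Require Import ring lra zify.
Set Implicit Arguments.
Unset Strict Implicit.
Unset Printing Implicit Defensive.
Import Order.TTheory GRing.Theory Num.Theory.
Import numFieldNormedType.Exports.
Local Open Scope classical_set_scope.
Local Open Scope ring_scope.
Local Open Scope complex_scope.

(** All sizes are powers of s = n^(1/96). On the unit circle |p'| is typically of order n^(3/2) =
    s^144 and |p''| of order n^(5/2) = s^240. A good root asks for |p'| at least L = s^137, a little
    below typical, and for |p''| / 2 at most s^272, a little below L^2; then |p| passes 1 at radius
    2 / L, before the quadratic term matters. Up to small powers of s, a disc of radius about delta
    has p and z p' both small with probability (L delta)^2 L^2 tau^4, so the tau / delta^2 discs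
    contribute about tau^5 L^4 bad ones whatever delta is; delta only has to make Taylor remainders
    over a disc negligible. The width tau is such that the s / tau roots lost outside the annulus
    are n / s in number.

    The net of discs is forced by the fact that roots are random while the Gaussian estimates hold
    at fixed points. In the upper bound the obstacle is that a component need not be relatively
    open; it is approached through clopen parts of the compact lemniscate. *)

Notation nc := Normc.normc.

(** * The modulus as a real-valued function *)

Section Modulus.
Variable R : realType.
Implicit Types (z w : R[i]) (x y : R).

Lemma normcEr z : `|z| = (nc z)%:C.
Proof. by []. Qed.

Lemma nc_ge0 z : 0 <= nc z.
Proof. by case: z => a b; exact: sqrtr_ge0. Qed.

Lemma nc0 : nc (0 : R[i]) = 0. Proof. exact: Normc.normc0. Qed.
Lemma nc1 : nc (1 : R[i]) = 1. Proof. exact: Normc.normc1. Qed.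
Lemma ncM z w : nc (z * w) = nc z * nc w. Proof. exact: Normc.normcM. Qed.
Lemma ncN z : nc (- z) = nc z. Proof. exact: normcN. Qed.
Lemma ncD z w : nc (z + w) <= nc z + nc w. Proof. exact: le_normcD. Qed.
Lemma ncV z : nc z^-1 = (nc z)^-1. Proof. exact: Normc.normcV. Qed.

Lemma nc_eq0 z : (nc z == 0) = (z == 0).
Proof. by apply/eqP/eqP => [/Normc.eq0_normc//|->]; rewrite nc0. Qed.

Lemma nc_gt0 z : (0 < nc z) = (z != 0).
Proof. by rewrite lt_def nc_ge0 andbT nc_eq0. Qed.

Lemma ncX z n : nc (z ^+ n) = nc z ^+ n.
Proof. by elim: n => [|n IH]; rewrite ?expr0 ?nc1// !exprS ncM IH. Qed.

Lemma ncBC z w : nc (z - w) = nc (w - z).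
Proof. by rewrite -ncN opprB. Qed.

Lemma ncB_tri z w u : nc (z - u) <= nc (z - w) + nc (w - u).
Proof. by rewrite (le_trans _ (ncD _ _))// addrA subrK. Qed.

Lemma ncB_ge z w : nc z - nc w <= nc (z + w).
Proof. by rewrite lerBlDr -(ncN w) -{1}(addrK w z) ncD. Qed.

Lemma ncB_ler z w : nc z - nc w <= nc (z - w).
Proof. by rewrite -(ncN w) ncB_ge. Qed.

Lemma nc_sum (I : Type) (r : seq I) (P : pred I) (F : I -> R[i]) :
  nc (\sum_(i <- r | P i) F i) <= \sum_(i <- r | P i) nc (F i).
Proof.
elim/big_ind2 : _ => //; first by rewrite nc0.
by move=> a b c d ab cd; rewrite (le_trans (ncD _ _))// lerD.
Qed.

Lemma nc_prod (I : Type) (r : seq I) (P : pred I) (F : I -> R[i]) :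
  nc (\prod_(i <- r | P i) F i) = \prod_(i <- r | P i) nc (F i).
Proof. by apply: (big_morph _ ncM nc1). Qed.

Lemma ncr x : nc (x%:C) = `|x|.
Proof. by rewrite /nc /= expr0n addr0 sqrtr_sqr. Qed.

Lemma ncsq z : nc z ^+ 2 = complex.Re z ^+ 2 + complex.Im z ^+ 2.
Proof. by case: z => a b; rewrite /nc sqr_sqrtr// addr_ge0// sqr_ge0. Qed.

Lemma nc_conj z : nc (z^*)%C = nc z.
Proof. by case: z => a b; rewrite /nc/= sqrrN. Qed.

Lemma nc_Re z : `|complex.Re z| <= nc z.
Proof.
by rewrite -ler_sqr ?nnegrE ?nc_ge0// ncsq real_normK ?num_real// lerDl sqr_ge0.
Qed.

Lemma nc_Im z : `|complex.Im z| <= nc z.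
Proof.
by rewrite -ler_sqr ?nnegrE ?nc_ge0// ncsq real_normK ?num_real// lerDr sqr_ge0.
Qed.

Lemma nc_le_ReIm z : nc z <= `|complex.Re z| + `|complex.Im z|.
Proof.
rewrite -ler_sqr ?nnegrE ?nc_ge0 ?addr_ge0// ncsq sqrrD !real_normK ?num_real//.
by rewrite addrAC lerDl mulrn_wge0// mulr_ge0.
Qed.

(** Balls of [R[i]] have a radius in [R[i]] itself; a positive one is real, so real radii
    suffice. *)
Lemma nbhs_ncP z (A : set R[i]) :
  nbhs z A <-> exists2 e : R, 0 < e & forall w, nc (z - w) < e -> A w.
Proof.
split.
  move=> /nbhs_ballP[e /= e0 eA].
  have er : e = (complex.Re e)%:C by rewrite RRe_real// gtr0_real.
  exists (complex.Re e); first by move: e0; rewrite er ltcR.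
  by move=> w zw; apply: eA; rewrite /ball/= normcEr er ltcR.
move=> [e e0 eA]; apply/nbhs_ballP; exists e%:C; first by rewrite /= ltcR.
by move=> w; rewrite /ball/= normcEr ltcR; exact: eA.
Qed.

End Modulus.

(** * Landau's inequality *)

Section Landau.
Variable R : realType.
Implicit Types (p q : {poly R[i]}) (z : R[i]).

(** For [size p <= N] this is the mean of |p|^2 over the unit circle, by Parseval. *)
Definition l2sq (N : nat) p : R := \sum_(i < N) nc p`_i ^+ 2.

Lemma l2sq_ge N p i : (size p <= N)%N -> nc p`_i ^+ 2 <= l2sq N p.
Proof.
move=> sN; have [iN|Ni] := ltnP i N.
  rewrite /l2sq (bigD1 (Ordinal iN))//= lerDl sumr_ge0// => j _.
  exact: sqr_ge0.
rewrite nth_default ?(leq_trans sN)// nc0 expr0n sumr_ge0// => j _.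
exact: sqr_ge0.
Qed.

(** Coefficient form of the identity behind Blaschke factors, |w - z| = |1 - conj(z) w| for |w| = 1;
    on consecutive coefficients the right side telescopes. *)
Let swap_step (a b z : R[i]) :
  nc (a - z * b) ^+ 2 - nc (b - z^*%C * a) ^+ 2 =
  (1 - nc z ^+ 2) * (nc a ^+ 2 - nc b ^+ 2).
Proof.
by rewrite !ncsq; case: a b z => [a1 a2] [b1 b2] [z1 z2] /=; ring.
Qed.

(* Reflecting a root in the unit circle preserves the l2 norm of the coefficients. *)
Lemma l2sq_swap N q z : (size q < N)%N ->
  l2sq N (q * ('X - z%:P)) = l2sq N (q * (1 - z^*%C%:P * 'X)).
Proof.
case: N => // N; rewrite ltnS => sN.
(* The telescoped sum leaves a single boundary term in the k-th coefficient of [q], which is zero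
   for k = N by the size of [q]. *)
suff H k : l2sq k.+1 (q * ('X - z%:P)) - l2sq k.+1 (q * (1 - z^*%C%:P * 'X)) =
    - (1 - nc z ^+ 2) * nc q`_k ^+ 2.
  by apply/eqP; rewrite -subr_eq0 H nth_default// nc0 expr0n mulr0.
have cl i : (q * ('X - z%:P))`_i = (if i == 0%N then 0 else q`_i.-1) - z * q`_i.
  by rewrite mulrBr coefB coefMX coefMC mulrC.
have cr i : (q * (1 - z^*%C%:P * 'X))`_i =
    q`_i - z^*%C * (if i == 0%N then 0 else q`_i.-1).
  by rewrite mulrBr mulr1 coefB mulrCA coefCM coefMX.
rewrite /l2sq; elim: k => [|k IH].
  rewrite !big_ord1 cl cr/= swap_step nc0; ring.
rewrite big_ord_recr [X in _ - X]big_ord_recr/=.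
rewrite opprD addrACA IH cl cr/= swap_step; ring.
Qed.

Lemma size_mul_prod_le2 q (rs : seq R[i]) (F : R[i] -> {poly R[i]}) :
  (forall z, size (F z) <= 2)%N ->
  (size (q * \prod_(z <- rs) F z)%R <= size q + size rs)%N.
Proof.
move=> sF; elim: rs q => [|z rs IH] q; first by rewrite big_nil mulr1 addn0.
rewrite big_cons mulrA (leq_trans (IH _))//= addnS -addSn leq_add2r.
rewrite (leq_trans (size_polyMleq _ _))//; move: (sF z).
by move: (size (F z)) (size q) => a b; lia.
Qed.

Let size_swap (z : R[i]) : (size (1 - z%:P * 'X)%R <= 2)%N.
Proof.
rewrite (leq_trans (size_polyD _ _))// geq_max size_polyN size_poly1/= mul_polyC.
by rewrite (leq_trans (size_scale_leq _ _))// size_polyX.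
Qed.

Lemma l2sq_swaps N q (rs : seq R[i]) : (size q + size rs <= N)%N ->
  l2sq N (q * \prod_(z <- rs) ('X - z%:P)) =
  l2sq N (q * \prod_(z <- rs) (1 - z^*%C%:P * 'X)).
Proof.
elim: rs q => [|z rs IH] q sN; first by rewrite !big_nil.
rewrite !big_cons mulrA mulrAC l2sq_swap; last first.
  rewrite (leq_ltn_trans (size_mul_prod_le2 _ _ _))//.
    by move=> u; rewrite size_XsubC.
  by move: sN => /=; lia.
rewrite mulrAC IH ?mulrA//.
rewrite (leq_trans _ sN)//= addnS -addSn leq_add2r.
rewrite (leq_trans (size_polyMleq _ _))//; move: (size_swap (z^*%C)).
by move: (size _) (size q) => a b; lia.
Qed.

(** Reflecting all of [rs] leaves [q] alone at the origin: the original constant coefficient is the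
    reflected one times the product of the |z|, and a single coefficient is at most the l2 norm. *)
Lemma landau_small N q (rs : seq R[i]) : (size q + size rs <= N)%N ->
  nc (q * \prod_(z <- rs) ('X - z%:P))`_0 ^+ 2 <=
  \prod_(z <- rs) nc z ^+ 2 * l2sq N (q * \prod_(z <- rs) ('X - z%:P)).
Proof.
move=> sN; rewrite l2sq_swaps//.
set g := q * \prod_(z <- rs) (1 - _).
have -> : nc (q * \prod_(z <- rs) ('X - z%:P))`_0 ^+ 2 =
    \prod_(z <- rs) nc z ^+ 2 * nc g`_0 ^+ 2.
  rewrite -!horner_coef0 /g !hornerM !horner_prod !ncM !exprMn mulrC; congr (_ * _).
    rewrite nc_prod -prodrXl; apply: eq_bigr => z _.
    by rewrite hornerXsubC sub0r ncN.
  rewrite big1 ?nc1 ?expr1n ?mulr1// => z _.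
  by rewrite !hornerE ?mulr0 ?subr0.
rewrite ler_wpM2l ?prodr_ge0// => [z _|]; first exact: sqr_ge0.
apply: l2sq_ge.
exact: leq_trans (size_mul_prod_le2 q rs (fun z => size_swap _)) sN.
Qed.

(** Dually, reflection multiplies the leading coefficient by the product of the |z|. *)
Lemma landau_large N q (rs : seq R[i]) : (size q + size rs <= N)%N ->
  nc (lead_coef q) ^+ 2 * \prod_(z <- rs) nc z ^+ 2 <=
  l2sq N (q * \prod_(z <- rs) ('X - z%:P)).
Proof.
move=> sN; rewrite l2sq_swaps//.
set g := q * \prod_(z <- rs) (1 - _).
(* A zero root reflects to the constant 1 and lowers the degree; the left side is then 0. *)
have [/hasP[z zrs /eqP z0]|] := boolP (has (fun z => z == 0) rs).
  rewrite (big_rem z)//= z0 nc0 expr0n mul0r mulr0 sumr_ge0// => i _.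
  exact: sqr_ge0.
move=> /hasPn rs0.
have -> : nc (lead_coef q) ^+ 2 * \prod_(z <- rs) nc z ^+ 2 =
    nc (lead_coef g) ^+ 2.
  rewrite lead_coefM ncM exprMn; congr (_ * _).
  rewrite lead_coef_prod nc_prod -prodrXl; apply: eq_big_seq => z /rs0 z0.
  rewrite addrC lead_coefDl ?lead_coefN ?ncN; last first.
    by rewrite size_polyN mul_polyC size_scale ?conjc_eq0// size_polyX size_poly1.
  by rewrite mul_polyC lead_coefZ lead_coefX mulr1 nc_conj.
apply: l2sq_ge.
exact: leq_trans (size_mul_prod_le2 q rs (fun z => size_swap _)) sN.
Qed.

Section Factored.
Variables (c : R[i]) (rs : seq R[i]).
Let p : {poly R[i]} := c *: \prod_(z <- rs) ('X - z%:P).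

Let split_roots (a : pred R[i]) : p =
  (c *: \prod_(z <- rs | ~~ a z) ('X - z%:P)) *
    \prod_(z <- seq.filter a rs) ('X - z%:P).
Proof. by rewrite /p (bigID a)/= big_filter -scalerAl mulrC. Qed.

Let size_split (a : pred R[i]) :
  (size (c *: \prod_(z <- rs | ~~ a z) ('X - z%:P))%R + size (seq.filter a rs) <=
   (size rs).+1)%N.
Proof.
rewrite (leq_trans (leq_add (size_scale_leq _ _) (leqnn _)))//.
rewrite -big_filter size_prod_XsubC !size_filter addSn addnC -(count_predC a rs).
by rewrite ltnS leq_add2l.
Qed.

(** Only the roots in the closed disc are reflected, the others stay in [q]. For [rho] < 1 this
    limits their number. *)
Lemma count_small_roots (rho : R) : 0 <= rho ->
  nc p.[0] ^+ 2 <=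
  rho ^+ (2 * count (fun z => nc z <= rho) rs) * l2sq (size rs).+1 p.
Proof.
move=> rho0; set a : pred R[i] := fun z => nc z <= rho.
rewrite horner_coef0 (split_roots a).
rewrite (le_trans (landau_small (size_split a)))// ler_wpM2r//.
  by apply: sumr_ge0 => i _; exact: sqr_ge0.
rewrite big_filter exprM -iter_mulr_1 -big_const_seq -[leRHS]/(\prod_(i <- rs | a i) rho ^+ 2).
by apply: ler_prod => z az; rewrite sqr_ge0/= lerXn2r// nnegrE ?nc_ge0.
Qed.

Lemma count_large_roots (rho : R) : 0 <= rho ->
  nc c ^+ 2 * rho ^+ (2 * count (fun z => rho <= nc z) rs) <=
  l2sq (size rs).+1 p.
Proof.
move=> rho0; set a : pred R[i] := fun z => rho <= nc z.
rewrite (split_roots a) (le_trans _ (landau_large (size_split a)))//.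
rewrite -big_filter lead_coefZ (monicP (monic_prod_XsubC _ _ _)) mulr1.
rewrite ler_wpM2l ?sqr_ge0// big_filter exprM.
rewrite -iter_mulr_1 -big_const_seq -[leLHS]/(\prod_(i <- rs | a i) rho ^+ 2).
by apply: ler_prod => z az; rewrite sqr_ge0/= lerXn2r// nnegrE ?nc_ge0.
Qed.

End Factored.
End Landau.

(** * Taylor coefficients and second-order expansion *)

Section Taylor.
Variable R : realType.
Implicit Types (p q : {poly R[i]}) (z h : R[i]).

(** This is p^(j)(z) / j!, so index 2 gives half of the second derivative. *)
Definition tcoef p z (j : nat) : R[i] := (p \Po ('X + z%:P))`_j.

Lemma tcoefE N p z j : (size p <= N)%N ->
  tcoef p z j = \sum_(l < N) p`_l * z ^+ (l - j) *+ 'C(l, j).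
Proof.
move=> sN; rewrite /tcoef comp_polyE coef_sum.
have co l : (('X + z%:P) ^+ l)`_j = z ^+ (l - j) *+ 'C(l, j).
  rewrite exprDn coef_sum.
  have E (i : nat) : ('X^(l - i) * z%:P ^+ i *+ 'C(l, i) : {poly R[i]})`_j =
      (z ^+ i *+ 'C(l, i)) * ((j == l - i)%N)%:R.
    by rewrite -rmorphXn coefMn coefMC coefXn mulrC mulrnAl.
  under eq_bigr do rewrite E.
  have [lj|jl] := ltnP l j.
    rewrite bin_small// mulr0n big1// => i _.
    by rewrite (_ : (j == l - i)%N = false) ?mulr0//; apply/eqP; lia.
  have li : (l - j < l.+1)%N by rewrite ltnS leq_subr.
  rewrite (bigD1 (Ordinal li))//= big1 ?addr0; last first.
    move=> i /eqP iE; rewrite (_ : (j == l - i)%N = false) ?mulr0//.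
    apply/eqP => jE; apply: iE; apply/val_inj => /=.
    by have := ltn_ord i; lia.
  by rewrite subKn// eqxx mulr1 bin_sub.
transitivity (\sum_(l < size p) p`_l * z ^+ (l - j) *+ 'C(l, j)).
  by apply: eq_bigr => l _; rewrite coefZ co mulrnAr.
rewrite (big_ord_widen _ (fun l => p`_l * z ^+ (l - j) *+ 'C(l, j)) sN).
rewrite big_mkcond/=; apply: eq_bigr => l _; case: ifPn => //.
by rewrite -leqNgt => /(nth_default 0) ->; rewrite mul0r mul0rn.
Qed.

Lemma tcoef0 p z : tcoef p z 0 = p.[z].
Proof. by rewrite /tcoef -horner_coef0 horner_comp !hornerE. Qed.

Lemma size_shift p z : size (p \Po ('X + z%:P)) = size p.
Proof. by rewrite size_comp_poly2// size_XaddC. Qed.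

Lemma tcoefD N p z h j : (size p <= N)%N ->
  tcoef p (z + h) j = \sum_(l < N) tcoef p z l * h ^+ (l - j) *+ 'C(l, j).
Proof.
move=> sN; rewrite -(@tcoefE _ (p \Po ('X + z%:P))) ?size_shift//.
rewrite /tcoef -comp_polyA comp_polyD comp_polyX comp_polyC.
by rewrite -addrA -polyCD (addrC h).
Qed.

(** The right side is the majorant with coefficients |p_l| at |z| + r; the binomial theorem expands
    it around |z|. *)
Lemma sum_tcoef_le N p z (r : R) : 0 <= r -> (size p <= N)%N ->
  \sum_(k < N) nc (tcoef p z k) * r ^+ k <=
  \sum_(l < N) nc p`_l * (nc z + r) ^+ l.
Proof.
move=> r0 sN.
apply: (@le_trans _ _ (\sum_(k < N) \sum_(l < N)
    nc p`_l * (nc z ^+ (l - k) * r ^+ k *+ 'C(l, k)))).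
  apply: ler_sum => k _; rewrite (tcoefE _ _ sN).
  rewrite (le_trans (ler_wpM2r _ (nc_sum _ _ _)))// ?exprn_ge0// mulr_suml.
  apply: ler_sum => l _; rewrite normcMn ncM ncX.
  by rewrite mulrnAl mulrnAr mulrA.
rewrite exchange_big/=; apply: ler_sum => l _; rewrite -mulr_sumr.
rewrite ler_wpM2l ?nc_ge0// exprDn -(big_mkord xpredT (fun k =>
  nc z ^+ (l - k) * r ^+ k *+ 'C(l, k))) (big_cat_nat (leq0n _) (ltn_ord l))/=.
rewrite big_mkord [X in _ + X]big_nat [X in _ + X]big1 ?addr0// => i /andP[li _].
by rewrite bin_small.
Qed.

(** Each tail term, of index l >= 3, is compared with r^l: the bounds C(l, j) <= 2^l and 2 |h| <= r
    leave the factor 8 = 2^3. *)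
Lemma tcoefD_approx N p z h (r M : R) j : (size p <= N)%N -> (j < 3)%N ->
  0 < r -> nc h *+ 2 <= r ->
  \sum_(k < N) nc (tcoef p z k) * r ^+ k <= M ->
  nc (tcoef p (z + h) j - \sum_(l < 3) tcoef p z l * h ^+ (l - j) *+ 'C(l, j)) <=
  8 * nc h ^+ (3 - j) / r ^+ 3 * M.
Proof.
move=> sN j3 r0 hr sM; have r0' := ltW r0.
have [N3|N3] := leqP N 3.
  rewrite (@tcoefD 3)//; last exact: leq_trans sN N3.
  rewrite subrr nc0 mulr_ge0 ?divr_ge0 ?mulr_ge0 ?exprn_ge0 ?nc_ge0//.
  apply: le_trans sM; apply: sumr_ge0 => k _.
  by rewrite mulr_ge0 ?nc_ge0 ?exprn_ge0// ltW.
rewrite (tcoefD _ _ _ sN).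
rewrite -(big_mkord xpredT (fun l => tcoef p z l * h ^+ (l - j) *+ 'C(l, j))).
rewrite (big_cat_nat (leq0n 3) (ltnW N3))/= big_mkord addrAC subrr add0r.
rewrite (le_trans (nc_sum _ _ _))//.
apply: (@le_trans _ _ (\sum_(3 <= l < N)
   8 * nc h ^+ (3 - j) / r ^+ 3 * (nc (tcoef p z l) * r ^+ l))).
  rewrite big_nat [leRHS]big_nat; apply: ler_sum => l /andP[l3 lN].
  rewrite normcMn ncM ncX -[leLHS]mulr_natr -[leLHS]mulrA [leRHS]mulrCA ler_wpM2l ?nc_ge0//.
  have jl : (j <= l)%N by lia.
  apply: (@le_trans _ _ (nc h ^+ (l - j) * 2 ^+ l)).
    rewrite ler_wpM2l ?exprn_ge0 ?nc_ge0//.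
    rewrite -natrX ler_nat.
    rewrite -[2%N]/(1 + 1)%N expnDn (bigD1 (Ordinal (jl : (j < l.+1)%N)))//=.
    by rewrite !exp1n !muln1 leq_addr.
  rewrite (_ : (l - j = (3 - j) + (l - 3))%N); last lia.
  rewrite (_ : 2 ^+ l = 2 ^+ 3 * 2 ^+ (l - 3) :> R); last first.
    by rewrite -exprD; congr (_ ^+ _); lia.
  rewrite (_ : r ^+ l = r ^+ 3 * r ^+ (l - 3) :> R); last first.
    by rewrite -exprD; congr (_ ^+ _); lia.
  rewrite exprD.
  rewrite [leLHS](_ : _ = 8 * nc h ^+ (3 - j) * (2 * nc h) ^+ (l - 3)); last first.
    rewrite exprMn; move: (nc h ^+ _) (nc h ^+ _) (2 ^+ (l - 3)) => a b c; ring.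
  rewrite [leRHS]mulrA divfK ?expf_neq0 ?gt_eqF//.
  rewrite ler_wpM2l ?mulr_ge0 ?exprn_ge0 ?nc_ge0//.
  by rewrite lerXn2r ?nnegrE ?mulr_ge0 ?nc_ge0// mulr_natl.
rewrite -mulr_sumr ler_wpM2l ?divr_ge0 ?mulr_ge0 ?exprn_ge0 ?nc_ge0 ?(ltW r0)//.
apply: le_trans sM.
rewrite -(big_mkord xpredT (fun l => nc (tcoef p z l) * r ^+ l)).
rewrite [leRHS](big_cat_nat (leq0n 3) (ltnW N3))/= lerDr sumr_ge0// => k _.
by rewrite mulr_ge0 ?nc_ge0 ?exprn_ge0// ltW.
Qed.

End Taylor.

(** * Good roots and bad cells *)

Section Weight.
Variable R : realType.
Implicit Types (p q : {poly R[i]}) (z h : R[i]).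

(** The growth of a polynomial of degree n with bounded coefficients. Measuring every size against
    it makes the estimates uniform inside and outside the unit circle. *)
Definition wgt (n : nat) z : R := Num.max 1 (nc z) ^+ n.

Lemma wgt_ge1 n z : 1 <= wgt n z.
Proof. by rewrite exprn_ege1// le_max lexx. Qed.

Lemma wgt_gt0 n z : 0 < wgt n z.
Proof. exact: lt_le_trans (wgt_ge1 n z). Qed.

Lemma expr_onephalf n (x : R) : 0 <= x -> n%:R * x <= 1 -> (1 + x) ^+ n <= 4.
Proof.
move=> x0 nx.
have e4 : expR 1 <= 4 :> R.
  have : 1 - 2^-1 <= expR (- 2^-1) :> R by have := @expR_ge1Dx R (- 2^-1).
  rewrite expRN (_ : 1 - 2^-1 = 2^-1 :> R); last by lra.
  rewrite lef_pV2 ?posrE ?expR_gt0// => e2.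
  rewrite [X in expR X](_ : _ = 2^-1 + 2^-1); last by lra.
  have := ler_pM (expR_ge0 _) (expR_ge0 _) e2 e2; rewrite expRD.
  by move/le_trans; apply; lra.
apply: le_trans e4; rewrite (le_trans (lerXn2r n _ _ (expR_ge1Dx x)))//.
- by rewrite nnegrE addr_ge0.
- by rewrite nnegrE expR_ge0.
- by rewrite -expRM_natl ler_expR mulr_natl -mulr_natl.
Qed.

Lemma max1D z (x : R) : 0 <= x ->
  Num.max 1 (nc z + x) <= Num.max 1 (nc z) * (1 + x).
Proof.
move=> x0; have m1 : 1 <= Num.max 1 (nc z) by rewrite le_max lexx.
have mz : nc z <= Num.max 1 (nc z) by rewrite le_max lexx orbT.
rewrite ge_max; apply/andP; split; nra.
Qed.

(** A shift by |h| <= 1 / n costs at most (1 + |h|)^n <= e <= 4. *)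
Lemma wgtD n z h : n%:R * nc h <= 1 -> wgt n (z + h) <= 4 * wgt n z.
Proof.
move=> nh; apply: (@le_trans _ _ ((Num.max 1 (nc z) * (1 + nc h)) ^+ n)).
  rewrite lerXn2r ?nnegrE ?mulr_ge0 ?le_max ?ler01 ?addr_ge0 ?nc_ge0//.
  apply: le_trans (max1D _ (nc_ge0 _)).
  by rewrite ge_max !le_max lexx ncD orbT.
rewrite exprMn mulrC ler_wpM2r ?exprn_ge0 ?le_max ?ler01//.
by apply: expr_onephalf => //; exact: nc_ge0.
Qed.

(** At radius 1 / n the weight grows by a bounded factor only; this is the bound M fed to
    [tcoefD_approx]. *)
Lemma sum_tcoef_wgt n p z : (0 < n)%N -> (size p <= n.+1)%N ->
  \sum_(k < n.+1) nc (tcoef p z k) * n%:R^-1 ^+ k <=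
  4 * (\sum_(l < n.+1) nc p`_l) * wgt n z.
Proof.
move=> n0 sp; rewrite (le_trans (sum_tcoef_le _ _ sp))// ?invr_ge0//.
rewrite mulrAC mulr_sumr; apply: ler_sum => l _; rewrite mulrC.
rewrite ler_wpM2r ?nc_ge0//.
apply: (@le_trans _ _ (Num.max 1 (nc z + n%:R^-1) ^+ n)).
  apply: (@le_trans _ _ (Num.max 1 (nc z + n%:R^-1) ^+ l)).
    by rewrite lerXn2r ?nnegrE ?le_max ?ler01 ?lexx ?addr_ge0 ?nc_ge0 ?orbT.
  by rewrite ler_weXn2l ?le_max ?lexx// -ltnS ltn_ord.
apply: (@le_trans _ _ ((Num.max 1 (nc z) * (1 + n%:R^-1)) ^+ n)).
  rewrite lerXn2r ?nnegrE ?mulr_ge0 ?le_max ?ler01 ?addr_ge0 ?nc_ge0//.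
  exact: max1D.
rewrite exprMn mulrC ler_wpM2r ?exprn_ge0 ?le_max ?ler01//.
by apply: expr_onephalf; rewrite ?divff ?invr_ge0// pnatr_eq0 -lt0n.
Qed.

Definition good_root n (L B : R) p z :=
  (L * wgt n z <= nc (tcoef p z 1)) && (nc (tcoef p z 2) <= B * wgt n z).

Section Cell.
Variables (n : nat) (p : {poly R[i]}) (L B A rho : R).
Hypotheses (n0 : (0 < n)%N) (sp : (size p <= n.+1)%N).
Hypotheses (L0 : 0 <= L) (B0 : 0 <= B) (rho0 : 0 <= rho).
Hypothesis (rhon : 2 * rho <= n%:R^-1).
Hypothesis (sA : 4 * \sum_(l < n.+1) nc p`_l <= A).

Let N := n%:R ^+ 3 : R.
Let A0 : 0 <= A.
Proof. by rewrite (le_trans _ sA)// mulr_ge0// sumr_ge0// => *; exact: nc_ge0. Qed.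

Let approx z h j : (j < 3)%N -> nc h <= rho ->
  nc (tcoef p (z + h) j - \sum_(l < 3) tcoef p z l * h ^+ (l - j) *+ 'C(l, j)) <=
  8 * nc h ^+ (3 - j) * N * (A * wgt n z).
Proof.
move=> j3 hr.
have ni0 : 0 < n%:R^-1 :> R by rewrite invr_gt0 ltr0n.
have hn : nc h *+ 2 <= n%:R^-1.
  by rewrite (le_trans _ rhon)// mulr2n mulr_natl mulr2n lerD.
have := @tcoefD_approx _ n.+1 p z h n%:R^-1 (A * wgt n z) j sp j3 ni0 hn.
rewrite -exprVn invrK; apply.
by rewrite (le_trans (sum_tcoef_wgt z n0 sp))// ler_wpM2r// ltW// wgt_gt0.
Qed.

Let mono h j : nc h <= rho -> nc h ^+ j <= rho ^+ j.
Proof. by move=> hr; rewrite lerXn2r ?nnegrE ?nc_ge0. Qed.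

(** Taylor expansion to order two at the root: the hypothesis makes the quadratic term and the
    remainder together at most a quarter of the linear term. *)
Lemma good_root_isolated z h : root p z -> good_root n L B p z -> nc h <= rho ->
  B * rho + 8 * A * rho ^+ 2 * N <= L / 4 ->
  3 / 4 * L * nc h <= nc p.[z + h].
Proof.
move=> /rootP pz /andP[gL gB] hr hyp.
have := @approx z h 0 isT hr.
rewrite !big_ord_recr big_ord0 /= !subn0 !bin0 !mulr1n !tcoef0 pz mul0r !add0r.
rewrite expr1 => ap.
set c1 := tcoef p z 1 in gL ap; set c2 := tcoef p z 2 in gB ap.
set W := wgt n z in gL gB ap.
have W1 : 1 <= W by exact: wgt_ge1.
set H := nc h in hr ap *; have H0 : 0 <= H by exact: nc_ge0.
have t1 : nc (c1 * h + c2 * h ^+ 2) - nc p.[z + h] <=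
    nc (p.[z + h] - (c1 * h + c2 * h ^+ 2)).
  by rewrite ncBC ncB_ler.
have t2 : nc (c1 * h) - nc (c2 * h ^+ 2) <= nc (c1 * h + c2 * h ^+ 2).
  exact: ncB_ge.
rewrite (ncM c1) (ncM c2) ncX -/H in t2.
have H2 : H ^+ 2 <= rho * H by rewrite expr2 ler_wpM2r.
have H3 : H ^+ 3 <= rho ^+ 2 * H.
  by rewrite (exprSr H 2) ler_wpM2r// lerXn2r.
have k1 : L * W * H <= nc c1 * H by rewrite ler_wpM2r.
have k2 : nc c2 * H ^+ 2 <= B * W * (rho * H).
  by rewrite ler_pM ?nc_ge0 ?exprn_ge0.
have k3 : 8 * H ^+ 3 * N * (A * W) <= 8 * (rho ^+ 2 * H) * N * (A * W).
  rewrite -subr_ge0 (_ : _ - _ = 8 * (rho ^+ 2 * H - H ^+ 3) * N * (A * W)).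
    by rewrite !mulr_ge0 ?subr_ge0// (le_trans ler01).
  by ring.
have k4 : W * H * (B * rho + 8 * A * rho ^+ 2 * N) <= W * H * (L / 4).
  by rewrite ler_wpM2l ?mulr_ge0// (le_trans ler01).
have k5 : 3 / 4 * L * H <= W * (3 / 4 * L * H).
  by rewrite ler_peMl// !mulr_ge0.
lra.
Qed.

(** Transfers the failure at the unknown root [zeta] to the fixed centre [z], where probabilities
    are estimated. A small derivative at a root makes p and p' small nearby, while a huge second
    derivative stays huge; the factors 4 compare the weights at the two points. *)
Lemma bad_root_cell zeta z : root p zeta -> ~~ good_root n L B p zeta ->
  nc (z - zeta) <= rho -> 8 * A * rho * N <= B ->
  (nc p.[z] <= 4 * (L * rho + B * rho ^+ 2 + 8 * A * rho ^+ 3 * N) * wgt n z /\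
   nc (tcoef p z 1) <= 4 * (L + 2 * B * rho + 8 * A * rho ^+ 2 * N) * wgt n z) \/
  (B - 8 * A * rho * N) / 4 * wgt n z <= nc (tcoef p z 2).
Proof.
move=> /rootP pz bad hr hyp; set h := z - zeta.
have zE : z = zeta + h by rewrite /h addrC subrK.
set W := wgt n zeta; set V := wgt n z; set H := nc h in hr *.
have H0 : 0 <= H by exact: nc_ge0.
have W1 : 1 <= W by exact: wgt_ge1.
have V1 : 1 <= V by exact: wgt_ge1.
have nH : n%:R * H <= 1.
  rewrite -(@ler_pM2l _ n%:R^-1) ?invr_gt0 ?ltr0n// mulKf ?pnatr_eq0 -?lt0n//.
  rewrite mulr1; apply: le_trans rhon; rewrite mulr_natl mulr2n.
  by rewrite (le_trans hr)// lerDl.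
have VW : V <= 4 * W by rewrite /V zE wgtD.
have WV : W <= 4 * V.
  by rewrite /W (_ : zeta = z + (- h)) ?wgtD ?ncN// zE addrK.
have e0 := @approx zeta h 0 isT hr.
have e1 := @approx zeta h 1 isT hr.
have e2 := @approx zeta h 2 isT hr.
move: e0 e1 e2; rewrite -zE -/W.
rewrite !big_ord_recr !big_ord0 /= ?subn0 ?bin0 ?bin1 ?binn ?bin0n ?mulr1n ?mulr0n
  !tcoef0 pz !mul0r !add0r ?expr1 ?expr0 ?mulr1.
set c1 := tcoef p zeta 1; set c2 := tcoef p zeta 2 => e0 e1 e2.
have W0 : 0 <= W by exact: le_trans ler01 W1.
have kN j : 8 * nc h ^+ j * N * (A * W) <= 8 * rho ^+ j * N * (A * W).
  rewrite -subr_ge0 (_ : _ - _ = 8 * (rho ^+ j - nc h ^+ j) * N * (A * W)).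
    by rewrite !mulr_ge0 ?subr_ge0 ?mono.
  by ring.
have k0 := kN 3; have k1 := kN 2; have k2 := kN 1.
rewrite !expr1 in k2; rewrite subn1/= in e1.
have [cB|Bc] := leP (nc c2) (B * W); last first.
  right; have : nc c2 - nc (tcoef p z 2) <= nc (tcoef p z 2 - c2).
    by rewrite ncBC ncB_ler.
  have : (B - 8 * A * rho * N) * V <= (B - 8 * A * rho * N) * (4 * W).
    by rewrite ler_wpM2l// subr_ge0.
  by move=> *; lra.
left.
have cL : nc c1 <= L * W.
  rewrite leNgt; apply/negP => /ltW cL; move: bad.
  by rewrite /good_root -/c1 -/c2 -/W cB cL.
have E : 0 <= 4 * V - W by rewrite subr_ge0.
have c1h : nc (c1 * h) <= L * W * rho by rewrite ncM ler_pM ?nc_ge0.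
have c2h : nc (c2 * h ^+ 2) <= B * W * rho ^+ 2.
  by rewrite ncM ncX ler_pM ?nc_ge0 ?exprn_ge0 ?nc_ge0 ?mono.
have c2h2 : nc (c2 * h *+ 2) <= 2 * (B * W * rho).
  by rewrite normcMn mulr2n mulr_natl mulr2n ncM lerD// ler_pM ?nc_ge0.
split.
  have : nc p.[z] <= nc (p.[z] - (c1 * h + c2 * h ^+ 2)) +
      (nc (c1 * h) + nc (c2 * h ^+ 2)).
    rewrite -{1}(subrK (c1 * h + c2 * h ^+ 2) p.[z]).
    by rewrite (le_trans (ncD _ _))// lerD// ncD.
  have : 0 <= (L * rho + B * rho ^+ 2 + 8 * A * rho ^+ 3 * N) * (4 * V - W).
    by rewrite mulr_ge0// !addr_ge0 ?mulr_ge0 ?exprn_ge0.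
  by move=> *; clear kN; lra.
have : nc (tcoef p z 1) <= nc (tcoef p z 1 - (c1 + c2 * h *+ 2)) +
    (nc c1 + nc (c2 * h *+ 2)).
  rewrite -{1}(subrK (c1 + c2 * h *+ 2) (tcoef p z 1)).
  by rewrite (le_trans (ncD _ _))// lerD// ncD.
have : 0 <= (L + 2 * B * rho + 8 * A * rho ^+ 2 * N) * (4 * V - W).
  by rewrite mulr_ge0// !addr_ge0 ?mulr_ge0 ?exprn_ge0.
by move=> *; clear kN; lra.
Qed.

End Cell.
End Weight.

(** * Continuity, and one component around each isolated root *)

Section Topology.
Variable R : realType.
Implicit Types (p q : {poly R[i]}) (z h : R[i]).

Lemma continuous_nc : continuous (fun z : R[i] => nc z : R).
Proof.
move=> z A /nbhs_ballP[e e0 eA]; apply/nbhs_ncP; exists e => // w zw; apply: eA.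
rewrite /ball/= (le_lt_trans _ zw)// ler_norml ncB_ler andbT.
by rewrite lerNl opprB ncBC ncB_ler.
Qed.

Lemma continuous_Re : continuous (fun z : R[i] => complex.Re z : R).
Proof.
move=> z A /nbhs_ballP[e e0 eA]; apply/nbhs_ncP; exists e => // w zw; apply: eA.
rewrite /ball/= (le_lt_trans _ zw)// (le_trans _ (nc_Re _))//.
by case: z w {zw} => ? ? [].
Qed.

Lemma poly_lip p z h : nc h <= 1 -> nc (p.[z + h] - p.[z]) <=
  nc h * \sum_(k < size p) nc (tcoef p z k).
Proof.
move=> h1; rewrite -!tcoef0 (tcoefD z h 0 (leqnn _)).
have -> : tcoef p z 0 = \sum_(k < size p) (k == 0%N :> nat)%:R * tcoef p z k.
  case s : (size p) => [|n].
    by rewrite big_ord0 tcoef0 (eqP (_ : p == 0)) ?horner0 -?size_poly_eq0 ?s.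
  rewrite big_ord_recl/= mul1r big1 ?addr0// => i _; by rewrite mul0r.
rewrite -sumrB mulr_sumr (le_trans (nc_sum _ _ _))//; apply: ler_sum => -[[|k] kp] _.
  by rewrite /= subn0 expr0 bin0 mulr1 mulr1n mul1r subrr nc0 mulr_ge0// nc_ge0.
rewrite /= subn0 bin0 mulr1n mul0r subr0 ncM ncX mulrC ler_wpM2r ?nc_ge0//.
by rewrite exprS ler_piMr ?nc_ge0// exprn_ile1// nc_ge0.
Qed.

Lemma continuous_poly p : continuous (fun z : R[i] => p.[z]).
Proof.
move=> z A /nbhs_ncP[e e0 eA]; apply/nbhs_ncP.
set M := \sum_(k < size p) nc (tcoef p z k).
have M0 : 0 <= M by apply: sumr_ge0 => i _; exact: nc_ge0.
have M1 : 0 < M + 1 by rewrite ltr_wpDl.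
exists (Num.min 1 (e / (M + 1))); first by rewrite lt_min ltr01 divr_gt0.
move=> w; rewrite lt_min ncBC => /andP[w1 we]; apply: eA.
rewrite -{1}(subrK z w) (addrC _ z) ncBC.
apply: le_lt_trans (poly_lip p z (ltW w1)) _.
move: we; rewrite ltr_pdivlMr//; apply: le_lt_trans.
by rewrite ler_wpM2l ?nc_ge0// lerDl.
Qed.

Lemma lemniscateP p z : lemniscate p z <-> nc p.[z] = 1.
Proof.
rewrite /lemniscate/= normcEr.
by split=> [/(congr1 (@complex.Re R))|->].
Qed.

(** At distance between rho / 2 and rho from z the modulus exceeds 1, so the component of a
    lemniscate point near z is trapped in the disc of radius rho / 2. The growth hypothesis also
    keeps every other root of [gs] out of the disc of radius rho, so different roots trap different
    components. *)
Lemma betti0_ge p (gs : seq R[i]) (rho kappa : R) : uniq gs ->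
  0 < rho -> 1 < kappa * (rho / 2) ->
  {in gs, forall z, root p z} ->
  {in gs, forall z h, nc h <= rho -> kappa * nc h <= nc p.[z + h]} ->
  ((size gs)%:R%:E <= betti0 R (lemniscate p))%E.
Proof.
move=> ugs r0 kr gr gk.
have r20 : 0 < rho / 2 by rewrite divr_gt0.
have k0 : 0 < kappa by rewrite -(pmulr_lgt0 _ r20) (lt_trans ltr01).
have r2r : rho / 2 < rho by rewrite ltr_pdivrMr// ltr_pMr// ltr1n.
have close z y : z \in gs -> lemniscate p y -> nc (y - z) <= rho ->
    nc (y - z) < rho / 2.
  move=> zg /lemniscateP y1 yr; have := gk _ zg _ yr.
  rewrite (addrC z) subrK y1 => /le_lt_trans/(_ kr).
  by rewrite ltr_pM2l.
have ex z : exists x, z \in gs -> lemniscate p x /\ nc (x - z) <= rho.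
  have [zg|_] := boolP (z \in gs); last by exists 0.
  (* Along a horizontal segment from z the modulus rises from 0 past 1 within distance rho / 2. *)
  pose f (t : R) : R := nc p.[z + t%:C].
  have cf : continuous f.
    move=> t; apply: (@continuous_comp _ _ _ (fun t : R => p.[z + t%:C])).
      apply: (@continuous_comp _ _ _ (fun t : R => z + t%:C)).
        move=> A /nbhs_ncP[e e0 eA]; exists e => // u tu; apply: eA.
        by rewrite opprD addrACA subrr add0r -rmorphB ncr.
      exact: continuous_poly.
    exact: continuous_nc.
  have f0 : f 0 = 0 by rewrite /f addr0 (rootP (gr _ zg)) nc0.
  have fr : 1 < f (rho / 2).
    rewrite /f (lt_le_trans kr)// -{1}(ger0_norm (ltW r20)) -ncr.
    by apply: gk => //; rewrite ncr ger0_norm ltW.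
  have [||t] := @IVT R f 0 (rho / 2) 1 (ltW r20).
  - by apply: continuous_subspaceT.
  - by rewrite f0 ge_min ler01/= le_max (ltW fr) orbT.
  rewrite in_itv/= => /andP[t0 tr] ft1; exists (z + t%:C) => _.
  split; first exact/lemniscateP.
  by rewrite addrAC subrr add0r ncr ger0_norm// (le_trans tr)// ltW.
pose x z := projT1 (cid (ex z)).
have xP z : z \in gs -> lemniscate p (x z) /\ nc (x z - z) < rho / 2.
  move=> zg; have [a b] := projT2 (cid (ex z)) zg.
  by split => //; exact: close.
pose C z := connected_component (lemniscate p) (x z).
have CD z : z \in gs -> C z `<=` [set y | nc (y - z) < rho / 2].
  move=> zg; have [Lx xz] := xP z zg.
  have cz : continuous (fun y : R[i] => nc (y - z) : R).
    move=> y; apply: (@continuous_comp _ _ _ (fun y : R[i] => y - z)).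
      move=> A /nbhs_ncP[e e0 eA]; apply/nbhs_ncP; exists e => // u tu.
      by apply: eA; rewrite opprB addrA subrK.
    exact: continuous_nc.
  have CL : C z `<=` lemniscate p by exact: connected_component_sub.
  (* The component meets the open disc of radius rho / 2 and the closed disc of radius rho in the
     same set, which is therefore clopen in it. *)
  suff <- : C z `&` [set y | nc (y - z) < rho / 2] = C z by move=> y [].
  apply: (@component_connected _ (lemniscate p) (x z)).
  - by exists (x z); split => //; exact: connected_component_refl.
  - exists [set y | nc (y - z) < rho / 2] => //.
    apply: (@open_comp _ _ (fun y : R[i] => nc (y - z) : R) [set t | t < rho / 2]) => //.
  - exists [set y | nc (y - z) <= rho].
      apply: (@closed_comp _ _ (fun y : R[i] => nc (y - z) : R) [set t | t <= rho]) => //.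
    apply/seteqP; split => y [Cy yz]; split => //=.
      by rewrite (le_trans (ltW yz))// ltW.
    by apply: close => //; exact: CL.
have Cinj : {in gs &, injective C}.
  move=> z z' zg z'g CC; have [Lx xz] := xP z zg.
  have xz' : nc (x z - z') < rho / 2.
    by apply: (CD _ z'g); rewrite -CC; exact: connected_component_refl.
  have d : nc (z' - z) <= rho.
    rewrite (le_trans (ncB_tri _ (x z) _))// ncBC -(divfK (_ : 2 != 0) rho)//.
    by rewrite mulr_natr mulr2n lerD ?ltW.
  have := gk _ zg _ d; rewrite (addrC z) subrK (rootP (gr _ z'g)) nc0.
  by rewrite pmulr_rle0// le_eqVlt ltNge nc_ge0 orbF nc_eq0 subr_eq0 => /eqP.
rewrite /betti0 /counting; case: ifPn => [/asboolP fin|_]; last exact: leey.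
rewrite lee_fin ler_nat -(size_map C); apply: uniq_leq_size.
  by rewrite map_inj_in_uniq.
move=> _ /mapP[z zg ->]; rewrite in_fset_set// inE.
by exists (x z) => //; have [] := xP z zg.
Qed.
End Topology.

(** * At most one component per root of [p = 1] *)

Section QuasiComponent.
Variable T : topologicalType.
Hypothesis separation : forall A B : set T, closed A -> closed B ->
  A `&` B = set0 -> exists U V : set T,
  [/\ open U, open V, A `<=` U, B `<=` V & U `&` V = set0].
Hypothesis hT : hausdorff_space T.
Variable K : set T.
Hypothesis cK : compact K.

(** Clopen in the subspace [K]; both conditions are stated in [T] because [K] is closed. *)
Definition rel_clopen (U : set T) := [/\ U `<=` K, closed U & closed (K `\` U)].

Let clK : closed K. Proof. exact: compact_closed. Qed.

Lemma rel_clopenT : rel_clopen K.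
Proof. by split=> //; rewrite setDv; exact: closed0. Qed.

Lemma rel_clopenI U V : rel_clopen U -> rel_clopen V -> rel_clopen (U `&` V).
Proof.
move=> [UK cU cU'] [VK cV cV']; split.
- by move=> z [/UK].
- exact: closedI.
- by rewrite setDIr; exact: closedU.
Qed.

(** The quasi-component of x in [K]. *)
Let quasi x := [set z | K z /\ forall U, rel_clopen U -> U x -> U z].

Let closed_quasi x : closed (quasi x).
Proof.
have -> : quasi x = K `&` \bigcap_(U in [set U | rel_clopen U /\ U x]) U.
  apply/seteqP; split => z [Kz zU]; split => //.
    by move=> U [rU Ux]; exact: zU.
  by move=> U rU Ux; apply: zU.
by apply: closedI => //; apply: closed_bigI => U [[]].
Qed.

(** The heart of the classical fact that quasi-components of a compact Hausdorff space are
    connected: a splitting into closed sets A and B spreads to disjoint open sets, and from there to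
    a clopen set that contains x and misses B. *)
Let quasi_split x A B : K x -> closed A -> closed B -> A `&` B = set0 ->
  quasi x = A `|` B -> A x -> B = set0.
Proof.
move=> Kx cA cB AB0 QAB Ax.
have [V [W [oV oW AV BW VW0]]] := separation cA cB AB0.
pose Rm := K `\` (V `|` W).
have cR : compact Rm.
  apply: (subclosed_compact _ cK); last by move=> z [].
  by apply: closedI => //; apply: open_closedC; exact: openU.
(* By compactness of [Rm] a single clopen U avoids it; otherwise the traces of these U on [Rm]
   cluster at a point of the quasi-component outside V and W. *)
have [U [[UK cU cU'] Ux] UR] : exists2 U, rel_clopen U /\ U x & U `&` Rm = set0.
  apply: contrapT => /forall2NP noU.
  pose F := filter_from [set U | rel_clopen U /\ U x] (fun U => U `&` Rm).
  have FF : ProperFilter F.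
    apply: filter_from_proper.
      apply: filter_from_filter; first by exists K; split => //; exact: rel_clopenT.
      move=> U1 U2 [r1 x1] [r2 x2]; exists (U1 `&` U2).
        by split; [exact: rel_clopenI|].
      by move=> z [[z1 z2] zR].
    move=> U rU; have [//|/eqP/set0P//] := noU U.
  have [|z [Rz Fz]] := cR F FF.
    by exists K => [|z []//]; split => //; exact: rel_clopenT.
  have : quasi x z.
    split; first by case: Rz.
    move=> U rU Ux; have [_ cU _] := rU; apply: cU => N zN.
    have [|y [[Uy _] Ny]] := Fz (U `&` Rm) N _ zN; first by exists U.
    by exists y.
  by rewrite QAB => zAB; apply: Rz.2; case: zAB => [/AV|/BW]; [left|right].
have UVW z : U z -> V z \/ W z.
  move=> Uz; apply: contrapT => nVW.
  have : (U `&` Rm) z by split => //; split; [exact: UK|].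
  by rewrite UR.
(* Since U lies in the disjoint union of V and W, its part in V is its part outside W; hence this
   part and its complement are both closed. *)
have rUV : rel_clopen (U `&` V).
  have VW z : V z -> ~ W z.
    by move=> Vz Wz; have : (V `&` W) z by []; rewrite VW0.
  split; first by move=> z [/UK].
    have -> : U `&` V = U `&` ~` W.
      apply/seteqP; split => z [Uz zV]; split => //; first exact: VW.
      by have [] := UVW z Uz.
    by apply: closedI => //; exact: open_closedC.
  have -> : K `\` (U `&` V) = (K `\` U) `|` (U `&` ~` V).
    apply/seteqP; split => z.
      move=> [Kz nUV]; have [Uz|nU] := pselect (U z); last by left.
      by right; split => // Vz; exact: nUV.
    move=> [[Kz nU]|[Uz nV]]; first by split => // -[].
    by split; [exact: UK|case].
  by apply: closedU => //; apply: closedI => //; exact: open_closedC.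
apply/seteqP; split => // z Bz.
have [_ /(_ _ rUV)] : quasi x z by rewrite QAB; right.
case=> [|_ Vz]; first by split => //; exact: AV.
have : (V `&` W) z by split => //; exact: BW.
by rewrite VW0.
Qed.

(** The quasi-component of x is connected, hence contained in its component, so a point outside the
    component is cut off by one clopen set. *)
Lemma connected_component_rel_clopen x y : K x -> K y ->
  ~ connected_component K x y -> exists U, [/\ rel_clopen U, U x & ~ U y].
Proof.
move=> Kx Ky nxy; apply: contrapT => noU; apply: nxy.
have Qx : quasi x x by split.
exists (quasi x); last first.
  split => // U rU Ux; apply: contrapT => nUy; apply: noU; by exists U.
split => //; first by move=> z [].
move=> B [b Bb] [Q1 oQ1 BE1] [Q2 cQ2 BE2].
have cB : closed B by rewrite BE2; exact: closedI.
have cB' : closed (quasi x `\` B).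
  have -> : quasi x `\` B = quasi x `&` ~` Q1.
    by rewrite BE1; apply/seteqP; split => z [Qz nz]; split => // Q1z; apply: nz => //; case: Q1z.
  by apply: closedI => //; exact: open_closedC.
have BQ : B `<=` quasi x by rewrite BE2 => z [].
have QE : quasi x = B `|` (quasi x `\` B) by rewrite setDUK.
have [Bx|nBx] := pselect (B x).
  have := quasi_split Kx cB cB' _ QE Bx.
  rewrite setDIK => /(_ erefl) Q0.
  by rewrite QE Q0 setU0.
have := quasi_split Kx cB' cB _ _ _.
rewrite setIC setDIK setUC => /(_ erefl QE (conj Qx nBx)) B0.
by rewrite B0 in Bb.
Qed.

End QuasiComponent.

(** * Separation and compactness in the plane *)

Section ComplexSeparation.
Variable R : realType.

Lemma open_ncP (U : set R[i]) :
  open U <-> forall z, U z -> exists2 e : R, 0 < e & forall w, nc (z - w) < e -> U w.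
Proof.
rewrite openE; split => H z Uz; first by apply/nbhs_ncP; exact: H.
by apply/nbhs_ncP; exact: H.
Qed.

Lemma complex_separation (A B : set R[i]) : closed A -> closed B ->
  A `&` B = set0 -> exists U V : set R[i],
  [/\ open U, open V, A `<=` U, B `<=` V & U `&` V = set0].
Proof.
(* A union of balls about points of C with radius at most half the distance to D; the triangle
   inequality makes [far A B] and [far B A] disjoint. *)
pose far (C D : set R[i]) := [set z : R[i] | exists a (e : R),
  [/\ C a, 0 < e, forall b, D b -> e *+ 2 <= nc (a - b) & nc (a - z) < e]].
have far_open C D : open (far C D).
  apply/open_ncP => z [a [e [Ca e0 eD az]]]; exists (e - nc (a - z)).
    by rewrite subr_gt0.
  move=> w zw; exists a, e; split => //.
  by rewrite (le_lt_trans (ncB_tri _ z _))// -ltrBrDl.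
have sub_far (C D : set R[i]) : closed D -> C `&` D = set0 -> C `<=` far C D.
  move=> cD CD0 a Ca.
  have /open_ncP/(_ a)[|e e0 eD] := closed_openC cD.
    by move=> Da; have : (C `&` D) a by []; rewrite CD0.
  exists a, (e / 2); split => //; first by rewrite divr_gt0.
    move=> b Db; rewrite mulr2n -splitr leNgt; apply/negP => /eD.
    exact.
  by rewrite subrr nc0 divr_gt0.
move=> cA cB AB0; exists (far A B), (far B A); split => //.
- exact: sub_far.
- by apply: sub_far => //; rewrite setIC.
apply/seteqP; split => // z [[a [e [Aa e0 eB az]]] [b [f [Bb f0 fA bz]]]].
have := eB _ Bb; have := fA _ Aa; rewrite (ncBC b a).
have := ncB_tri a z b; rewrite (ncBC z b) !mulr2n => h1 h2 h3.
clear -h1 h2 h3 az bz; lra.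
Qed.

Lemma complex_hausdorff : hausdorff_space R[i].
Proof.
move=> x y xy; apply/eqP; rewrite -subr_eq0 -nc_eq0; apply: contrapT => /negP n0.
have e0 : 0 < nc (x - y) / 2 by rewrite divr_gt0// lt_def n0 nc_ge0.
have [||z [xz yz]] := xy [set z | nc (x - z) < nc (x - y) / 2]
                     [set z | nc (y - z) < nc (x - y) / 2].
- by apply/nbhs_ncP; exists (nc (x - y) / 2).
- by apply/nbhs_ncP; exists (nc (x - y) / 2).
have := ncB_tri x z y; rewrite (ncBC z y); move: xz yz => /= *; lra.
Qed.

Lemma complex_compact (K : set R[i]) (M : R) : closed K ->
  (forall z, K z -> nc z <= M) -> compact K.
Proof.
move=> cK KM; pose S := `[- M, M]%classic `*` `[- M, M]%classic : set (R * R).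
have cS : compact S by apply: compact_setX; exact: segment_compact.
have cf : continuous (fun x : R * R => (x.1 +i* x.2)%C : R[i]).
  move=> [a b] A /nbhs_ncP[e e0 eA].
  exists (ball a (e / 2), ball b (e / 2)).
    by split; apply: nbhsx_ballx; rewrite divr_gt0.
  move=> [c d] [/= ac bd]; apply: eA.
  rewrite (le_lt_trans (nc_le_ReIm _))//=.
  by move: ac bd; rewrite /ball/= => ac bd; lra.
have := continuous_compact (continuous_subspaceT cf) cS.
move=> cI; apply: (subclosed_compact cK cI) => -[a b] /KM ab.
exists (a, b) => //; split; rewrite /= in_itv/= -ler_norml (le_trans _ ab)//.
  exact: (nc_Re (a +i* b)%C).
exact: (nc_Im (a +i* b)%C).
Qed.

End ComplexSeparation.

(** * Open mapping, compactness of the lemniscate, and the upper bound *)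

Section UpperBound.
Variable R : realType.
Implicit Types (p q : {poly R[i]}) (z w h : R[i]).

Lemma lead_coef_subC p w : (1 < size p)%N -> lead_coef (p - w%:P) = lead_coef p.
Proof.
move=> sp; rewrite lead_coefDl// size_polyN.
exact: leq_ltn_trans (size_polyC_leq1 _) sp.
Qed.

Lemma size_subC p w : (1 < size p)%N -> size (p - w%:P) = size p.
Proof.
move=> sp; rewrite size_polyDl// size_polyN.
exact: leq_ltn_trans (size_polyC_leq1 _) sp.
Qed.

Lemma poly_prod_roots p w : (1 < size p)%N -> exists rs : seq R[i],
  size rs = (size p).-1 /\
  p - w%:P = lead_coef p *: \prod_(z <- rs) ('X - z%:P).
Proof.
move=> sp; have [rs rsE] := closed_field_poly_normal (p - w%:P).
exists rs; rewrite {1}rsE lead_coef_subC//; split => //.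
have l0 : lead_coef p != 0 by rewrite lead_coef_eq0 -size_poly_gt0 (ltn_trans _ sp).
by rewrite -(size_subC w sp) rsE lead_coef_subC// size_scale// size_prod_XsubC.
Qed.

(** If all roots of p - w were at distance at least e from z0, the factorisation would give |p(z0) -
    w| >= |lead| e^deg. *)
Lemma poly_open p z0 w (e : R) : (1 < size p)%N -> 0 < e ->
  nc (p.[z0] - w) < nc (lead_coef p) * e ^+ (size p).-1 ->
  exists z, p.[z] = w /\ nc (z0 - z) < e.
Proof.
move=> sp e0 we; have [rs [srs rsE]] := poly_prod_roots w sp.
have [/hasP[z zrs ze]|/hasPn far] := boolP (has (fun z => nc (z0 - z) < e) rs).
  exists z; split => //; apply/eqP; rewrite -subr_eq0.
  rewrite -[w in X in _ - X](hornerC w z) -hornerN -hornerD rsE.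
  by rewrite hornerZ horner_prod (big_rem z)//= hornerXsubC subrr mul0r mulr0.
exfalso; move: we; apply/negP; rewrite -leNgt.
rewrite -[w in leRHS](hornerC w z0) -hornerN -hornerD rsE hornerZ horner_prod.
rewrite ncM nc_prod ler_wpM2l ?nc_ge0// -srs.
rewrite -(count_predT rs) -iter_mulr_1 -big_const_seq big_seq [leRHS]big_seq.
apply: ler_prod => z zrs; rewrite (ltW e0) hornerXsubC/= leNgt.
exact: far.
Qed.

Lemma lemniscate_closed p : closed (lemniscate p).
Proof.
have -> : lemniscate p = (fun z : R[i] => nc p.[z] : R) @^-1` [set 1].
  by apply/seteqP; split => z /lemniscateP.
apply: closed_comp; last exact: closed_eq.
move=> z _; apply: (@continuous_comp _ _ _ (fun z : R[i] => p.[z])).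
  exact: continuous_poly.
exact: continuous_nc.
Qed.

Lemma lemniscate_compact p : (1 < size p)%N -> compact (lemniscate p).
Proof.
move=> sp; have [rs [srs rsE]] := poly_prod_roots 0 sp.
rewrite subr0 in rsE.
have l0 : 0 < nc (lead_coef p).
  by rewrite nc_gt0 lead_coef_eq0 -size_poly_gt0 (ltn_trans _ sp).
(* Chosen so that |lead| e > 1 and e >= 1: at distance at least e from every root, |p| >= |lead|
   e^deg > 1. *)
pose e := 1 + (nc (lead_coef p))^-1.
apply: (@complex_compact _ _ (\sum_(z <- rs) nc z + e) (@lemniscate_closed p)).
move=> z /lemniscateP z1; rewrite leNgt; apply/negP => ze.
have far x : x \in rs -> e <= nc (z - x).
  move=> xrs; rewrite leNgt; apply/negP => zx.
  have : nc z <= nc (z - x) + nc x by rewrite -{1}(subrK x z) ncD.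
  have : nc x <= \sum_(z <- rs) nc z.
    by rewrite (big_rem x)//= lerDl sumr_ge0// => *; exact: nc_ge0.
  by move=> h1 h2; clear -h1 h2 ze zx; lra.
have e1 : 1 <= e by rewrite lerDl invr_ge0 ltW.
suff : 1 < nc p.[z] by rewrite z1 ltxx.
rewrite rsE hornerZ ncM horner_prod nc_prod.
apply: (@lt_le_trans _ _ (nc (lead_coef p) * e ^+ (size rs))); last first.
  rewrite ler_wpM2l ?nc_ge0//.
  rewrite -(count_predT rs) -iter_mulr_1 -big_const_seq big_seq [leRHS]big_seq.
  apply: ler_prod => x xrs; rewrite (le_trans ler01 e1)/= hornerXsubC.
  exact: far.
apply: (@lt_le_trans _ _ (nc (lead_coef p) * e)).
  by rewrite mulrDr mulr1 divff ?gt_eqF// ltrDr.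
rewrite ler_wpM2l ?nc_ge0// -{1}(expr1 e) ler_weXn2l// srs.
by case: (size p) sp => [|[]].
Qed.

Lemma circle_Re_increase (w0 : R[i]) (eta : R) : nc w0 = 1 -> w0 != 1 ->
  0 < eta -> exists w, [/\ nc w = 1, complex.Re w0 < complex.Re w &
    nc (w0 - w) < eta].
Proof.
move=> w1 w01 e0; case: w0 w1 w01 => a b w1 w01.
have ab : a ^+ 2 + b ^+ 2 = 1 by have := ncsq (a +i* b)%C; rewrite w1 expr1n /= => <-.
have a1 : a < 1.
  rewrite ltNge; apply/negP => a1.
  have b0 : b = 0 by apply/eqP; rewrite -sqrf_eq0; apply/eqP; nra.
  have aE : a = 1 by rewrite b0 in ab; nra.
  by move: w01; rewrite aE b0 eqxx.
(* The rational rotation used below changes the real part by (- 2 a t^2 - 2 b t) / (1 + t^2). For b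
   nonzero, t is small of sign opposite to b; for b = 0 one has a = -1, and a small positive t
   works. *)
have [t [t0 t1 te tb]] : exists t : R, [/\ t != 0, `|t| <= 1, 5 * `|t| < eta &
    0 < - (2 * a * t ^+ 2) - 2 * b * t].
  have [b0|b0] := eqVneq b 0.
    exists (Num.min 1 (eta / 6)).
    have m0 : 0 < Num.min 1 (eta / 6) by rewrite lt_min ltr01 divr_gt0.
    have m1 : Num.min 1 (eta / 6) <= 1 by rewrite ge_min lexx.
    have m2 : Num.min 1 (eta / 6) <= eta / 6 by rewrite ge_min lexx orbT.
    rewrite gtr0_norm// gt_eqF//; split => //; first lra.
    rewrite b0 mulr0 mul0r subr0.
    have -> : a = -1 by rewrite b0 in ab; nra.
    by rewrite mulrN1 mulNr opprK mulr_gt0// exprn_gt0.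
  pose m := Num.min (`|b| / 2) (Num.min 1 (eta / 6)).
  have b1 : 0 < `|b| by rewrite normr_gt0.
  have m0 : 0 < m by rewrite !lt_min ltr01 !divr_gt0.
  have m1 : m <= 1 by rewrite !ge_min lexx orbT.
  have m2 : m <= eta / 6 by rewrite !ge_min lexx !orbT.
  have m3 : m <= `|b| / 2 by rewrite !ge_min lexx.
  exists (- Num.sg b * m).
  have nm : `|- Num.sg b * m| = m.
    by rewrite normrM normrN normr_sg b0 mul1r gtr0_norm.
  rewrite -normr_eq0 nm gt_eqF//; split => //; first lra.
  rewrite (_ : _ - _ =
    2 * m * (Num.sg b * b) - 2 * a * Num.sg b ^+ 2 * m ^+ 2); last by ring.
  rewrite -normrEsg sqr_sg b0 /= mulr1 -/m; clear -m0 m3 a1 b1; nra.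
exists ((a +i* b) * (((1 - t ^+ 2) / (1 + t ^+ 2)) +i* (2 * t / (1 + t ^+ 2))))%C.
have d0 : 0 < 1 + t ^+ 2 by rewrite ltr_wpDr// sqr_ge0.
have dn0 : 1 + t ^+ 2 != 0 by rewrite gt_eqF.
split.
- rewrite ncM w1 mul1r; apply/eqP.
  rewrite -(@eqrXn2 _ 2) ?nc_ge0// expr1n ncsq /=; apply/eqP; field.
  exact: dn0.
- rewrite /= -subr_gt0 (_ : _ - _ =
     (- (2 * a * t ^+ 2) - 2 * b * t) / (1 + t ^+ 2)); last by field.
  by rewrite divr_gt0.
rewrite -[X in nc (X - _)]mulr1 -mulrBr ncM w1 mul1r.
apply: le_lt_trans te; rewrite (le_trans (nc_le_ReIm _))//=.
rewrite sub0r normrN (_ : 1 - _ = t * (2 * t / (1 + t ^+ 2))); last by field.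
have nn : `|2 * t / (1 + t ^+ 2)| <= 2 * `|t|.
  rewrite normrM normrV ?unitfE// (gtr0_norm d0) normrM ger0_norm//.
  by rewrite ler_pdivrMr// ler_peMr ?mulr_ge0// lerDl sqr_ge0.
rewrite normrM; have := normr_ge0 t.
by have := normr_ge0 (2 * t / (1 + t ^+ 2)); nra.
Qed.

(** If the component of x contained no root of p = 1, each of these finitely many roots could be cut
    off by a clopen set around x; their intersection is a clopen part without such roots, on which
    Re p has no maximum. *)
Lemma component_hits_fiber1 p x : (1 < size p)%N -> lemniscate p x ->
  exists z, p.[z] = 1 /\ connected_component (lemniscate p) x z.
Proof.
move=> sp Lx; apply: contrapT => none.
have cL := lemniscate_compact sp.
have [rs [srs rsE]] := poly_prod_roots 1 sp.
have [U [[UL cU cU'] Ux Urs]] : exists U, [/\ rel_clopen (lemniscate p) U, U x &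
    forall z, z \in rs -> ~ U z].
  have : {subset rs <= [pred z | p.[z] == 1]}.
    move=> z zrs; rewrite inE -subr_eq0 -[1 in X in _ - X](hornerC 1 z).
    rewrite -hornerN -hornerD rsE hornerZ horner_prod (big_rem z)//=.
    by rewrite hornerXsubC subrr mul0r mulr0.
  elim: (rs) => [|z s IH] sub.
    by exists (lemniscate p); split => //; apply: rel_clopenT => //; exact: complex_hausdorff.
  have [|U [rU Ux Us]] := IH; first by move=> y ys; apply: sub; rewrite inE ys orbT.
  have /eqP pz : p.[z] == 1 by apply: sub; rewrite mem_head.
  have Lz : lemniscate p z by apply/lemniscateP; rewrite pz nc1.
  have [|V [rV Vx Vz]] := connected_component_rel_clopen (@complex_separation R)
    (@complex_hausdorff R) cL Lx Lz.
    by move=> xz; apply: none; exists z.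
  exists (U `&` V); split => //; first exact: rel_clopenI.
  by move=> y; rewrite inE => /predU1P[->|ys] [] // /(Us _ ys).
have cmU : compact U by apply: (subclosed_compact cU cL).
have [||z0 Uz0 zmax] := @compact_EVT_max _ R (fun z => complex.Re p.[z]) U _ cmU.
- by exists x.
- apply: continuous_subspaceT => z.
  apply: (@continuous_comp _ _ _ (fun z : R[i] => p.[z])).
    exact: continuous_poly.
  exact: continuous_Re.
rewrite inE in Uz0; have /lemniscateP z01 := UL _ Uz0.
(* The rest of the lemniscate is closed and misses z0, so a lemniscate point found near z0 must lie
   in U. *)
have [e e0 eU] : exists2 e : R, 0 < e & forall w, nc (z0 - w) < e -> ~ (lemniscate p `\` U) w.
  have /open_ncP := closed_openC cU'; apply; by case.
have l0 : 0 < nc (lead_coef p).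
  by rewrite nc_gt0 lead_coef_eq0 -size_poly_gt0 (ltn_trans _ sp).
have [||w [w1 Rw ww]] := @circle_Re_increase p.[z0]
    (nc (lead_coef p) * e ^+ (size p).-1) z01.
- apply/negP => /eqP pz; apply: (Urs z0) => //.
  have : root (p - 1%:P) z0 by rewrite /root !hornerE pz subrr.
  by rewrite rsE rootZ ?root_prod_XsubC// lead_coef_eq0 -size_poly_gt0 (ltn_trans _ sp).
- by rewrite mulr_gt0// exprn_gt0.
have [z [pz zz]] := poly_open sp e0 ww.
have Uz : U z.
  apply: contrapT => nU; apply: (eU z zz); split => //.
  by apply/lemniscateP; rewrite pz.
by have := zmax z; rewrite inE pz => /(_ Uz); rewrite leNgt Rw.
Qed.

Lemma counting_le (T : choiceType) (A : set T) (s : seq T) :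
  (forall x, A x -> x \in s) -> (counting A <= (size s)%:R%:E :> \bar R)%E.
Proof.
move=> As; have fA : finite_set A.
  by apply: (sub_finite_set _ (finite_seq s)) => x /As.
rewrite /counting asboolT// lee_fin ler_nat.
apply: uniq_leq_size; first exact: fset_uniq.
by move=> x; rewrite in_fset_set// inE; exact: As.
Qed.

Lemma complex_connected : connected [set: R[i]].
Proof.
have -> : [set: R[i]] =
    \bigcup_(z in [set: R[i]]) (fun t : R => t%:C * z) @` `[0, 1]%classic.
  apply/seteqP; split => // z _; exists z => //; exists 1.
    by rewrite /= in_itv/= ler01 lexx.
  by rewrite mul1r.
apply: bigcup_connected.
  by exists 0 => z _; exists 0; rewrite ?mul0r//= in_itv/= lexx ler01.
move=> z _; apply: connected_continuous_connected; first exact: segment_connected.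
apply: continuous_subspaceT => t A /nbhs_ncP[e e0 eA].
have z1 : 0 < nc z + 1 by rewrite ltr_wpDl// nc_ge0.
exists (e / (nc z + 1)); first by rewrite /= divr_gt0.
move=> u; rewrite /ball/= ltr_pdivlMr// => tu; apply: eA.
rewrite -mulrBl -rmorphB ncM ncr (le_lt_trans _ tu)// ler_wpM2l//.
by rewrite lerDl.
Qed.

Lemma betti0_le n p : (0 < n)%N -> (size p <= n.+1)%N ->
  (betti0 R (lemniscate p) <= n%:R%:E)%E.
Proof.
(* The bound covers constants too, whose lemniscate is empty or the whole, connected, plane. *)
move=> n0 sp; have [s1|s1] := leqP (size p) 1.
  apply: (@le_trans _ _ 1%:R%:E); last by rewrite lee_fin ler_nat.
  apply: (@counting_le _ _ [:: [set: R[i]]]) => _ [x Lx <-]; rewrite inE; apply/eqP.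
  have LT : lemniscate p = [set: R[i]].
    apply/seteqP; split => // z _; apply/lemniscateP.
    by move/lemniscateP : Lx; rewrite (size1_polyC s1) !hornerC.
  rewrite LT connected_component_id//; exact: complex_connected.
have [rs [srs rsE]] := poly_prod_roots 1 s1.
apply: (@le_trans _ _ (size rs)%:R%:E); last first.
  by rewrite lee_fin ler_nat srs -ltnS (leq_trans _ sp)// prednK// ltnW.
rewrite -(size_map (connected_component (lemniscate p))).
apply: counting_le => _ [x Lx <-].
have [z [pz xz]] := component_hits_fiber1 s1 Lx.
apply/mapP; exists z; last exact: same_connected_component.
have : root (p - 1%:P) z by rewrite /root !hornerE pz subrr.
by rewrite rsE rootZ ?root_prod_XsubC// lead_coef_eq0 -size_poly_gt0 (ltn_trans _ s1).
Qed.

End UpperBound.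

(** * Gaussian linear forms *)

Section Density.
Context d (T : measurableType d) (R : realType).
Local Open Scope ereal_scope.
Import HBNNSimple.

(** The density is given on measurable sets; simple functions and monotone convergence extend it to
    nonnegative integrands. *)
Lemma ge0_integral_density (mu nu : {measure set T -> \bar R}) (g : T -> R)
    (f : T -> \bar R) :
  measurable_fun setT g -> (forall x, 0 <= g x)%R ->
  (forall A, measurable A -> nu A = \int[mu]_(x in A) (g x)%:E) ->
  measurable_fun setT f -> (forall x, 0 <= f x) ->
  \int[nu]_x f x = \int[mu]_x (f x * (g x)%:E).
Proof.
move=> mg g0 nuE mf f0.
pose h := nnsfun_approx measurableT mf.
have hf x : (h n x)%:E @[n --> \oo] --> f x.
  by apply: cvg_nnsfun_approx => // y _; exact: f0.
have nd_h x : {homo (fun n => (h n x)%:E) : a b / (a <= b)%N >-> a <= b}.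
  by move=> a b ab; rewrite lee_fin; exact/lefP/nd_nnsfun_approx.
have mgE : measurable_fun setT (EFin \o g) by exact/measurable_EFinP.
have mhE n : measurable_fun setT (EFin \o h n) by exact/measurable_EFinP.
have -> : \int[nu]_x f x = limn (fun n => \int[nu]_x (h n x)%:E).
  rewrite -monotone_convergence//; last by move=> n x _; rewrite lee_fin.
  by apply: eq_integral => x _; apply/esym/cvg_lim => //; exact: hf.
have -> : \int[mu]_x (f x * (g x)%:E) =
    limn (fun n => \int[mu]_x ((h n x)%:E * (g x)%:E)).
  rewrite -monotone_convergence//; last 3 first.
  - by move=> n; exact: (emeasurable_funM (mhE n) mgE).
  - by move=> n x _; rewrite mule_ge0 ?lee_fin.
  - by move=> x _ a b ab; rewrite lee_wpmul2r ?lee_fin// -lee_fin; exact: nd_h.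
  apply: eq_integral => x _; apply/esym/cvg_lim => //.
  by apply: cvgeZr => //; exact: hf.
congr (limn _); apply/funext => n.
rewrite integralT_nnsfun sintegralE.
under eq_fsbigr => r _.
  rewrite nuE//; over.
transitivity (\int[mu]_x (\sum_(y \in range (h n))
    (y * \1_(h n @^-1` [set y]) x)%:E * (g x)%:E)); last first.
  apply: eq_integral => x _; rewrite [X in X%:E * _]fimfunE -fsumEFin//.
  by rewrite -ge0_mule_fsuml// => y; exact: nnfun_muleindic_ge0.
rewrite ge0_integral_fsum//; last 2 first.
- move=> y; apply: emeasurable_funM => //; apply/measurable_EFinP.
  exact: measurable_funM.
- by move=> y x _; rewrite mule_ge0 ?lee_fin// -lee_fin nnfun_muleindic_ge0.
apply: eq_fsbigr => r _.
have [r0|r0] := leP 0%R r; last first.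
  rewrite preimage_nnfun0// integral_set0 mule0.
  by rewrite integral0_eq// => x _; rewrite indicE in_set0 mulr0 mul0e.
under [RHS]eq_integral do rewrite EFinM -muleA muleC.
rewrite ge0_integralZr ?lee_fin//; last 2 first.
- apply: emeasurable_funM => //; apply/measurable_EFinP.
  exact: measurable_indic.
- by move=> x _; rewrite mule_ge0 ?lee_fin.
rewrite muleC; congr (_ * _).
rewrite (integral_mkcond _ (EFin \o g))/=; apply: eq_integral => x _.
by rewrite epatch_indic/= muleC.
Qed.

End Density.

Section GaussianIntegral.
Variable R : realType.
Notation mu := (@lebesgue_measure R).

Lemma integral_expR_quadratic (k h : R) : 0 < k ->
  (\int[mu]_x (expR (- (k * x ^+ 2 + 2 * h * x)))%:E =
   (Num.sqrt (pi / k) * expR (h ^+ 2 / k))%:E)%E.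
Proof.
(* Completing the square yields a multiple of the normal density with mean - h / k and variance 1 /
   (2 k). *)
move=> k0; pose s := Num.sqrt (2 * k)^-1; pose m := - h / k.
have kn0 : k != 0 by rewrite gt_eqF.
have s2 : s ^+ 2 = (2 * k)^-1 by rewrite sqr_sqrtr// invr_ge0 mulr_ge0// ltW.
have s0 : s != 0 by rewrite gt_eqF// sqrtr_gt0 invr_gt0 mulr_gt0.
have peakE : (normal_peak s)^-1 = Num.sqrt (pi / k).
  by rewrite /normal_peak invrK s2; congr Num.sqrt; field.
have peak0 : normal_peak s != 0 by rewrite gt_eqF// normal_peak_gt0.
under eq_integral => x _.
  rewrite (_ : expR _ = Num.sqrt (pi / k) * expR (h ^+ 2 / k) * normal_pdf m s x);
    last first.
    rewrite normal_pdfE// -peakE -[RHS]mulrA [X in _ = _ * X]mulrCA mulKf// -expRD s2.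
    by congr expR; rewrite /m; field.
  rewrite EFinM; over.
rewrite ge0_integralZl_EFin//.
- by rewrite integral_normal_pdf mule1.
- by move=> x _; rewrite lee_fin normal_pdf_ge0.
- by apply/measurable_EFinP; exact: measurable_normal_pdf.
Qed.

End GaussianIntegral.

(** * Measurability and the law of one complex Gaussian *)

Section ComplexMeasurability.
Variable R : realType.

Lemma measurable_Re : measurable_fun [set: R[i]] (@complex.Re R : R[i] -> R).
Proof. exact: (measurableT_comp measurable_fst measurable_complex_to_pair). Qed.

Lemma measurable_Im : measurable_fun [set: R[i]] (@complex.Im R : R[i] -> R).
Proof. exact: (measurableT_comp measurable_snd measurable_complex_to_pair). Qed.

Lemma measurable_nc : measurable_fun [set: R[i]] (fun z : R[i] => nc z : R).
Proof.
rewrite (_ : (fun _ => _) = fun z : R[i] =>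
    Num.sqrt (complex.Re z ^+ 2 + complex.Im z ^+ 2)); last first.
  by apply/funext => -[a b].
have ms : measurable_fun [set: R] (@Num.sqrt R : R -> R).
  by apply: continuous_measurable_fun => x; exact: sqrt_continuous.
apply: (measurableT_comp ms).
by apply: measurable_funD; apply: measurable_funX;
  [exact: measurable_Re|exact: measurable_Im].
Qed.

Lemma measurable_gaussian_pdf :
  measurable_fun [set: R[i]] (@complex_gaussian_pdf R).
Proof.
apply: measurable_funM => //; apply: measurableT_comp => //.
by apply: measurableT_comp => //; apply: measurable_funX; exact: measurable_nc.
Qed.

End ComplexMeasurability.

Section GaussianLaw.
Context d (T : measurableType d) (R : realType) (P : probability T R).
Notation mu := (@lebesgue_measure R).
Variable X : {RV P >-> R[i]}.
Hypothesis gX : std_complex_gaussian P X.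

Lemma ge0_integral_gaussian (f : R[i] -> \bar R) :
  measurable_fun [set: R[i]] f -> (forall z, 0 <= f z)%E ->
  (\int[distribution P X]_z f z = \int[mu]_x \int[mu]_y
    (f (x +i* y)%C * (pi^-1 * expR (- (x ^+ 2 + y ^+ 2)))%:E))%E.
Proof.
move=> mf f0.
have pdf0 z : 0 <= @complex_gaussian_pdf R z by rewrite mulr_ge0 ?invr_ge0 ?pi_ge0 ?expR_ge0.
rewrite (@ge0_integral_density _ _ _ (@complex_lebesgue_measure R) _
  (@complex_gaussian_pdf R))//; last exact: measurable_gaussian_pdf.
have mfg : measurable_fun [set: R[i]] (fun z => f z * (complex_gaussian_pdf z)%:E)%E.
  apply: emeasurable_funM => //; apply/measurable_EFinP.
  exact: measurable_gaussian_pdf.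
rewrite ge0_integral_pushforward//; last first.
  by move=> z _; rewrite mule_ge0// lee_fin.
rewrite preimage_setT.
set F := (X in (\int[_]_x X x = _)%E).
have mF : measurable_fun [set: measurableTypeR R * measurableTypeR R] F.
  by apply: measurableT_comp => //; exact: measurable_pair_to_complex.
have F0 x : (0 <= F x)%E by rewrite /F/= mule_ge0// lee_fin.
rewrite (fubini_tonelli1 _ mF F0).
apply: eq_integral => x _; rewrite /fubini_F; apply: eq_integral => y _.
by rewrite /F /= /complex_gaussian_pdf ncsq.
Qed.

End GaussianLaw.

Section ComplexMeasurableOps.
Context d (T : measurableType d) (R : realType).
Implicit Types f g : T -> R[i].

Lemma measurable_ReIm f :
  measurable_fun [set: T] (fun t => complex.Re (f t) : R) ->
  measurable_fun [set: T] (fun t => complex.Im (f t) : R) ->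
  measurable_fun [set: T] f.
Proof.
move=> mr mi; rewrite (_ : f = pair_to_complex \o
    (fun t => (complex.Re (f t), complex.Im (f t)))); last first.
  by apply/funext => t /=; rewrite /pair_to_complex/=; case: (f t).
apply: measurableT_comp; first exact: measurable_pair_to_complex.
exact: measurable_fun_pair.
Qed.

Lemma measurable_cadd f g : measurable_fun [set: T] f ->
  measurable_fun [set: T] g -> measurable_fun [set: T] (fun t => f t + g t).
Proof.
move=> mf mg; apply: measurable_ReIm.
- rewrite (_ : (fun _ => _) = fun t => complex.Re (f t) + complex.Re (g t)).
    by apply: measurable_funD; exact: (measurableT_comp (@measurable_Re R)).
  by apply/funext => t; case: (f t) (g t) => ? ? [].
- rewrite (_ : (fun _ => _) = fun t => complex.Im (f t) + complex.Im (g t)).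
    by apply: measurable_funD; exact: (measurableT_comp (@measurable_Im R)).
  by apply/funext => t; case: (f t) (g t) => ? ? [].
Qed.

Lemma measurable_cmul (c : R[i]) f : measurable_fun [set: T] f ->
  measurable_fun [set: T] (fun t => c * f t).
Proof.
move=> mf; apply: measurable_ReIm.
- rewrite (_ : (fun _ => _) = fun t =>
      complex.Re c * complex.Re (f t) - complex.Im c * complex.Im (f t)).
    apply: measurable_funB; apply: measurable_funM => //.
      exact: (measurableT_comp (@measurable_Re R)).
    exact: (measurableT_comp (@measurable_Im R)).
  by apply/funext => t; case: c (f t) => ? ? [].
- rewrite (_ : (fun _ => _) = fun t =>
      complex.Re c * complex.Im (f t) + complex.Im c * complex.Re (f t)).
    apply: measurable_funD; apply: measurable_funM => //.
      exact: (measurableT_comp (@measurable_Im R)).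
    exact: (measurableT_comp (@measurable_Re R)).
  by apply/funext => t; case: c (f t) => ? ? [].
Qed.

Lemma measurable_csum (I : Type) (r : seq I) (p : pred I) (F : I -> T -> R[i]) :
  (forall i, p i -> measurable_fun [set: T] (F i)) ->
  measurable_fun [set: T] (fun t => \sum_(i <- r | p i) F i t).
Proof.
move=> mF; elim: r => [|i r IH].
  rewrite (_ : (fun _ => _) = cst 0)//; last by apply/funext => t; rewrite big_nil.
rewrite (_ : (fun _ => _) = (fun t => (if p i then F i t else 0) + \sum_(j <- r | p j) F j t)).
  apply: measurable_cadd => //; case: (boolP (p i)) => [pi_i|_]; first exact: mF.
  exact: measurable_cst.
by apply/funext => t; rewrite big_cons; case: ifP; rewrite ?add0r.
Qed.

Lemma measurable_cnc f : measurable_fun [set: T] f ->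
  measurable_fun [set: T] (fun t => nc (f t) : R).
Proof. by move=> mf; exact: (measurableT_comp (@measurable_nc R)). Qed.

End ComplexMeasurableOps.

Section GaussianStep.
Context d (T : measurableType d) (R : realType) (P : probability T R).
Variable X : {RV P >-> R[i]}.
Hypothesis gX : std_complex_gaussian P X.

(** The integral met when one coefficient is averaged with the others fixed. The condition 1 + c > 0
    admits negative c: the value c = -1/2 gives the exponential moment of |X|^2 / 2. *)
Lemma gaussian_exp_quadratic (c h1 h2 A : R) : 0 < 1 + c ->
  (\int[distribution P X]_z (expR (- (c * nc z ^+ 2 +
      2 * (h1 * complex.Re z + h2 * complex.Im z) + A)))%:E =
   ((1 + c)^-1 * expR (- A + (h1 ^+ 2 + h2 ^+ 2) / (1 + c)))%:E)%E.
Proof.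
move=> c0.
have mF : measurable_fun [set: R[i]] (fun z => (expR (- (c * nc z ^+ 2 +
      2 * (h1 * complex.Re z + h2 * complex.Im z) + A)))%:E).
  apply/measurable_EFinP; apply: measurableT_comp => //.
  apply: measurableT_comp => //; apply: measurable_funD => //.
  apply: measurable_funD.
    apply: measurable_funM => //; apply: measurable_funX; exact: measurable_nc.
  apply: measurable_funM => //; apply: measurable_funD; apply: measurable_funM => //.
    exact: measurable_Re.
  exact: measurable_Im.
rewrite (ge0_integral_gaussian gX mF); last first.
  by move=> z; rewrite lee_fin expR_ge0.
pose q (h t : R) := expR (- ((1 + c) * t ^+ 2 + 2 * h * t)).
have mq h : measurable_fun [set: R] (EFin \o q h).
  apply/measurable_EFinP; apply: measurableT_comp => //.
  apply: measurableT_comp => //; apply: measurable_funD => //; apply: measurable_funM => //.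
have q0 h t : 0 <= q h t by exact: expR_ge0.
have iq h : (\int[@lebesgue_measure R]_t (q h t)%:E =
   (Num.sqrt (pi / (1 + c)) * expR (h ^+ 2 / (1 + c)))%:E)%E.
  exact: integral_expR_quadratic.
set I2 := Num.sqrt (pi / (1 + c)) * expR (h2 ^+ 2 / (1 + c)).
have I20 : 0 <= I2 by rewrite mulr_ge0 ?expR_ge0 ?sqrtr_ge0.
pose K := pi^-1 * expR (- A) : R.
have K0 : 0 <= K by rewrite mulr_ge0 ?invr_ge0 ?pi_ge0 ?expR_ge0.
have inner x : (\int[@lebesgue_measure R]_y
    ((expR (- (c * nc (x +i* y)%C ^+ 2 + 2 * (h1 * complex.Re (x +i* y)%C +
       h2 * complex.Im (x +i* y)%C) + A)))%:E *
     (pi^-1 * expR (- (x ^+ 2 + y ^+ 2)))%:E) = (K * I2 * q h1 x)%:E)%E.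
  transitivity (\int[@lebesgue_measure R]_y ((K * q h1 x)%:E * (q h2 y)%:E))%E.
    apply: eq_integral => y _; rewrite -!EFinM; congr EFin.
    rewrite ncsq /= mulrCA -expRD /K /q -!mulrA -!expRD; congr (_ * expR _).
    ring.
  rewrite ge0_integralZl_EFin//.
  - by rewrite iq -/I2 -EFinM mulrAC.
  - by move=> y _; rewrite lee_fin.
  - exact: mq.
  - by rewrite mulr_ge0.
under eq_integral => x _ do rewrite inner EFinM.
rewrite ge0_integralZl_EFin//; last 3 first.
- by move=> y _; rewrite lee_fin.
- exact: mq.
- by rewrite mulr_ge0.
rewrite iq -EFinM; congr EFin.
have pp : Num.sqrt (pi / (1 + c)) ^+ 2 = pi / (1 + c) :> R.
  by rewrite sqr_sqrtr// divr_ge0 ?pi_ge0// ltW.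
rewrite (_ : - A + _ = - A + (h1 ^+ 2 / (1 + c) + h2 ^+ 2 / (1 + c))); last first.
  by rewrite mulrDl.
rewrite [X in _ = _ * X]expRD (expRD (_ / _)) /K /I2.
rewrite [RHS](_ : _ = pi^-1 * (pi / (1 + c)) * (expR (- A) *
   (expR (h1 ^+ 2 / (1 + c)) * expR (h2 ^+ 2 / (1 + c))))); last first.
  by rewrite mulKf// gt_eqF// pi_gt0.
by move: pp; move: (Num.sqrt _) => r <-; ring.
Qed.

End GaussianStep.

(** * Independence of one coefficient from the earlier ones *)

Section IndependentPast.
Context d (T : measurableType d) (R : realType) (P : probability T R).
Context d' (V : measurableType d') (n : nat).
Variable a : 'I_n -> {RV P >-> V}.
Hypothesis a_indep : mutually_independent P a.

(** A pi-system that generates the sigma-algebra of the variables of index below k. *)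
Definition past_cylinder (k : 'I_n) : set (set T) :=
  [set E | exists B : 'I_n -> set V, (forall j, measurable (B j)) /\
     E = \bigcap_(j in [set j : 'I_n | (j < k)%N]) a j @^-1` B j].

Let past_measurable k : past_cylinder k `<=` measurable.
Proof.
move=> _ [B [mB ->]]; apply: fin_bigcap_measurable; first exact: finite_finset.
by move=> j _; rewrite -[X in measurable X]setTI; apply: measurable_funP.
Qed.

Let pastT k : past_cylinder k setT.
Proof.
exists (fun=> setT); split => //; apply/seteqP; split => // w _ j _ //.
Qed.

Let pastI k : setI_closed (past_cylinder k).
Proof.
move=> _ _ [B [mB ->]] [C [mC ->]]; exists (fun j => B j `&` C j); split.
  by move=> j; exact: measurableI.
by apply/seteqP; split => [w [wB wC] j jk|w wBC];
  [split; [exact: wB|exact: wC]|split=> j jk; have [] := wBC j jk].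
Qed.

Let P_cyl (J : {set 'I_n}) (B : 'I_n -> set V) : (forall j, measurable (B j)) ->
  P (\bigcap_(j in [set` J]) a j @^-1` B j) = (\prod_(j in J) P (a j @^-1` B j))%E.
Proof. by move=> mB; apply: a_indep. Qed.

(** As functions of E both sides are finite measures, and they agree on the pi-system of cylinders,
    hence on the sigma-algebra it generates. *)
Lemma past_independent (k : 'I_n) (A : set V) (E : set T) :
  measurable A -> <<s past_cylinder k >> E ->
  P (E `&` a k @^-1` A) = (P E * P (a k @^-1` A))%E.
Proof.
move=> mA sE.
have mkA : measurable (a k @^-1` A).
  by rewrite -[X in measurable X]setTI; apply: measurable_funP.
have pfin : P (a k @^-1` A) \is a fin_num by exact: fin_num_measure.
pose r := NngNum (fine_ge0 (measure_ge0 P (a k @^-1` A))).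
have UT : \bigcup_(i : nat) (fun=> setT : set T) i = setT.
  by apply/seteqP; split => // w _; exists 0%N.
have agree C : past_cylinder k C -> mrestr P mkA C = mscale r P C.
  move=> [B [mB ->]]; rewrite /mrestr /mscale/= fineK//.
  pose J := [set j : 'I_n | (j < k)%N]%SET.
  (* With A inserted as coordinate k, the intersection is again a finite cylinder and independence
     applies to it. *)
  pose B' j := if j == k then A else B j.
  have mB' j : measurable (B' j) by rewrite /B'; case: ifP.
  have -> : \bigcap_(j in [set j : 'I_n | (j < k)%N]) a j @^-1` B j =
      \bigcap_(j in [set` J]) a j @^-1` B j.
    apply/seteqP; split => w wB j jk.
      by have := wB j; apply; move: jk; rewrite /= inE.
    by have := wB j; apply; move: jk; rewrite /= inE.
  have -> : (\bigcap_(j in [set` J]) a j @^-1` B j) `&` a k @^-1` A =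
      \bigcap_(j in [set` (k |: J)%SET]) a j @^-1` B' j.
    apply/seteqP; split => w.
      move=> [wB wA] j /=; rewrite !inE /B' => /orP[/eqP ->|jk]; first by rewrite eqxx.
      by rewrite (ltn_eqF jk : (j == k) = false); apply: (wB j); rewrite /= inE.
    move=> wB; split => [j|].
      rewrite /= inE => jk; have := wB j; rewrite /= !inE jk orbT => /(_ isT).
      by rewrite /B' (ltn_eqF jk : (j == k) = false).
    by have := wB k; rewrite /= !inE eqxx => /(_ isT); rewrite /B' eqxx.
  rewrite !P_cyl// big_setU1/=; last by rewrite inE ltnn.
  congr (_ * _)%E; first by rewrite /B' eqxx.
  apply: eq_bigr => j; rewrite inE => jk.
  by rewrite /B' (ltn_eqF jk : (j == k) = false).
have fin (i : nat) : (mrestr P mkA ((fun=> setT) i) < +oo)%E.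
  rewrite /mrestr setTI.
  by rewrite ltey_eq fin_num_measure.
have := @g_sigma_algebra_measure_unique _ R T _
  (past_measurable (k:=k)) _ (fun=> pastT k) UT _ _ (pastI (k:=k)) agree fin E sE.
rewrite -[LHS]/(P (E `&` a k @^-1` A)).
rewrite -[RHS]/((fine (P (a k @^-1` A)))%:E * P E)%E fineK// => ->.
exact: muleC.
Qed.

Lemma measurable_past (k j : 'I_n) : (j < k)%N ->
  measurable_fun [set: g_sigma_algebraType (past_cylinder k)] (a j).
Proof.
move=> jk _ A mA; rewrite setTI; apply: sub_sigma_algebra.
exists (fun i => if i == j then A else setT); split; first by move=> i; case: ifP.
apply/seteqP; split => w.
  by move=> wA i _ /=; case: eqP => [->|//].
by move=> /(_ j jk) /=; rewrite eqxx.
Qed.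

(** The joint law of the past statistic [S] and of [a k] is the product of their laws, so Tonelli
    applies. *)
Lemma ge0_integral_past (k : 'I_n) d1 (S1 : measurableType d1) (S : T -> S1)
    (F : S1 * V -> \bar R) :
  measurable_fun [set: g_sigma_algebraType (past_cylinder k)] S ->
  measurable_fun [set: S1 * V] F -> (forall x, 0 <= F x)%E ->
  (\int[P]_w F (S w, a k w) = \int[P]_w \int[distribution P (a k)]_z F (S w, z))%E.
Proof.
move=> mS mF F0.
have mST : measurable_fun [set: T] S.
  move=> _ A mA; rewrite setTI.
  have := mS measurableT A mA; rewrite setTI.
  apply: smallest_sub; last exact: past_measurable.
  exact: sigma_algebra_measurable.
pose S' := HB.pack_for {mfun T >-> S1} S (isMeasurableFun.Build _ _ _ _ S mST).
pose ph w := (S w, a k w).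
have mph : measurable_fun [set: T] ph by apply: measurable_fun_pair.
pose ph' := HB.pack_for {mfun T >-> (S1 * V)%type} ph
  (isMeasurableFun.Build _ _ _ _ ph mph).
have lawE X : measurable X ->
    (distribution P S' \x distribution P (a k))%E X = distribution P ph' X.
  apply: product_measure_unique => A B mA mB.
  rewrite -[LHS]/(P (S @^-1` A `&` a k @^-1` B)).
  rewrite -[RHS]/(P (S @^-1` A) * P (a k @^-1` B))%E.
  apply: past_independent => //.
  by have := mS measurableT A mA; rewrite setTI.
transitivity (\int[distribution P ph']_x F x)%E.
  by rewrite ge0_integral_distribution.
rewrite (@eq_measure_integral _ _ _ _ (distribution P S' \x distribution P (a k))%E);
  last by move=> X mX _; first [exact: lawE|exact/esym/lawE].
rewrite fubini_tonelli1// ge0_integral_distribution//.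
  exact: measurable_fun_fubini_tonelli_F.
by move=> x; apply: integral_ge0 => y _.
Qed.

End IndependentPast.

(** * Laplace transform of a quadratic form in two linear forms *)

Section GaussianQuadraticForm.
Context d (T : measurableType d) (R : realType) (P : probability T R).
Variables (n : nat) (a : 'I_n -> {RV P >-> R[i]}).
Hypothesis a_indep : mutually_independent P a.
Hypothesis a_gauss : forall k, std_complex_gaussian P (a k).

(** The real quadratic form A |u|^2 + 2 B Re(u conj(v)) + C |v|^2. *)
Definition qform (A B C : R) (u v : R[i]) : R :=
  A * nc u ^+ 2 +
  2 * B * (complex.Re u * complex.Re v + complex.Im u * complex.Im v) +
  C * nc v ^+ 2.

Lemma measurable_qform d1 (S : measurableType d1) (A B C : R) (f g : S -> R[i]) :
  measurable_fun [set: S] f -> measurable_fun [set: S] g ->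
  measurable_fun [set: S] (fun t => (expR (- qform A B C (f t) (g t)))%:E).
Proof.
move=> mf mg; apply/measurable_EFinP; apply: measurableT_comp => //.
have mRe h : measurable_fun [set: S] h ->
    measurable_fun [set: S] (fun t => complex.Re (h t) : R).
  by move=> mh; exact: (measurableT_comp (@measurable_Re R)).
have mIm h : measurable_fun [set: S] h ->
    measurable_fun [set: S] (fun t => complex.Im (h t) : R).
  by move=> mh; exact: (measurableT_comp (@measurable_Im R)).
apply: measurableT_comp => //; apply: measurable_funD; last first.
  by apply: measurable_funM => //; apply: measurable_funX; exact: measurable_cnc.
apply: measurable_funD.
  by apply: measurable_funM => //; apply: measurable_funX; exact: measurable_cnc.
apply: measurable_funM => //.
by apply: measurable_funD; apply: measurable_funM; first [exact: mRe|exact: mIm].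
Qed.

(** Expansion in the new Gaussian z: a square, a linear and a constant term, the shape that
    [gaussian_exp_quadratic] integrates. *)
Lemma qform_shift (A B C c d0 : R) (u v om z : R[i]) :
  let g := nc om ^+ 2 in
  let q := (A * c + B * d0)%:C * u + (B * c + C * d0)%:C * v in
  qform A B C (u + c%:C * om * z) (v + d0%:C * om * z) =
  g * (A * c ^+ 2 + 2 * B * c * d0 + C * d0 ^+ 2) * nc z ^+ 2 +
  2 * (complex.Re (om^*%C * q) * complex.Re z +
       complex.Im (om^*%C * q) * complex.Im z) + qform A B C u v.
Proof.
rewrite /qform !ncsq; case: u v om z => [u1 u2] [v1 v2] [w1 w2] [z1 z2] /=.
ring.
Qed.

Section Fixed.
Variables (c d0 : 'I_n -> R) (om : 'I_n -> R[i]).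

Let U (e : 'I_n -> R) (k : nat) (w : T) : R[i] :=
  \sum_(j < n | (j < k)%N) (e j)%:C * om j * a j w.
Let S (e f : 'I_n -> R) (k : nat) : R :=
  \sum_(j < n | (j < k)%N) nc (om j) ^+ 2 * (e j * f j).

Let big_succ (M : zmodType) (F : 'I_n -> M) (k : 'I_n) :
  \sum_(j < n | (j < k.+1)%N) F j = \sum_(j < n | (j < k)%N) F j + F k.
Proof.
rewrite (bigD1 k)/= ?ltnSn// addrC; congr (_ + _).
by apply: eq_bigl => j; rewrite ltnS [RHS]ltn_neqAle andbC.
Qed.

Let measurable_U e k d1 (S1 : measurableType d1) (b : 'I_n -> S1 -> R[i]) :
  (forall j : 'I_n, (j < k)%N -> measurable_fun [set: S1] (b j)) ->
  measurable_fun [set: S1]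
    (fun t => \sum_(j < n | (j < k)%N) (e j)%:C * om j * b j t).
Proof.
by move=> mb; apply: measurable_csum => j jk; apply: measurable_cmul; exact: mb.
Qed.

(** The value is 1 / det(I + M G), where M is the matrix of the form and G the weighted Gram matrix
    of [c] and [d0] cut at index k. Averaging the last coefficient replaces M by another nonnegative
    matrix, so the induction has to run over all forms at once. *)
Let partial k : (k <= n)%N -> forall A B C : R, 0 <= A -> 0 <= C -> B ^+ 2 <= A * C ->
  (\int[P]_w (expR (- qform A B C (U c k w) (U d0 k w)))%:E =
  ((1 + A * S c c k + 2 * B * S c d0 k + C * S d0 d0 k +
    (A * C - B ^+ 2) * (S c c k * S d0 d0 k - S c d0 k ^+ 2))^-1)%:E)%E.
Proof.
elim: k => [|k IH] kn A B C A0 C0 BAC.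
  rewrite /S !big_pred0// !mulr0 expr0n !addr0 subr0 !mulr0 !addr0 invr1.
  have q0 : qform A B C 0 0 = 0 by rewrite /qform nc0 /=; ring.
  under eq_integral do rewrite /U !big_pred0// q0 oppr0 expR0.
  by rewrite integral_cst//= mul1e; exact: probability_setT.
pose i := Ordinal kn.
pose F (x : (R[i] * R[i]) * R[i]) := (expR (- qform A B C
  (x.1.1 + (c i)%:C * om i * x.2) (x.1.2 + (d0 i)%:C * om i * x.2)))%:E.
have mF : measurable_fun [set: (R[i] * R[i]) * R[i]] F.
  apply: measurable_qform; apply: measurable_cadd.
  - exact: (measurableT_comp measurable_fst measurable_fst).
  - by apply: measurable_cmul; exact: measurable_snd.
  - exact: (measurableT_comp measurable_snd measurable_fst).
  - by apply: measurable_cmul; exact: measurable_snd.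
have F0 x : (0 <= F x)%E by rewrite lee_fin expR_ge0.
pose Sk w := (U c k w, U d0 k w).
have mS : measurable_fun [set: g_sigma_algebraType (past_cylinder a i)] Sk.
  by apply: measurable_fun_pair; apply: measurable_U => j jk; exact: measurable_past.
transitivity (\int[P]_w F (Sk w, a i w))%E.
  by apply: eq_integral => w _; rewrite /U !(big_succ _ i).
rewrite (ge0_integral_past a_indep mS mF F0).
set g := nc (om i) ^+ 2.
have g0 : 0 <= g by exact: sqr_ge0.
pose s := g * (A * c i ^+ 2 + 2 * B * c i * d0 i + C * d0 i ^+ 2).
have s0 : 0 <= s.
  rewrite mulr_ge0//; have [Ae|An0] := eqVneq A 0.
    have -> : B = 0.
      by apply/eqP; rewrite -sqrf_eq0 eq_le sqr_ge0 andbT -(mul0r C) -Ae.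
    by rewrite Ae !(mul0r,mulr0,add0r) mulr_ge0// sqr_ge0.
  have Ap : 0 < A by rewrite lt_def An0.
  rewrite -(pmulr_rge0 _ Ap) [X in 0 <= X](_ : _ = (A * c i + B * d0 i) ^+ 2 +
    (A * C - B ^+ 2) * d0 i ^+ 2); last by ring.
  by rewrite addr_ge0 ?sqr_ge0// mulr_ge0 ?sqr_ge0// subr_ge0.
have s1 : 0 < 1 + s by rewrite ltr_wpDr.
pose q1 := A * c i + B * d0 i; pose q2 := B * c i + C * d0 i.
(* The averaged form is a rank one correction of M along M (c, d0), as in the Sherman-Morrison
   formula. *)
pose A' := A - g * q1 ^+ 2 / (1 + s).
pose B' := B - g * q1 * q2 / (1 + s).
pose C' := C - g * q2 ^+ 2 / (1 + s).
have inner u v : (\int[distribution P (a i)]_z F ((u, v), z) =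
    ((1 + s)^-1 * expR (- qform A' B' C' u v))%:E)%E.
  rewrite /F /=; under eq_integral do rewrite qform_shift.
  rewrite (gaussian_exp_quadratic (a_gauss i)) -/g -/s//; congr (_ * expR _)%:E.
  set q := _%:C * u + _.
  rewrite -!ncsq ncM nc_conj exprMn -/g.
  rewrite /q /qform !ncsq; case: u v {q} => [u1 u2] [v1 v2] /=.
  rewrite /A' /B' /C' -/q1 -/q2; field.
  by rewrite gt_eqF.
under eq_integral do rewrite inner EFinM.
have mk e : measurable_fun [set: T] (U e k).
  apply: measurable_U => j _; exact: measurable_funP.
rewrite ge0_integralZl_EFin//; last 2 first.
- by apply: measurable_qform; exact: mk.
- by rewrite invr_ge0 ltW.
have sn0 : 1 + s != 0 by rewrite gt_eqF.
have A'E : (1 + s) * A' = A + g * (A * C - B ^+ 2) * d0 i ^+ 2.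
  by rewrite mulrBr mulrC (mulrC (1 + s) (_ / _)) divfK// /s /q1; ring.
have B'E : (1 + s) * B' = B - g * (A * C - B ^+ 2) * c i * d0 i.
  by rewrite mulrBr mulrC (mulrC (1 + s) (_ / _)) divfK// /s /q1 /q2; ring.
have C'E : (1 + s) * C' = C + g * (A * C - B ^+ 2) * c i ^+ 2.
  by rewrite mulrBr mulrC (mulrC (1 + s) (_ / _)) divfK// /s /q2; ring.
(* The determinant of the form is divided by exactly the factor 1 + s that the average contributes,
   which keeps the product formula polynomial. *)
have DE : (1 + s) * (A' * C' - B' ^+ 2) = A * C - B ^+ 2.
  apply: (mulfI sn0).
  rewrite [LHS](_ : _ = ((1 + s) * A') * ((1 + s) * C') - ((1 + s) * B') ^+ 2);
    last by ring.
  by rewrite A'E B'E C'E /s; ring.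
have D0 : 0 <= A * C - B ^+ 2 by rewrite subr_ge0.
rewrite IH ?(ltnW kn)//; last 3 first.
- by rewrite -(pmulr_rge0 _ s1) A'E addr_ge0// (mulr_ge0 (mulr_ge0 g0 D0))// sqr_ge0.
- by rewrite -(pmulr_rge0 _ s1) C'E addr_ge0// (mulr_ge0 (mulr_ge0 g0 D0))// sqr_ge0.
- by rewrite -subr_ge0 -(pmulr_rge0 _ s1) DE.
rewrite -EFinM -invfM; congr (_^-1)%:E.
have SE e f : S e f k.+1 = S e f k + g * (e i * f i) by rewrite /S (big_succ _ i).
rewrite !SE; set X := S c c k; set Y := S c d0 k; set Z := S d0 d0 k.
rewrite [LHS](_ : _ = (1 + s) + ((1 + s) * A') * X + 2 * ((1 + s) * B') * Y +
  ((1 + s) * C') * Z + ((1 + s) * (A' * C' - B' ^+ 2)) * (X * Z - Y ^+ 2));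
  last by ring.
by rewrite A'E B'E C'E DE /s; ring.
Qed.

Lemma gaussian_qform_integral (A B C : R) : 0 <= A -> 0 <= C -> B ^+ 2 <= A * C ->
  let S2 (e f : 'I_n -> R) := \sum_(j < n) nc (om j) ^+ 2 * (e j * f j) in
  (\int[P]_w (expR (- qform A B C (\sum_(j < n) (c j)%:C * om j * a j w)
                              (\sum_(j < n) (d0 j)%:C * om j * a j w)))%:E =
  ((1 + A * S2 c c + 2 * B * S2 c d0 + C * S2 d0 d0 +
    (A * C - B ^+ 2) * (S2 c c * S2 d0 d0 - S2 c d0 ^+ 2))^-1)%:E)%E.
Proof.
move=> A0 C0 BAC S2; have := partial (leqnn n) A0 C0 BAC.
have E (M : zmodType) (G : 'I_n -> M) : \sum_(j < n | (j < n)%N) G j = \sum_(j < n) G j.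
  by apply: eq_bigl => j; rewrite ltn_ord.
rewrite /S !E => <-; apply: eq_integral => w _.
by rewrite /U !E.
Qed.

End Fixed.
End GaussianQuadraticForm.

Section Markov.
Context d (T : measurableType d) (R : realType) (P : probability T R).

Lemma markov_bound (E : set T) (f : T -> R) (kappa I : R) : measurable E ->
  0 < kappa -> measurable_fun [set: T] f -> (forall w, 0 <= f w) ->
  (forall w, E w -> kappa <= f w) -> (\int[P]_w (f w)%:E <= I%:E)%E ->
  (P E <= (I / kappa)%:E)%E.
Proof.
move=> mE k0 mf f0 fE fI; rewrite -(@lee_pmul2l _ kappa%:E)//.
rewrite -EFinM mulrCA divff ?gt_eqF// mulr1; apply: le_trans fI.
rewrite -[X in (_ * P X)%E]setIT -integral_indic// -ge0_integralZl_EFin//; last 2 first.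
- exact/measurable_EFinP.
- exact: ltW.
apply: ge0_le_integral => //.
- by move=> w _; rewrite -EFinM lee_fin mulr_ge0// ltW.
- by apply/measurable_EFinP; apply: measurable_funM.
- exact/measurable_EFinP.
move=> w _; rewrite -EFinM lee_fin indicE.
have [wE|wE] := boolP (w \in E); last by rewrite mulr0.
by rewrite mulr1; apply: fE; rewrite inE in wE.
Qed.

End Markov.

(** * Small-ball and large-deviation bounds for linear forms *)

Section SmallBall.
Context d (T : measurableType d) (R : realType) (P : probability T R).
Variables (n : nat) (a : 'I_n -> {RV P >-> R[i]}).
Hypothesis a_indep : mutually_independent P a.
Hypothesis a_gauss : forall k, std_complex_gaussian P (a k).
Variables (c d0 : 'I_n -> R) (om : 'I_n -> R[i]).

Let X w := \sum_(j < n) (c j)%:C * om j * a j w.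
Let Y w := \sum_(j < n) (d0 j)%:C * om j * a j w.
Let S2 (e f : 'I_n -> R) := \sum_(j < n) nc (om j) ^+ 2 * (e j * f j).

Lemma measurable_linear_form (e : 'I_n -> R[i]) :
  measurable_fun [set: T] (fun w => \sum_(j < n) e j * a j w).
Proof.
by apply: measurable_csum => j _; apply: measurable_cmul; exact: measurable_funP.
Qed.

Lemma measurable_linear_form_le (e : 'I_n -> R[i]) (r : R) :
  measurable [set w | nc (\sum_(j < n) e j * a j w) <= r].
Proof.
rewrite -[X in measurable X]setTI; apply: measurable_fun_le => //.
exact/measurable_cnc/measurable_linear_form.
Qed.

Lemma measurable_linear_form_ge (e : 'I_n -> R[i]) (r : R) :
  measurable [set w | r <= nc (\sum_(j < n) e j * a j w)].
Proof.
rewrite -[X in measurable X]setTI; apply: measurable_fun_le => //.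
exact/measurable_cnc/measurable_linear_form.
Qed.

Let expRN1 : 4^-1 <= expR (-1) :> R.
Proof.
have h : 2^-1 <= expR (- 2^-1) :> R.
  by rewrite (le_trans _ (@expR_ge1Dx R (- 2^-1)))//; lra.
rewrite (_ : -1 = - 2^-1 + - 2^-1 :> R); last by lra.
have i0 : 0 <= 2^-1 :> R by rewrite invr_ge0.
by rewrite expRD; have := ler_pM i0 i0 h h; apply: le_trans; lra.
Qed.

(** With A = alpha^-2, B = 0 and C = beta^-2 the exponential is at least e^-2 >= 1/16 on the event;
    in the denominator only the Gram determinant is kept. *)
Lemma small_ball2 (alpha beta : R) : 0 < alpha -> 0 < beta ->
  0 < S2 c c * S2 d0 d0 - S2 c d0 ^+ 2 ->
  (P [set w | (nc (X w) <= alpha)%R /\ (nc (Y w) <= beta)%R] <=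
   (16 * (alpha ^+ 2 * beta ^+ 2) / (S2 c c * S2 d0 d0 - S2 c d0 ^+ 2))%:E)%E.
Proof.
move=> a0 b0 D0; set D := _ - _.
have a2 : 0 < alpha ^+ 2 by exact: exprn_gt0.
have b2 : 0 < beta ^+ 2 by exact: exprn_gt0.
pose A := (alpha ^+ 2)^-1; pose C := (beta ^+ 2)^-1.
have A0 : 0 < A by rewrite invr_gt0.
have C0 : 0 < C by rewrite invr_gt0.
have := @gaussian_qform_integral _ _ _ _ _ _ a_indep a_gauss c d0 om A 0 C
  (ltW A0) (ltW C0).
rewrite expr0n/= subr0 !(mulr0,mul0r) !addr0 => /(_ (mulr_ge0 (ltW A0) (ltW C0))).
rewrite -/(S2 c c) -/(S2 d0 d0) -/(S2 c d0) -/D.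
set J := (_ + _)^-1 => HI.
have JD : J <= (A * C * D)^-1.
  rewrite lef_pV2 ?posrE.
  - by rewrite lerDr !addr_ge0// mulr_ge0 ?(ltW A0) ?(ltW C0)// sumr_ge0// => j _;
      rewrite mulr_ge0 ?sqr_ge0// -expr2 sqr_ge0.
  - rewrite ltr_wpDl ?mulr_gt0// !addr_ge0// mulr_ge0 ?(ltW A0) ?(ltW C0)// sumr_ge0// => j _;
      by rewrite mulr_ge0 ?sqr_ge0// -expr2 sqr_ge0.
  - by rewrite !mulr_gt0.
have k0 : 0 < 16^-1 :> R by rewrite invr_gt0.
have := @markov_bound _ _ _ P [set w | nc (X w) <= alpha /\ nc (Y w) <= beta]
  (fun w => expR (- qform A 0 C (X w) (Y w))) 16^-1 J _ k0.
rewrite HI => H; apply: (le_trans (H _ _ _ _ _)) => //.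
- apply: measurableI; exact: measurable_linear_form_le.
- by apply/measurable_EFinP; apply: measurable_qform; exact: measurable_linear_form.
- move=> w [wX wY]; rewrite /qform mulr0 mul0r addr0.
  apply: (@le_trans _ _ (expR (-1 + -1))).
    have i4 : 0 <= 4^-1 :> R by rewrite invr_ge0.
    by rewrite expRD; have := ler_pM i4 i4 expRN1 expRN1; apply: le_trans; lra.
  rewrite ler_expR -opprD lerN2 lerD//.
    rewrite /A mulrC ler_pdivrMr// mul1r lerXn2r ?nnegrE ?nc_ge0//.
    exact: ltW.
  rewrite /C mulrC ler_pdivrMr// mul1r lerXn2r ?nnegrE ?nc_ge0//.
  exact: ltW.
- rewrite lee_fin invrK mulrC -mulrA ler_wpM2l//.
  by rewrite (le_trans JD)// /A /C !invfM !invrK.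
Qed.

Lemma small_ball1 (alpha : R) : 0 < alpha -> 0 < S2 c c ->
  (P [set w | (nc (X w) <= alpha)%R] <= (4 * alpha ^+ 2 / S2 c c)%:E)%E.
Proof.
move=> a0 D0.
have a2 : 0 < alpha ^+ 2 by exact: exprn_gt0.
pose A := (alpha ^+ 2)^-1.
have A0 : 0 < A by rewrite invr_gt0.
have := @gaussian_qform_integral _ _ _ _ _ _ a_indep a_gauss c d0 om A 0 0
  (ltW A0) (lexx _).
rewrite expr0n/= subr0 !(mulr0,mul0r) !addr0 => /(_ (lexx _)).
rewrite -/(S2 c c); set J := (_ + _)^-1 => HI.
have JD : J <= (A * S2 c c)^-1.
  by rewrite lef_pV2 ?posrE ?lerDr// ?ltr_wpDl ?mulr_gt0.
have k0 : 0 < 4^-1 :> R by rewrite invr_gt0.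
have := @markov_bound _ _ _ P [set w | nc (X w) <= alpha]
  (fun w => expR (- qform A 0 0 (X w) (Y w))) 4^-1 J _ k0.
rewrite HI => H; apply: (le_trans (H _ _ _ _ _)) => //.
- exact: measurable_linear_form_le.
- by apply/measurable_EFinP; apply: measurable_qform; exact: measurable_linear_form.
- move=> w wX; rewrite /qform mulr0 !mul0r !addr0.
  apply: (le_trans expRN1).
  rewrite ler_expR lerN2.
  rewrite /A mulrC ler_pdivrMr// mul1r lerXn2r ?nnegrE ?nc_ge0//.
  exact: ltW.
- rewrite lee_fin invrK mulrC -mulrA ler_wpM2l//.
  by rewrite (le_trans JD)// /A invfM invrK.
Qed.

(** Markov's inequality for (1 - exp(- y))^2 with y = |X|^2 / t^2. Two Laplace transforms combine to
    the mean 2 sg^2 / ((1 + sg) (1 + 2 sg)), quadratic in sg; a bound linear in sg would not survive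
    the sum over all cells. *)
Lemma large_dev (t : R) : 0 < t ->
  (P [set w | (t <= nc (X w))%R] <= (8 * (S2 c c / t ^+ 2) ^+ 2)%:E)%E.
Proof.
move=> t0.
have t2 : 0 < t ^+ 2 by exact: exprn_gt0.
pose A := (t ^+ 2)^-1.
have A0 : 0 < A by rewrite invr_gt0.
have A20 : 0 < 2 * A by rewrite mulr_gt0.
have H1 := @gaussian_qform_integral _ _ _ _ _ _ a_indep a_gauss c d0 om A 0 0
  (ltW A0) (lexx _).
have H2 := @gaussian_qform_integral _ _ _ _ _ _ a_indep a_gauss c d0 om (2 * A) 0 0
  (ltW A20) (lexx _).
rewrite expr0n/= !(mulr0,mul0r,subr0,addr0) in H1 H2.
have {}H1 := H1 (lexx _); have {}H2 := H2 (lexx _).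
rewrite -/(S2 c c) in H1 H2; set sg := S2 c c / t ^+ 2.
have sgE : A * S2 c c = sg by rewrite mulrC.
rewrite sgE in H1; rewrite -mulrA sgE in H2.
have sg0 : 0 <= sg.
  rewrite mulr_ge0 ?(ltW A0)// sumr_ge0// => j _.
  by rewrite mulr_ge0 ?sqr_ge0// -expr2 sqr_ge0.
pose y w := A * nc (X w) ^+ 2.
have q1 w : qform A 0 0 (X w) (Y w) = y w by rewrite /qform !(mulr0,mul0r) !addr0.
have q2 w : qform (2 * A) 0 0 (X w) (Y w) = 2 * y w.
  by rewrite /qform /y; ring.
have {}H1 : (\int[P]_w (expR (- y w))%:E = ((1 + sg)^-1)%:E)%E.
  by rewrite -H1; apply: eq_integral => w _; rewrite q1.
have {}H2 : (\int[P]_w (expR (- (2 * y w)))%:E = ((1 + 2 * sg)^-1)%:E)%E.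
  by rewrite -H2; apply: eq_integral => w _; rewrite q2.
have mX : measurable_fun [set: T] X by exact: measurable_linear_form.
have my : measurable_fun [set: T] y.
  by apply: measurable_funM => //; apply: measurable_funX; exact: measurable_cnc.
have me1 : measurable_fun [set: T] (fun w => expR (- y w)).
  by apply: measurableT_comp => //; exact: measurableT_comp.
have k0 : 0 < 4^-1 :> R by rewrite invr_gt0.
pose f w := (1 - expR (- y w)) ^+ 2.
have mf : measurable_fun [set: T] f.
  by apply: measurable_funX; apply: measurable_funB.
have e1 : expR (-1) <= 2^-1 :> R.
  rewrite expRN lef_pV2 ?posrE ?expR_gt0// (le_trans _ (expR_ge1Dx _))//; lra.
have HI : (\int[P]_w (f w)%:E <= (2 * sg ^+ 2)%:E)%E.
  have s1 : 0 < 1 + sg by rewrite ltr_wpDr.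
  have s2 : 0 < 1 + 2 * sg by rewrite ltr_wpDr// mulr_ge0.
  have sumE : (\int[P]_w (f w)%:E + (2 * (1 + sg)^-1)%:E =
     (1 + (1 + 2 * sg)^-1)%:E)%E.
    rewrite EFinM -H1 -ge0_integralZl_EFin//; last exact/measurable_EFinP.
    rewrite -ge0_integralD//; last 3 first.
    - by move=> w _; rewrite lee_fin sqr_ge0.
    - exact/measurable_EFinP.
    - by apply/measurable_EFinP; exact: measurable_funM.
    rewrite [RHS]EFinD -[X in _ = (_ + X)%E]H2.
    have -> : 1%:E = (\int[P]_w (cst 1%:E) w)%E.
      by rewrite integral_cst//= mul1e; exact/esym/probability_setT.
    rewrite -ge0_integralD//; last first.
      apply/measurable_EFinP; apply: measurableT_comp => //.
      by apply: measurableT_comp => //; exact: measurable_funM.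
    apply: eq_integral => w _; rewrite /= -!EFinM -!EFinD; congr EFin.
    by rewrite /f (_ : - (2 * y w) = - y w + - y w) ?expRD; ring.
  have : (\int[P]_w (f w)%:E)%E = (1 + (1 + 2 * sg)^-1 - 2 * (1 + sg)^-1)%:E.
    by rewrite EFinB -sumE addeK.
  move=> ->; rewrite lee_fin.
  rewrite (_ : _ - _ = 2 * sg ^+ 2 * ((1 + sg) * (1 + 2 * sg))^-1); last first.
    by field; rewrite !gt_eqF.
  apply: ler_piMr; first by rewrite mulr_ge0 ?sqr_ge0.
  rewrite invf_le1 ?mulr_gt0//.
  nra.
have := @markov_bound _ _ _ P [set w | t <= nc (X w)] f 4^-1 (2 * sg ^+ 2) _ k0 mf.
move=> H; apply: (le_trans (H _ _ _ HI)).
- exact: measurable_linear_form_ge.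
- by move=> w; exact: sqr_ge0.
- move=> w tX; rewrite /f.
  have : expR (- y w) <= 2^-1.
    apply: le_trans e1; rewrite ler_expR lerN2 /y /A mulrC ler_pdivlMr// mul1r.
    by rewrite lerXn2r ?nnegrE ?nc_ge0// ltW.
  by have := expR_ge0 (- y w); nra.
- by rewrite lee_fin invrK; lra.
Qed.

End SmallBall.

(** * Probabilities of the cell events *)

Section GramDeterminant.
Variable R : realType.

Lemma lagrange_sum (N : nat) (g e : nat -> R) :
  2 * ((\sum_(0 <= i < N) g i) * (\sum_(0 <= i < N) g i * e i ^+ 2) -
       (\sum_(0 <= i < N) g i * e i) ^+ 2) =
  \sum_(0 <= i < N) \sum_(0 <= j < N) g i * g j * (e i - e j) ^+ 2.
Proof.
transitivity (\sum_(0 <= i < N) (g i * e i ^+ 2 * (\sum_(0 <= j < N) g j) +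
    g i * (\sum_(0 <= j < N) g j * e j ^+ 2) -
    2 * (g i * e i) * (\sum_(0 <= j < N) g j * e j))).
  rewrite sumrB big_split/= -!mulr_suml -!mulr_sumr; ring.
apply: eq_bigr => i _; rewrite !mulr_sumr -big_split/= -sumrB.
by apply: eq_bigr => j _; ring.
Qed.

Lemma sum_nat_sub_ge (N p m : nat) (F : nat -> R) (K : R) : (p + m <= N)%N ->
  (forall i, (i < N)%N -> 0 <= F i) ->
  (forall i, (p <= i < p + m)%N -> K <= F i) ->
  m%:R * K <= \sum_(0 <= i < N) F i.
Proof.
move=> pmN F0 FK.
have pos u v : (v <= N)%N -> 0 <= \sum_(u <= i < v) F i.
  move=> vN; rewrite big_nat sumr_ge0// => i /andP[_ iv]; apply: F0.
  exact: leq_trans iv vN.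
rewrite (big_cat_nat (leq0n p) (leq_trans (leq_addr m p) pmN))/=.
rewrite (big_cat_nat (leq_addr m p) pmN)/=.
rewrite -[leLHS]add0r lerD//; first exact/pos/(leq_trans _ pmN)/leq_addr.
rewrite -[leLHS]addr0 lerD//; last exact: pos.
rewrite -[m in m%:R](addKn p) mulr_natl -sumr_const_nat.
exact: ler_sum_nat.
Qed.

(** In Lagrange's identity only the pairs from two blocks of m indices at least m apart are kept:
    m^2 pairs, each with squared gap at least m^2. *)
Lemma gram_ge (N p q m : nat) (g : nat -> R) (K : R) : (p + 2 * m <= q)%N ->
  (q + m <= N)%N -> 0 <= K -> (forall i, 0 <= g i) ->
  (forall i j, (p <= i < p + m)%N -> (q <= j < q + m)%N -> K <= g i * g j) ->
  m%:R ^+ 4 * K <=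
  2 * ((\sum_(0 <= i < N) g i) * (\sum_(0 <= i < N) g i * i%:R ^+ 2) -
       (\sum_(0 <= i < N) g i * i%:R) ^+ 2).
Proof.
move=> pq qN K0 g0 gK; rewrite (lagrange_sum N g (fun i => i%:R)).
have h0 i j : 0 <= g i * g j * (i%:R - j%:R) ^+ 2.
  by rewrite mulr_ge0 ?sqr_ge0// mulr_ge0.
rewrite (_ : _ * K = m%:R * (m%:R * (K * m%:R ^+ 2))); last by ring.
apply: (@sum_nat_sub_ge N p m) => [||i pi].
- lia.
- by move=> i _; rewrite sumr_ge0.
apply: (@sum_nat_sub_ge N q m) => // j qj.
rewrite ler_pM ?sqr_ge0 ?gK// -[leRHS]sqrrN opprB.
rewrite -natrB; last lia.
by rewrite lerXn2r ?nnegrE// ler_nat; lia.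
Qed.

Lemma bernoulli_ge (x : R) k : 0 <= x <= 1 -> 1 - k%:R * x <= (1 - x) ^+ k.
Proof.
move=> /andP[x0 x1]; elim: k => [|k IH]; first by rewrite mul0r subr0 expr0.
rewrite exprS; have := ler_wpM2l (_ : 0 <= 1 - x) IH.
rewrite subr_ge0 => /(_ x1); apply: le_trans.
have : 0 <= k%:R * x * x by rewrite !mulr_ge0.
rewrite -natr1; nra.
Qed.

(** The blocks are placed where |z|^(2 i) is comparable with the squared weight: at the lowest
    powers inside the unit disc, at the highest outside. The condition 16 m tau <= 1 keeps |z|^(8 m)
    within a factor 2 of 1 on the side where it matters. *)
Lemma gram_annulus (n m : nat) (z : R[i]) (tau : R) : (4 * m <= n)%N ->
  0 <= tau -> 16 * m%:R * tau <= 1 -> tau <= 1 ->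
  1 - tau <= nc z <= 1 + tau ->
  m%:R ^+ 4 * wgt n z ^+ 4 <=
  4 * ((\sum_(0 <= i < n.+1) nc z ^+ (2 * i)) *
       (\sum_(0 <= i < n.+1) nc z ^+ (2 * i) * i%:R ^+ 2) -
       (\sum_(0 <= i < n.+1) nc z ^+ (2 * i) * i%:R) ^+ 2).
Proof.
move=> mn t0 mt t1 /andP[tz zt].
have half : 1 <= 2 * (1 - tau) ^+ (8 * m).
  have /(@bernoulli_ge _ (8 * m)) : 0 <= tau <= 1 by rewrite t0.
  by rewrite natrM; lra.
have g0 i : 0 <= nc z ^+ (2 * i) by rewrite exprn_ge0// nc_ge0.
suff [p [q [pq qN H]]] : exists p q, [/\ (p + 2 * m <= q)%N, (q + m <= n.+1)%N &
    forall i j, (p <= i < p + m)%N -> (q <= j < q + m)%N ->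
      wgt n z ^+ 4 <= 2 * (nc z ^+ (2 * i) * nc z ^+ (2 * j))].
  have K0 : 0 <= wgt n z ^+ 4 / 2 by rewrite divr_ge0// exprn_ge0// ltW// wgt_gt0.
  have := @gram_ge n.+1 p q m (fun i => nc z ^+ (2 * i)) (wgt n z ^+ 4 / 2) pq qN
    K0 g0.
  have HK i j : (p <= i < p + m)%N -> (q <= j < q + m)%N ->
      wgt n z ^+ 4 / 2 <= nc z ^+ (2 * i) * nc z ^+ (2 * j).
    by move=> ip jq; rewrite ler_pdivrMr// mulrC; exact: H.
  by move=> /(_ HK); lra.
have [z1|z1] := leP (nc z) 1.
  exists 0%N, (2 * m)%N; split; [lia|lia|] => i j ip jq.
  have -> : wgt n z = 1 by rewrite /wgt max_l// expr1n.
  rewrite expr1n -exprD (le_trans half)// ler_wpM2l//.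
  apply: (@le_trans _ _ (nc z ^+ (8 * m))).
    by rewrite lerXn2r ?nnegrE ?subr_ge0 ?nc_ge0.
  by rewrite ler_wiXn2l ?nc_ge0//; lia.
exists (n.+1 - 3 * m)%N, (n.+1 - m)%N; split; [lia|lia|] => i j ip jq.
have -> : wgt n z = nc z ^+ n by rewrite /wgt max_r// ltW.
have z8 : nc z ^+ (8 * m) <= 2.
  apply: (@le_trans _ _ (nc z ^+ (8 * m) * (2 * (1 - tau) ^+ (8 * m)))).
    by rewrite ler_peMr// exprn_ge0// nc_ge0.
  rewrite mulrCA -exprMn ler_piMr// exprn_ile1 ?mulr_ge0 ?nc_ge0 ?subr_ge0//.
  have : nc z * (1 - tau) <= (1 + tau) * (1 - tau) by rewrite ler_wpM2r ?subr_ge0.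
  have : 0 <= tau * tau by rewrite mulr_ge0.
  by nra.
rewrite -exprM -exprD.
apply: (@le_trans _ _ (nc z ^+ (8 * m) * nc z ^+ (2 * i + 2 * j))).
  by rewrite -exprD ler_weXn2l ?(ltW z1)//; lia.
by rewrite ler_wpM2r// exprn_ge0// nc_ge0.
Qed.

End GramDeterminant.

(** * The random polynomial at a fixed point *)

Section RandomPolynomial.
Context d (T : measurableType d) (R : realType) (P : probability T R).
Variables (n : nat) (a : 'I_n.+1 -> {RV P >-> R[i]}).
Hypothesis n0 : (0 < n)%N.
Hypothesis a_indep : mutually_independent P a.
Hypothesis a_gauss : forall k, std_complex_gaussian P (a k).
Implicit Types z : R[i].

Lemma size_random_poly w : (size (random_poly a w) <= n.+1)%N.
Proof.
rewrite /random_poly (leq_trans (size_sum _ _ _))//; apply/bigmax_leqP => k _.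
by rewrite (leq_trans (size_scale_leq _ _))// size_polyXn.
Qed.

Lemma coef_random_poly w (k : 'I_n.+1) : (random_poly a w)`_k = a k w.
Proof.
rewrite /random_poly coef_sum (bigD1 k)//= coefZ coefXn eqxx mulr1.
rewrite big1 ?addr0// => j jk; rewrite coefZ coefXn.
by rewrite (_ : (k == j :> nat) = false) ?mulr0// eq_sym; apply/negbTE.
Qed.

Lemma tcoef_random_poly w z j : tcoef (random_poly a w) z j =
  \sum_(l < n.+1) ('C(l, j)%:R)%:C * z ^+ (l - j) * a l w.
Proof.
rewrite (tcoefE _ _ (size_random_poly w)); apply: eq_bigr => l _.
rewrite coef_random_poly -mulr_natl rmorph_nat.
by rewrite -mulrA; congr (_ * _); exact: mulrC.
Qed.

Lemma eval_random_poly w z : (random_poly a w).[z] =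
  \sum_(l < n.+1) (1 : R)%:C * z ^+ l * a l w.
Proof.
by rewrite -tcoef0 tcoef_random_poly; apply: eq_bigr => l _; rewrite bin0 subn0.
Qed.

(** The factor z gives z p'(z) the same factors z^l as p(z); the two linear forms then differ only
    by their real coefficients l and 1, as [small_ball2] requires. *)
Lemma deriv_random_poly w z : z * tcoef (random_poly a w) z 1 =
  \sum_(l < n.+1) (l%:R)%:C * z ^+ l * a l w.
Proof.
rewrite tcoef_random_poly mulr_sumr; apply: eq_bigr => l _; rewrite bin1.
case: l => -[|l] il /=; first by rewrite rmorph0 !(mul0r, mulr0).
rewrite subn1/= exprS; ring.
Qed.

(** One term is enough: l = 0 inside the unit disc, l = n outside. *)
Lemma var0_ge z : wgt n z ^+ 2 <=
  \sum_(l < n.+1) nc (z ^+ l) ^+ 2 * ((1 : R) * 1).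
Proof.
have pos (l : 'I_n.+1) : 0 <= nc (z ^+ l) ^+ 2 * ((1 : R) * 1).
  by rewrite mulr1 mulr1 sqr_ge0.
have [z1|z1] := leP (nc z) 1.
  rewrite (bigD1 ord0)// (_ : z ^+ (ord0 : 'I_n.+1) = 1)//.
  by rewrite /wgt max_l// !expr1n nc1 !expr1n !mulr1 lerDl; apply: sumr_ge0 => l _; rewrite ?mulr1 sqr_ge0.
rewrite (bigD1 ord_max)//= /wgt max_r; last exact: ltW.
by rewrite ncX !mulr1 lerDl; apply: sumr_ge0 => l _; rewrite ?mulr1 sqr_ge0.
Qed.

Lemma var2_le z : \sum_(l < n.+1) nc (z ^+ (l - 2)) ^+ 2 *
    (('C(l, 2)%:R : R) * 'C(l, 2)%:R) <= n%:R ^+ 5 * wgt n z ^+ 2.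
Proof.
have n1 : 1 <= n%:R :> R by rewrite ler1n.
apply: (@le_trans _ _ (\sum_(l < n.+1) (wgt n z ^+ 2 * (n%:R ^+ 4 / 4)))).
  apply: ler_sum => l _; apply: ler_pM; rewrite ?sqr_ge0 ?mulr_ge0//.
    rewrite lerXn2r ?nnegrE ?nc_ge0 ?(ltW (wgt_gt0 _ _))// ncX.
    apply: (@le_trans _ _ (Num.max 1 (nc z) ^+ (l - 2))).
      by rewrite lerXn2r ?nnegrE ?nc_ge0// le_max ?ler01 ?lexx ?orbT.
    rewrite ler_weXn2l ?le_max ?lexx// (leq_trans (leq_subr _ _))//.
    by rewrite -ltnS ltn_ord.
  have b2 : 'C(l, 2)%:R * 2 <= n%:R ^+ 2 :> R.
    rewrite -natrM -natrX ler_nat bin2 muln2 (leq_trans (_ : _ <= (l * l.-1))%N)//.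
      by have := odd_double_half (l * l.-1); lia.
    by rewrite expnS expn1 leq_mul//; have := ltn_ord l; lia.
  have c0 : 0 <= 'C(l, 2)%:R :> R by [].
  have := ler_pM (mulr_ge0 c0 (ler0n _ 2)) (mulr_ge0 c0 (ler0n _ 2)) b2 b2.
  by rewrite -exprD /=; lra.
rewrite sumr_const card_ord -[leLHS]mulr_natr [leRHS]mulrC -mulrA.
rewrite ler_wpM2l ?sqr_ge0// (exprS _ 4) -[n.+1%:R]natr1.
have := mulr_ge0 (exprn_ge0 4 (ler0n R n)) (_ : 0 <= n%:R - 1).
rewrite subr_ge0 => /(_ n1).
have : 0 <= n%:R ^+ 4 :> R by rewrite exprn_ge0.
move: (n%:R : R) => y h1 h2; clear n1; nra.
Qed.

Lemma prob_small_value z (gamma : R) : 0 < gamma ->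
  (P [set w | (nc (random_poly a w).[z] <= gamma * wgt n z)%R] <=
   (4 * gamma ^+ 2)%:E)%E.
Proof.
move=> g0; have w0 := wgt_gt0 n z.
have := @small_ball1 _ _ _ P _ a a_indep a_gauss (fun=> 1) (fun=> 0) (fun l => z ^+ l)
  (gamma * wgt n z) (mulr_gt0 g0 w0).
have V := var0_ge z.
have V0 := lt_le_trans (exprn_gt0 2 w0) V.
move=> /(_ V0) H.
under eq_set do rewrite eval_random_poly.
apply: le_trans H _; rewrite lee_fin ler_pdivrMr// exprMn mulrA.
by rewrite ler_wpM2l// mulr_ge0// sqr_ge0.
Qed.

Lemma prob_large_second z (kappa : R) : 0 < kappa ->
  (P [set w | (kappa * wgt n z <= nc (tcoef (random_poly a w) z 2))%R] <=
   (8 * (n%:R ^+ 5 / kappa ^+ 2) ^+ 2)%:E)%E.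
Proof.
move=> k0; have w0 := wgt_gt0 n z.
have := @large_dev _ _ _ P _ a a_indep a_gauss (fun l : 'I_n.+1 => 'C(l, 2)%:R)
  (fun=> 0) (fun l => z ^+ (l - 2)) (kappa * wgt n z) (mulr_gt0 k0 w0).
move=> H; under eq_set do rewrite tcoef_random_poly.
apply: le_trans H _; rewrite lee_fin ler_wpM2l//.
have k2 : 0 < kappa ^+ 2 by exact: exprn_gt0.
have w2 : 0 < wgt n z ^+ 2 by exact: exprn_gt0.
rewrite lerXn2r ?nnegrE ?divr_ge0 ?exprn_ge0 ?mulr_ge0 ?(ltW k0) ?(ltW w0)//.
  apply: sumr_ge0 => l _; by rewrite mulr_ge0 ?sqr_ge0 ?mulr_ge0.
rewrite exprMn ler_pdivrMr ?mulr_gt0// mulrA divfK ?gt_eqF//.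
exact: var2_le.
Qed.

Lemma prob_bad_cell z m (tau alpha beta : R) : (4 * m <= n)%N -> (0 < m)%N ->
  0 <= tau -> 16 * m%:R * tau <= 1 -> tau <= 1 ->
  1 - tau <= nc z <= 1 + tau -> 0 < alpha -> 0 < beta ->
  (P [set w | (nc (random_poly a w).[z] <= alpha * wgt n z)%R /\
              (nc (z * tcoef (random_poly a w) z 1) <= beta * wgt n z)%R] <=
   (64 * (alpha ^+ 2 * beta ^+ 2) / m%:R ^+ 4)%:E)%E.
Proof.
move=> mn m0 t0 mt t1 tz a0 b0; have w0 := wgt_gt0 n z.
have G := gram_annulus mn t0 mt t1 tz.
set D := (X in _ <= 4 * X) in G.
have w4 : 0 < wgt n z ^+ 4 by exact: exprn_gt0.
have m4 : 0 < m%:R ^+ 4 :> R by rewrite exprn_gt0// ltr0n.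
have D0 : 0 < D by rewrite -(pmulr_rgt0 _ (ltr0n R 4)) (lt_le_trans _ G)// mulr_gt0.
have := @small_ball2 _ _ _ P _ a a_indep a_gauss (fun=> 1)
  (fun l : 'I_n.+1 => l%:R) (fun l => z ^+ l)
  (alpha * wgt n z) (beta * wgt n z) (mulr_gt0 a0 w0) (mulr_gt0 b0 w0).
set D' := _ - _; have -> : D' = D.
  rewrite /D' /D !big_mkord; congr (_ * _ - _ ^+ 2); apply: eq_bigr => l _;
  by rewrite ncX -exprM mulnC ?mul1r ?mulr1 ?expr2.
move=> /(_ D0) H.
under eq_set do rewrite eval_random_poly deriv_random_poly.
apply: le_trans H _; rewrite lee_fin ler_pdivrMr//.
rewrite [leRHS]mulrAC ler_pdivlMr// !exprMn.
rewrite [leLHS](_ : _ = 16 * (alpha ^+ 2 * beta ^+ 2) *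
  (m%:R ^+ 4 * wgt n z ^+ 4)); last by ring.
rewrite [leRHS](_ : _ = 16 * (alpha ^+ 2 * beta ^+ 2) * (4 * D)); last by ring.
by rewrite ler_wpM2l// !mulr_ge0// ltW.
Qed.

Lemma prob_small_coef k (e : R) : 0 < e ->
  (P [set w | (nc (a k w) <= e)%R] <= (4 * e ^+ 2)%:E)%E.
Proof.
move=> e0.
have := @small_ball1 _ _ _ P _ a a_indep a_gauss (fun j => (j == k)%:R)
  (fun=> 0) (fun=> 1) e e0.
have -> : \sum_(j < n.+1) nc (1 : R[i]) ^+ 2 * ((j == k)%:R * (j == k)%:R) = 1 :> R.
  under eq_bigr do rewrite nc1 expr1n mul1r.
  rewrite (bigD1 k)//= eqxx mulr1 big1 ?addr0// => j jk.
  by rewrite (negbTE jk) mulr0.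
rewrite divr1 => /(_ ltr01) H.
rewrite (_ : [set w | _] = [set w |
    (nc (\sum_(j < n.+1) (((j == k)%:R : R)%:C * 1 * a j w)) <= e)%R])//.
have E w : \sum_(j < n.+1) (((j == k)%:R : R)%:C * 1 * a j w) = a k w.
  rewrite (bigD1 k)//= eqxx !mul1r big1 ?addr0// => j jk.
  by rewrite (negbTE jk) !mul0r.
by apply/seteqP; split => w /=; rewrite E.
Qed.

(** The moment E exp(|a_k|^2 / 2) = 2 is a case of [gaussian_exp_quadratic], and t <= exp t makes it
    stand in for the second moment. *)
Lemma prob_large_norm (lam : R) : 0 < lam ->
  (P [set w | (lam <= \sum_(k < n.+1) nc (a k w) ^+ 2)%R] <=
   (4 * n.+1%:R / lam)%:E)%E.
Proof.
move=> l0; pose f w := \sum_(k < n.+1) expR (2^-1 * nc (a k w) ^+ 2).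
have mnc k : measurable_fun [set: T] (fun w => nc (a k w) : R).
  by apply: measurable_cnc; exact: measurable_funP.
have me k : measurable_fun [set: T] (fun w => expR (2^-1 * nc (a k w) ^+ 2)).
  apply: measurableT_comp => //; apply: measurable_funM => //.
  exact: measurable_funX.
have E1 k : (\int[P]_w (expR (2^-1 * nc (a k w) ^+ 2))%:E = 2%:E)%E.
  have c0 : 0 < 1 + (- 2^-1) :> R by lra.
  transitivity (\int[distribution P (a k)]_z (expR (- (- 2^-1 * nc z ^+ 2 +
      2 * (0 * complex.Re z + 0 * complex.Im z) + 0)))%:E)%E.
    rewrite ge0_integral_distribution.
    - by apply: eq_integral => w _ /=; rewrite !mul0r !(addr0,mulr0) mulNr opprK.
    - apply/measurable_EFinP; apply: measurableT_comp => //.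
      under eq_fun do rewrite !mul0r !(addr0,mulr0).
      apply: measurableT_comp => //; apply: measurable_funM => //.
      by apply: measurable_funX; exact: measurable_nc.
    - by move=> z; rewrite lee_fin expR_ge0.
  rewrite (gaussian_exp_quadratic (a_gauss k) 0 0 0 c0) expr0n/= addr0 mul0r.
  rewrite oppr0 addr0 expR0 (_ : 1 + - 2^-1 = 2^-1 :> R); last by lra.
  by rewrite invrK mulr1.
have sumI : (\int[P]_w (f w)%:E <= (2 * n.+1%:R)%:E)%E.
  under eq_integral do rewrite /f -sumEFin.
  rewrite ge0_integral_sum//; last by move=> k; exact/measurable_EFinP.
  under eq_bigr do rewrite E1.
  by rewrite sumEFin sumr_const card_ord mulr_natr.
have k0 : 0 < lam / 2 by rewrite divr_gt0.
have mE : measurable [set w | lam <= \sum_(k < n.+1) nc (a k w) ^+ 2].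
  rewrite -[X in measurable X]setTI; apply: measurable_fun_le => //.
  by apply: measurable_sum => k; exact: measurable_funX.
have mf : measurable_fun [set: T] f by apply: measurable_sum.
have f0 w : 0 <= f w by apply: sumr_ge0 => k _; exact: expR_ge0.
apply: le_trans (markov_bound mE k0 mf f0 _ sumI) _.
  move=> w /= lw; apply: (@le_trans _ _ (2^-1 * \sum_(k < n.+1) nc (a k w) ^+ 2)).
    by rewrite mulrC ler_wpM2l ?invr_ge0.
  rewrite mulr_sumr; apply: ler_sum => k _.
  by rewrite (le_trans _ (expR_ge1Dx _))// lerDr.
by rewrite lee_fin invf_div; lra.
Qed.

End RandomPolynomial.

(** * Deterministic count of components *)

Section AnnulusNet.
Variable R : realType.
Implicit Types (a b x y delta tau : R).

Let trunc_itv x : 0 <= x -> (Num.truncn x)%:R <= x < (Num.truncn x).+1%:R.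
Proof. exact: truncn_itv. Qed.

(** On the arc a <= b the circle is a graph over a of slope at most 1, so a grid of step delta in a
    controls b equally well. *)
Lemma circle_grid a b delta : 0 <= a <= b -> a ^+ 2 + b ^+ 2 = 1 -> 0 < delta ->
  exists k : nat, [/\ (k <= Num.truncn delta^-1)%N, k%:R * delta <= 1,
    `|a - k%:R * delta| <= delta &
    `|b - Num.sqrt (1 - (k%:R * delta) ^+ 2)| <= delta].
Proof.
move=> /andP[a0 ab] ab1 d0.
have b0 : 0 <= b by exact: le_trans ab.
have a1 : a <= 1 by nra.
have b12 : 1 <= 2 * b ^+ 2 by nra.
exists (Num.truncn (a / delta)); set k := Num.truncn _.
have /trunc_itv/andP[ka ak] : 0 <= a / delta by rewrite divr_ge0// ltW.
rewrite -/k in ka ak.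
have {}ka : k%:R * delta <= a by rewrite -ler_pdivlMr.
have {}ak : a < k%:R * delta + delta.
  by move: ak; rewrite ltr_pdivrMr// -natr1 mulrDl mul1r.
set x := k%:R * delta in ka ak *.
have x0 : 0 <= x by rewrite mulr_ge0// ltW.
have x1 : x <= 1 by exact: le_trans a1.
split => //.
- by apply: le_truncn; rewrite -[leRHS]mul1r ler_pM2r ?invr_gt0.
- by rewrite ler_norml; apply/andP; split; lra.
set y := Num.sqrt _.
have y2 : y ^+ 2 = 1 - x ^+ 2 by rewrite sqr_sqrtr// subr_ge0 expr_le1.
have y0 : 0 <= y by exact: sqrtr_ge0.
have by_ : b <= y by rewrite -ler_sqr ?nnegrE// y2; nra.
rewrite ler_norml; apply/andP; split; last by lra.
have E : (y - b) * (y + b) = (a - x) * (a + x) by rewrite -!subr_sqr y2; lra.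
have : (y - b) * (2 * b) <= delta * (2 * b).
  have h1 : (y - b) * (2 * b) <= (y - b) * (y + b) by rewrite ler_wpM2l; lra.
  have h2 : (a - x) * (a + x) <= delta * (a + x) by rewrite ler_wpM2r; lra.
  have h3 : delta * (a + x) <= delta * (2 * b) by rewrite ler_wpM2l ?(ltW d0)//; lra.
  by rewrite (le_trans h1)// E (le_trans h2).
rewrite ler_pM2r; first by lra.
by rewrite mulr_gt0// lt_def b0 andbT; apply/eqP => b00; rewrite b00 in b12; lra.
Qed.

(** The signs [e1], [e2] and the exchange [f] produce the eight mirror images of a grid point, which
    reduces the circle to one octant. *)
Definition circle_point delta (k : nat) (e1 e2 f : bool) : R[i] :=
  let x := k%:R * delta in
  let y := Num.sqrt (1 - x ^+ 2) in
  if f then ((-1) ^+ e1 * x) +i* ((-1) ^+ e2 * y)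
  else ((-1) ^+ e2 * y) +i* ((-1) ^+ e1 * x).

Lemma nc_circle_point delta k e1 e2 f : 0 < delta -> k%:R * delta <= 1 ->
  nc (circle_point delta k e1 e2 f) = 1.
Proof.
move=> d0 k1; set x := k%:R * delta in k1 *.
have x0 : 0 <= x by rewrite mulr_ge0// ltW.
have y2 : Num.sqrt (1 - x ^+ 2) ^+ 2 = 1 - x ^+ 2.
  by rewrite sqr_sqrtr// subr_ge0 expr_le1.
apply/eqP; rewrite -(@eqrXn2 _ 2) ?nc_ge0// expr1n ncsq /circle_point -/x.
clearbody x; by case: f => /=; rewrite !exprMn !sqrr_sign !mul1r y2; apply/eqP; ring.
Qed.

Lemma circle_net delta (u : R[i]) : 0 < delta -> nc u = 1 ->
  exists (k : nat) (e1 e2 f : bool), [/\ (k <= Num.truncn delta^-1)%N,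
    k%:R * delta <= 1 & nc (u - circle_point delta k e1 e2 f) <= 2 * delta].
Proof.
move=> d0 u1; case: u u1 => x y u1.
have xy : `|x| ^+ 2 + `|y| ^+ 2 = 1.
  have h := ncsq (x +i* y); rewrite u1 expr1n /= in h.
  by rewrite h !real_normK ?num_real.
have sg (t v : R) : `|t - (-1) ^+ (t < 0)%R * v| = `| `|t| - v|.
  have [t0|t0] := ltP t 0; last by rewrite expr0 mul1r (ger0_norm t0).
  by rewrite expr1 mulN1r opprK (ltr0_norm t0) -[RHS]normrN opprB opprK addrC.
have [xley|/ltW ylex] := leP `|x| `|y|.
  have [|k [kK k1 kx ky]] := @circle_grid `|x| `|y| delta _ xy d0.
    by rewrite normr_ge0.
  exists k, (x < 0), (y < 0), true; split => //.
  rewrite (le_trans (nc_le_ReIm _))//= !sg; lra.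
have [||k [kK k1 kx ky]] := @circle_grid `|y| `|x| delta _ _ d0.
- by rewrite normr_ge0.
- by rewrite addrC.
exists k, (y < 0), (x < 0), false; split => //.
rewrite (le_trans (nc_le_ReIm _))//= !sg; lra.
Qed.

(** A polar grid: at most 3 tau / delta radii, 2 / delta abscissas and 8 mirror images give the
    constant 48. A radial error delta and an error 2 delta on the circle, scaled by a radius below
    2, give 5 delta. *)
Lemma annulus_net tau delta : 0 < delta -> delta <= tau -> tau < 1 ->
  exists zs : seq R[i],
  [/\ (size zs)%:R <= 48 * tau / delta ^+ 2,
     {in zs, forall z, 1 - tau <= nc z <= 1 + tau} &
     forall zeta, 1 - tau <= nc zeta <= 1 + tau ->
       exists2 z, z \in zs & nc (z - zeta) <= 5 * delta].
Proof.
move=> d0 dt t1; have t0 : 0 < tau by exact: lt_le_trans dt.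
pose J := Num.truncn (2 * tau / delta); pose K := Num.truncn delta^-1.
pose I := ('I_J.+1 * 'I_K.+1 * (bool * bool * bool))%type.
pose z_ (i : I) : R[i] := (1 - tau + i.1.1%:R * delta)%:C *
  circle_point delta i.1.2 i.2.1.1 i.2.1.2 i.2.2.
have /trunc_itv/andP[J1 J2] : 0 <= 2 * tau / delta.
  by rewrite divr_ge0 ?mulr_ge0// ltW.
have /trunc_itv/andP[K1 K2] : 0 <= delta^-1 by rewrite invr_ge0 ltW.
rewrite -/J in J1 J2; rewrite -/K in K1 K2.
have Kd (k : 'I_K.+1) : k%:R * delta <= 1.
  rewrite -ler_pdivlMr// mul1r (le_trans _ K1)// ler_nat -ltnS; exact: ltn_ord.
have Jd (j : 'I_J.+1) : j%:R * delta <= 2 * tau.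
  rewrite -ler_pdivlMr// (le_trans _ J1)// ler_nat -ltnS; exact: ltn_ord.
exists (map z_ (enum {: I})); split.
- rewrite size_map -cardE !card_prod !card_ord !card_bool !natrM.
  have h1 : J.+1%:R <= 3 * tau / delta.
    rewrite -natr1 (_ : 3 * tau / delta = 2 * tau / delta + tau / delta); last first.
      by field; rewrite gt_eqF.
    by rewrite lerD// ler_pdivlMr// mul1r.
  have h2 : K.+1%:R <= 2 / delta.
    rewrite -natr1 (_ : 2 / delta = delta^-1 + 1 / delta); last first.
      by field; rewrite gt_eqF.
    by rewrite lerD// ler_pdivlMr// mul1r (le_trans dt)// ltW.
  apply: (@le_trans _ _ ((3 * tau / delta) * (2 / delta) * (2 * 2 * 2))).
    by rewrite ler_wpM2r// ler_pM.
  rewrite le_eqVlt; apply/orP; left; apply/eqP; field.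
  by rewrite gt_eqF.
- move=> _ /mapP[[[j k] [[e1 e2] f]] _ ->]; rewrite /z_/= ncM ncr.
  rewrite nc_circle_point// mulr1 ger0_norm; last first.
    by rewrite addr_ge0 ?mulr_ge0 ?subr_ge0// ltW.
  have := Jd j; have : 0 <= j%:R * delta by rewrite mulr_ge0// ltW.
  by move=> *; apply/andP; split; lra.
move=> zeta /andP[z1 z2].
have z0 : 0 < nc zeta by rewrite (lt_le_trans _ z1)// subr_gt0.
pose u := zeta / (nc zeta)%:C.
have u1 : nc u = 1 by rewrite ncM ncV ncr ger0_norm ?(ltW z0)// divff ?gt_eqF.
have [k [e1 [e2 [f [kK k1 uk]]]]] := circle_net d0 u1.
pose j := Num.truncn ((nc zeta - (1 - tau)) / delta).
have /trunc_itv/andP[j1 j2] : 0 <= (nc zeta - (1 - tau)) / delta.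
  by rewrite divr_ge0 ?subr_ge0// ltW.
rewrite -/j in j1 j2.
have jJ : (j < J.+1)%N.
  rewrite ltnS; apply: le_truncn; rewrite ler_pM2r ?invr_gt0//; lra.
have {}j1 : j%:R * delta <= nc zeta - (1 - tau) by rewrite -ler_pdivlMr.
have {}j2 : nc zeta - (1 - tau) < j%:R * delta + delta.
  by move: j2; rewrite ltr_pdivrMr// -natr1 mulrDl mul1r.
pose i : I := ((Ordinal jJ, Ordinal (kK : (k < K.+1)%N)), ((e1, e2), f)).
exists (z_ i); first by rewrite map_f ?mem_enum.
have zE : zeta = (nc zeta)%:C * u.
  by rewrite mulrC divfK// -nc_eq0 ncr normr_eq0 gt_eqF.
set c := circle_point delta k e1 e2 f in uk.
have c1 : nc c = 1 by exact: nc_circle_point.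
have -> : z_ i - zeta = (1 - tau + j%:R * delta - nc zeta)%:C * c -
    (nc zeta)%:C * (u - c).
  by rewrite [in LHS]zE /z_ /= -/c rmorphB; ring.
rewrite (le_trans (ncD _ _))// ncN !ncM !ncr c1 mulr1 (ger0_norm (ltW z0)).
have n1 : `|1 - tau + j%:R * delta - nc zeta| <= delta.
  by rewrite ler_norml; apply/andP; split; lra.
have : nc zeta * nc (u - c) <= 2 * (2 * delta) by rewrite ler_pM ?nc_ge0//; lra.
lra.
Qed.

End AnnulusNet.

(** * Counting roots in small discs and outside the annulus *)

Section RootCounting.
Variable R : realType.
Variables (n : nat) (c : R[i]) (rs : seq R[i]).
Hypothesis n0 : (0 < n)%N.
Hypothesis srs : size rs = n.
Let p : {poly R[i]} := c *: \prod_(z <- rs) ('X - z%:P).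

Let size_p : (size p <= n.+1)%N.
Proof. by rewrite (leq_trans (size_scale_leq _ _))// size_prod_XsubC srs. Qed.

Lemma root_factored z : z \in rs -> root p z.
Proof.
by move=> zrs; rewrite /root /p hornerZ horner_prod (big_rem z)//= hornerXsubC
  subrr mul0r mulr0.
Qed.

Lemma tcoef1_double_root z : (1 < count_mem z rs)%N -> tcoef p z 1 = 0.
Proof.
move=> cz; have zrs : z \in rs by rewrite -has_pred1 has_count (ltn_trans _ cz).
have zrs2 : z \in rem z rs.
  rewrite -has_pred1 has_count; move: cz.
  by rewrite (permP (perm_to_rem zrs)) /= eqxx.
rewrite /tcoef /p (big_rem z)//= (big_rem z zrs2)/= linearZ/=.
rewrite !rmorphM/= !comp_polyB !comp_polyX !comp_polyC !addrK.
by rewrite coefZ coefXM/= coefXM/= mulr0.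
Qed.

(** A multiple root has zero derivative and is not good, so good roots listed with multiplicity are
    distinct. *)
Lemma uniq_good_roots (L B : R) : 0 < L ->
  uniq [seq z <- rs | good_root n L B p z].
Proof.
move=> L0; apply/count_mem_uniq => z.
have [zg|zg] := boolP (z \in [seq z <- rs | good_root n L B p z]); last first.
  by apply/count_memPn.
apply/eqP; rewrite eqn_leq -has_count has_pred1 zg andbT.
rewrite leqNgt; apply/negP => c2.
have c3 : (1 < count_mem z rs)%N.
  by rewrite (leq_trans c2)// count_filter sub_count// => y /= /andP[].
move: zg; rewrite mem_filter => /andP[/andP[+ _] _].
by rewrite tcoef1_double_root// nc0 leNgt mulr_gt0// wgt_gt0.
Qed.

Let coef_dilate (q : {poly R[i]}) (r : R[i]) k : (q \Po (r *: 'X))`_k = q`_k * r ^+ k.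
Proof.
rewrite comp_polyE coef_sum.
under eq_bigr do rewrite exprZn coefZ coefZ coefXn.
have [kq|qk] := ltnP k (size q).
  rewrite (bigD1 (Ordinal kq))//= eqxx mulr1 big1 ?addr0// => j jk.
  rewrite (_ : (k == j :> nat) = false) ?mulr0//.
  by apply/eqP => kj; move/eqP: jk; apply; apply/val_inj.
rewrite nth_default// mul0r big1// => j _.
rewrite (_ : (k == j :> nat) = false) ?mulr0//; apply/eqP => kj.
by have := ltn_ord j; rewrite -kj ltnNge qk.
Qed.

(** Rescaling the disc of radius 1 / n about z to the unit disc brings it under [count_small_roots];
    the new coefficients are the Taylor coefficients at z times n^-k. *)
Lemma local_root_count (z : R[i]) (rho M : R) : 0 <= rho ->
  \sum_(k < n.+1) nc (tcoef p z k) * n%:R^-1 ^+ k <= M ->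
  nc p.[z] ^+ 2 <=
    (rho * n%:R) ^+ (2 * count (fun x => nc (z - x) <= rho) rs) * M ^+ 2.
Proof.
move=> rho0 sM; pose r : R := n%:R^-1.
have r0 : 0 < r by rewrite invr_gt0 ltr0n.
have rc0 : r%:C != 0 :> R[i] by rewrite -nc_eq0 ncr normr_eq0 gt_eqF.
pose rs' := [seq (x - z) / r%:C | x <- rs].
have pE : (p \Po ('X + z%:P)) \Po (r%:C *: 'X) =
    (c * r%:C ^+ n) *: \prod_(x <- rs') ('X - x%:P).
  rewrite /p !linearZ/= -scalerA !rmorph_prod/=; congr (_ *: _).
  rewrite -srs /rs' big_map; elim: (rs) => [|x s IH].
    by rewrite !big_nil scale1r.
  rewrite !big_cons IH /= exprS -scalerA [in RHS]scalerAr scalerAl; congr (_ * _).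
  rewrite !comp_polyB comp_polyX comp_polyC comp_polyD comp_polyX !comp_polyC.
  rewrite scalerBr -(mul_polyC _ (_%:P)) -polyCM mulrC divfK// polyCB.
  by rewrite opprB addrA.
have := count_small_roots (c * r%:C ^+ n) rs' (mulr_ge0 rho0 (ler0n R n)).
rewrite -pE size_map srs horner_comp hornerZ hornerX mulr0 horner_comp hornerD
  hornerX hornerC add0r count_map.
have -> : count (preim (fun x => (x - z) / r%:C) (fun z0 => nc z0 <= rho * n%:R)) rs =
    count (fun x => nc (z - x) <= rho) rs.
  apply: eq_count => x /=; rewrite ncM ncV ncr gtr0_norm// invrK ncBC.
  by rewrite ler_pM2r// ltr0n.
move=> /le_trans; apply; rewrite ler_wpM2l ?exprn_ge0 ?mulr_ge0//.
have pos k : 0 <= nc (tcoef p z k) * r ^+ k.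
  by rewrite mulr_ge0 ?nc_ge0 ?exprn_ge0// ltW.
apply: (@le_trans _ _ ((\sum_(k < n.+1) nc (tcoef p z k) * r ^+ k) ^+ 2)).
  rewrite expr2 mulr_suml; apply: ler_sum => k _.
  rewrite coef_dilate -/(tcoef p z k) ncM ncX ncr gtr0_norm// expr2 ler_wpM2l//.
  by rewrite (bigD1 k)//= lerDl sumr_ge0.
by rewrite lerXn2r ?nnegrE ?sumr_ge0// (le_trans _ sM)// sumr_ge0.
Qed.

End RootCounting.

Section GeometricCount.
Variable R : realType.

Lemma expR_half_le (tau : R) : 0 <= tau <= 1 -> expR (tau / 2) <= 1 + tau.
Proof.
move=> /andP[t0 t1].
have h : 1 - tau / 2 <= expR (- (tau / 2)) by exact: expR_ge1Dx.
have h0 : 0 < 1 - tau / 2 by lra.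
have : expR (tau / 2) <= (1 - tau / 2)^-1.
  by rewrite -[leLHS]invrK -expRN lef_pV2 ?posrE ?expR_gt0.
move=> /le_trans; apply; rewrite -div1r ler_pdivrMr//.
have : 0 <= tau * (1 - tau) by rewrite mulr_ge0 ?subr_ge0.
lra.
Qed.

(** Since exp(tau / 2) <= 1 + tau, the power 2 N dominates exp(tau N), and exponentials are compared
    without logarithms. *)
Lemma geometric_count (tau Q x : R) N : 0 <= tau <= 1 ->
  (1 + tau) ^+ (2 * N) <= Q -> Q <= expR x -> tau * N%:R <= x.
Proof.
move=> t01 tQ Qx; rewrite -ler_expR (le_trans _ Qx)// (le_trans _ tQ)//.
have -> : tau * N%:R = (2 * N)%:R * (tau / 2).
  by rewrite natrM mulrAC -mulrA mulrCA mulrA divfK.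
rewrite expRM_natl lerXn2r ?nnegrE ?expR_ge0 ?expR_half_le//.
by case/andP: t01 => *; rewrite addr_ge0.
Qed.

End GeometricCount.

(** * From bad cells to the number of components *)

Section ComponentCount.
Variable R : realType.
Variables (n : nat) (p : {poly R[i]}) (c : R[i]) (rs zs : seq R[i]).
Variables (tau rho r L B A alpha beta kappa gamma e Q x : R).

Definition bad_cell z :=
  (nc p.[z] <= alpha * wgt n z) && (nc (z * tcoef p z 1) <= beta * wgt n z) ||
  (kappa * wgt n z <= nc (tcoef p z 2)).

Hypotheses (n0 : (0 < n)%N) (srs : size rs = n)
  (pE : p = c *: \prod_(z <- rs) ('X - z%:P)).
Hypothesis net : forall zeta, 1 - tau <= nc zeta <= 1 + tau ->
  exists2 z, z \in zs & nc (z - zeta) <= rho.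
Hypothesis zs2 : {in zs, forall z, nc z <= 2}.
Hypothesis sA : 4 * \sum_(l < n.+1) nc p`_l <= A.
Hypotheses (L0 : 0 < L) (B0 : 0 <= B) (rho0 : 0 <= rho) (r0 : 0 < r)
  (t01 : 0 < tau <= 1).
Hypotheses (rhon : 2 * rho <= n%:R^-1) (rn : 2 * r <= n%:R^-1).
Hypothesis iso : B * r + 8 * A * r ^+ 2 * n%:R ^+ 3 <= L / 4.
Hypothesis ring_gt1 : 1 < 3 / 4 * L * (r / 2).
Hypothesis cellB : 8 * A * rho * n%:R ^+ 3 <= B.
Hypothesis cell0 :
  4 * (L * rho + B * rho ^+ 2 + 8 * A * rho ^+ 3 * n%:R ^+ 3) <= alpha.
Hypothesis cell1 :
  8 * (L + 2 * B * rho + 8 * A * rho ^+ 2 * n%:R ^+ 3) <= beta.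
Hypothesis cell2 : kappa <= (B - 8 * A * rho * n%:R ^+ 3) / 4.
Hypothesis g0 : 0 <= gamma.
Hypothesis nonsmall : {in zs, forall z, gamma * wgt n z < nc p.[z]}.
Hypotheses (rho1 : rho * n%:R <= 1) (rhoA : (rho * n%:R) ^+ 10 * A ^+ 2 <= gamma ^+ 2).
Hypotheses (e0 : 0 < e) (pe0 : e <= nc p`_0 ^+ 2) (pen : e <= nc p`_n ^+ 2).
Hypotheses (Qe : \sum_(k < n.+1) nc p`_k ^+ 2 <= e * Q) (Qx : Q <= expR x).

Let sp : (size p <= n.+1)%N.
Proof.
by rewrite pE (leq_trans (size_scale_leq _ _))// size_prod_XsubC srs.
Qed.

Let good := good_root n L B p.

Let lead : p`_n = c.
Proof.
have := monicP (monic_prod_XsubC rs xpredT id); rewrite lead_coefE.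
by rewrite size_prod_XsubC srs/= pE coefZ => ->; rewrite mulr1.
Qed.

(** Landau's bound and |p(0)|^2 >= e give 1 <= (1 - tau)^(2 N) Q; then (1 - tau) (1 + tau) <= 1
    leads to [geometric_count]. *)
Let inner_count : tau * (count (fun z => nc z <= 1 - tau) rs)%:R <= x.
Proof.
set N := count _ _; have /andP[t0 t1] := t01.
have t1' : 0 <= 1 - tau by rewrite subr_ge0.
have := count_small_roots c rs t1'; rewrite srs -pE horner_coef0 -/N => H.
apply: (geometric_count (Q := Q)) Qx; first by rewrite ltW.
have pos : 0 <= (1 + tau) ^+ (2 * N) by rewrite exprn_ge0// addr_ge0// ltW.
have H2 : e <= (1 - tau) ^+ (2 * N) * (e * Q).
  by rewrite (le_trans pe0)// (le_trans H)// ler_wpM2l// exprn_ge0.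
rewrite -(ler_pM2l e0); have := ler_wpM2l pos H2.
rewrite mulrC => /le_trans; apply.
rewrite mulrA -exprMn ler_piMl//.
  by rewrite (le_trans _ Qe)// sumr_ge0// => k _; exact: sqr_ge0.
rewrite exprn_ile1 ?mulr_ge0// ?addr_ge0 ?(ltW t0)//.
have : 0 <= tau * tau by rewrite mulr_ge0 ?(ltW t0).
nra.
Qed.

Let outer_count : tau * (count (fun z => (1 + tau <= nc z)%R) rs)%:R <= x.
Proof.
set N := count _ _; have /andP[t0 t1] := t01.
have t1' : 0 <= 1 + tau by rewrite addr_ge0// ltW.
have := count_large_roots c rs t1'; rewrite srs -pE -/N => H.
apply: (geometric_count (Q := Q)) Qx; first by rewrite ltW.
rewrite -(ler_pM2l e0) (le_trans _ Qe)// (le_trans _ H)//.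
by rewrite ler_wpM2r ?exprn_ge0// -lead.
Qed.

(** Five roots in the disc would force |p(z)| <= (rho n)^5 A times the weight, which is at most
    gamma times the weight. With rho n about s^-48, A = s^97 and gamma = s^-98, four roots would not
    be enough for this. *)
Let cell_count z : z \in zs ->
  (count (fun y => (nc (z - y) <= rho)%R) rs <= 4)%N.
Proof.
move=> zzs; rewrite leqNgt; apply/negP => c5.
have w0 := wgt_gt0 n z.
have sM : \sum_(k < n.+1) nc (tcoef p z k) * n%:R^-1 ^+ k <= A * wgt n z.
  by rewrite (le_trans (sum_tcoef_wgt z n0 sp))// ler_wpM2r// ltW.
rewrite pE in sM; have := local_root_count n0 srs rho0 sM; rewrite -pE.
apply/negP; rewrite -ltNge.
have rn0 : 0 <= rho * n%:R by rewrite mulr_ge0.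
apply: (@le_lt_trans _ _ ((rho * n%:R) ^+ 10 * (A * wgt n z) ^+ 2)).
  rewrite ler_wpM2r ?sqr_ge0// ler_wiXn2l//.
  exact: (leq_mul (leqnn 2) c5).
rewrite [X in _ * X < _]exprMn; apply: (@le_lt_trans _ _ (gamma ^+ 2 * wgt n z ^+ 2)).
  by rewrite [leLHS]mulrA ler_wpM2r ?sqr_ge0.
by rewrite -exprMn ltrXn2r// ?nnegrE ?mulr_ge0 ?nc_ge0 ?(ltW w0)// nonsmall.
Qed.

Let bad_root_near zeta : root p zeta -> ~~ good zeta ->
  1 - tau <= nc zeta <= 1 + tau ->
  exists2 z, z \in zs & bad_cell z && (nc (z - zeta) <= rho).
Proof.
move=> rz bz az; have [z zzs zz] := net az; exists z => //; rewrite zz andbT.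
have w0 := wgt_gt0 n z.
have [[b0 b1]|b2] := bad_root_cell n0 sp (ltW L0) B0 rho0 rhon sA rz bz zz cellB.
  apply/orP; left; rewrite (le_trans b0) ?ler_wpM2r ?(ltW w0)//= ncM.
  apply: (@le_trans _ _ (2 * (4 * (L + 2 * B * rho +
      8 * A * rho ^+ 2 * n%:R ^+ 3) * wgt n z))).
    by rewrite ler_pM ?nc_ge0// zs2.
  rewrite 2!mulrA ler_wpM2r ?(ltW w0)// (le_trans _ cell1)//; lra.
apply/orP; right; apply: le_trans b2.
by rewrite ler_wpM2r ?(ltW w0).
Qed.

(** Every root that is not good is charged to the inside, to the outside, or to a nearby bad cell,
    and a bad cell is charged at most four times. *)
Let bad_count : (count (predC good) rs <= count (fun z => (nc z <= 1 - tau)%R) rs +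
  count (fun z => (1 + tau <= nc z)%R) rs + 4 * count bad_cell zs)%N.
Proof.
have cntE (a : pred R[i]) s : count a s = (\sum_(y <- s) a y)%N.
  by rewrite -sum1_count big_mkcond; apply: eq_bigr => y _; case: (a y).
apply: (@leq_trans (count (fun z => (nc z <= 1 - tau)%R) rs +
    count (fun z => (1 + tau <= nc z)%R) rs +
    \sum_(z <- zs) \sum_(y <- rs) (bad_cell z && (nc (z - y) <= rho)%R))%N).
  rewrite !cntE exchange_big/= -!big_split/= big_seq [leqRHS]big_seq.
  apply: leq_sum => y yrs; case: (boolP (good y)) => [//|by_].
  have [//|y1] := boolP (nc y <= 1 - tau).
  have [|y2] := boolP (1 + tau <= nc y); first by rewrite addnAC leq_addl.
  rewrite -ltNge in y1; rewrite -ltNge in y2.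
  have az : 1 - tau <= nc y <= 1 + tau by rewrite !ltW.
  have ry : root p y by rewrite pE; exact: root_factored.
  have [z zzs zy] := bad_root_near ry by_ az.
  by rewrite (big_rem z)//= zy.
rewrite leq_add2l cntE big_distrr/= big_seq [leqRHS]big_seq.
apply: leq_sum => z zzs; case: (bad_cell z); last first.
  by rewrite big1.
by rewrite muln1 -cntE; exact: cell_count.
Qed.

Lemma betti0_ge_bad_cells :
  ((n%:R - 2 * (x / tau) - 4 * (count bad_cell zs)%:R)%:E <=
   betti0 R (lemniscate p))%E.
Proof.
have /andP[t0 t1] := t01.
have k0 : 0 < 3 / 4 * L by rewrite mulr_gt0.
have ug : uniq [seq z <- rs | good z].
  by have := uniq_good_roots n c rs B L0; rewrite -pE.
have H := @betti0_ge R p [seq z <- rs | good z] r (3 / 4 * L) ug r0 ring_gt1.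
apply: le_trans (H _ _).
- rewrite lee_fin size_filter.
  have nE : n%:R = (count good rs)%:R + (count (predC good) rs)%:R :> R.
    by rewrite -natrD count_predC srs.
  have := bad_count; rewrite -(ler_nat R) natrD natrM natrD nE.
  have := inner_count; have := outer_count.
  rewrite -!ler_pdivlMl// ![tau^-1 * _]mulrC => h1 h2 h3.
  move: h1 h2 h3; move: (x / tau) (count _ _)%:R (count _ _)%:R (count _ _)%:R
    (count _ _)%:R (count _ _)%:R => u v1 v2 v3 v4 v5 *; lra.
- by move=> z; rewrite mem_filter => /andP[_ zrs]; rewrite pE; exact: root_factored.
move=> z; rewrite mem_filter => /andP[gz zrs] h hr.
have rz : root p z by rewrite pE; exact: root_factored.
exact: (good_root_isolated n0 sp (ltW L0) (ltW r0) rn sA rz gz hr iso).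
Qed.

End ComponentCount.

(** * Choice of parameters *)

Section PowersOfScale.
Variables (R : realType) (s : R).
Hypothesis s64 : 64 <= s.
Let u := s^-1.

Let s0 : 0 < s. Proof. by rewrite (lt_le_trans _ s64). Qed.
Let u0 : 0 < u. Proof. by rewrite invr_gt0. Qed.

(** The numerical inequalities below come down to comparing exponents: each spare power of s absorbs
    a factor 64. *)
Lemma scale_pow_lt k l : (k < l)%N -> 64 * s ^+ k <= s ^+ l.
Proof.
move=> kl; apply: (@le_trans _ _ (s ^+ k.+1)).
  by rewrite exprS ler_wpM2r// exprn_ge0// ltW.
by rewrite ler_weXn2l// (le_trans _ s64)// ler1n.
Qed.

Lemma scale_mul_inv k l : (k <= l)%N -> s ^+ k * u ^+ l = u ^+ (l - k).
Proof.
move=> kl; rewrite -{1}(subnK kl) exprD mulrCA -exprMn /u divff ?gt_eqF//.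
by rewrite expr1n mulr1.
Qed.

Lemma scale_mul_inv' k l : (l <= k)%N -> s ^+ k * u ^+ l = s ^+ (k - l).
Proof.
move=> kl; rewrite -{1}(subnK kl) exprD -mulrA -exprMn /u divff ?gt_eqF//.
by rewrite expr1n mulr1.
Qed.

Lemma scale_inv_pow_lt k l : (k < l)%N -> 64 * u ^+ l <= u ^+ k.
Proof.
move=> kl; have u1 : 64 * u <= 1 by rewrite ler_pdivrMr// mul1r.
apply: (@le_trans _ _ (64 * u ^+ k.+1)).
  rewrite ler_wpM2l// ler_wiXn2l// ?(ltW u0)//.
  by rewrite (le_trans _ u1)// ler_peMl ?(ltW u0)// ler1n.
by rewrite exprS mulrA ler_piMl// exprn_ge0// ltW.
Qed.

Lemma numeric_cell0 : 4 * (s ^+ 137 * (5 * u ^+ 144) + s ^+ 272 * (5 * u ^+ 144) ^+ 2 +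
  8 * s ^+ 97 * (5 * u ^+ 144) ^+ 3 * (s ^+ 96) ^+ 3) <= u ^+ 6.
Proof.
have -> : s ^+ 137 * (5 * u ^+ 144) = 5 * u ^+ 7.
  by rewrite mulrCA scale_mul_inv.
have -> : s ^+ 272 * (5 * u ^+ 144) ^+ 2 = 25 * u ^+ 16.
  rewrite exprMn -exprM mulrCA scale_mul_inv//. congr (_ * _). ring.
have -> : 8 * s ^+ 97 * (5 * u ^+ 144) ^+ 3 * (s ^+ 96) ^+ 3 = 1000 * u ^+ 47.
  rewrite exprMn -!exprM.
  rewrite [LHS](_ : _ = 8 * 5 ^+ 3 * ((s ^+ 97 * s ^+ 288) * u ^+ 432)); last by ring.
  rewrite -exprD scale_mul_inv//; congr (_ * _); ring.
have h7 := @scale_inv_pow_lt 6 7 isT.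
have h16 := @scale_inv_pow_lt 7 16 isT.
have h47 := @scale_inv_pow_lt 16 47 isT.
have p7 : 0 <= u ^+ 7 by rewrite exprn_ge0// ltW.
move: h7 h16 h47 p7; move: (u ^+ 6) (u ^+ 7) (u ^+ 16) (u ^+ 47) => a b c d *.
lra.
Qed.

Lemma numeric_cell1 : 8 * (s ^+ 137 + 2 * s ^+ 272 * (5 * u ^+ 144) +
  8 * s ^+ 97 * (5 * u ^+ 144) ^+ 2 * (s ^+ 96) ^+ 3) <= s ^+ 139.
Proof.
have -> : 2 * s ^+ 272 * (5 * u ^+ 144) = 10 * s ^+ 128.
  rewrite [LHS](_ : _ = 10 * (s ^+ 272 * u ^+ 144)); last by ring.
  by rewrite scale_mul_inv'.
have -> : 8 * s ^+ 97 * (5 * u ^+ 144) ^+ 2 * (s ^+ 96) ^+ 3 = 200 * s ^+ 97.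
  rewrite exprMn -!exprM.
  rewrite [LHS](_ : _ = 200 * ((s ^+ 97 * s ^+ 288) * u ^+ 288)); last by ring.
  by rewrite -exprD scale_mul_inv'.
have h1 := @scale_pow_lt 138 139 isT.
have h2 := @scale_pow_lt 137 138 isT.
have h3 := @scale_pow_lt 128 137 isT.
have h4 := @scale_pow_lt 97 137 isT.
have p : 0 <= s ^+ 137 by rewrite exprn_ge0// ltW.
move: h1 h2 h3 h4 p.
move: (s ^+ 139) (s ^+ 138) (s ^+ 137) (s ^+ 128) (s ^+ 97) => a b c d e *.
lra.
Qed.

Let cellBE : 8 * s ^+ 97 * (5 * u ^+ 144) * (s ^+ 96) ^+ 3 = 40 * s ^+ 241.
Proof.
rewrite -exprM.
rewrite [LHS](_ : _ = 40 * ((s ^+ 97 * s ^+ 288) * u ^+ 144)); last by ring.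
by rewrite -exprD scale_mul_inv'.
Qed.

Lemma numeric_cellB : 8 * s ^+ 97 * (5 * u ^+ 144) * (s ^+ 96) ^+ 3 <= s ^+ 272.
Proof.
rewrite cellBE; have h := @scale_pow_lt 241 272 isT.
have p : 0 <= s ^+ 241 by rewrite exprn_ge0// ltW.
by move: h p; move: (s ^+ 272) (s ^+ 241) => a b *; lra.
Qed.

Lemma numeric_cell2 :
  s ^+ 271 <= (s ^+ 272 - 8 * s ^+ 97 * (5 * u ^+ 144) * (s ^+ 96) ^+ 3) / 4.
Proof.
rewrite cellBE; have h := @scale_pow_lt 241 271 isT.
have h' := @scale_pow_lt 271 272 isT.
have p : 0 <= s ^+ 241 by rewrite exprn_ge0// ltW.
by move: h h' p; move: (s ^+ 272) (s ^+ 271) (s ^+ 241) => a b c *; lra.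
Qed.

Lemma numeric_iso : s ^+ 272 * (4 * u ^+ 137) +
  8 * s ^+ 97 * (4 * u ^+ 137) ^+ 2 * (s ^+ 96) ^+ 3 <= s ^+ 137 / 4.
Proof.
have -> : s ^+ 272 * (4 * u ^+ 137) = 4 * s ^+ 135 by rewrite mulrCA scale_mul_inv'.
have -> : 8 * s ^+ 97 * (4 * u ^+ 137) ^+ 2 * (s ^+ 96) ^+ 3 = 128 * s ^+ 111.
  rewrite exprMn -!exprM.
  rewrite [LHS](_ : _ = 128 * ((s ^+ 97 * s ^+ 288) * u ^+ 274)); last by ring.
  by rewrite -exprD scale_mul_inv'.
have h := @scale_pow_lt 135 137 isT.
have h' := @scale_pow_lt 111 135 isT.
have p : 0 <= s ^+ 111 by rewrite exprn_ge0// ltW.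
by move: h h' p; move: (s ^+ 137) (s ^+ 135) (s ^+ 111) => a b c *; lra.
Qed.

Lemma numeric_ring : 1 < 3 / 4 * s ^+ 137 * (4 * u ^+ 137 / 2).
Proof.
rewrite [ltRHS](_ : _ = 3 / 2 * (s ^+ 137 * u ^+ 137)); last by field.
by rewrite scale_mul_inv// subnn expr0; lra.
Qed.

Lemma numeric_rho : 2 * (5 * u ^+ 144) <= u ^+ 96.
Proof.
have h := @scale_inv_pow_lt 96 144 isT.
have p : 0 <= u ^+ 144 by rewrite exprn_ge0// ltW.
by move: h p; move: (u ^+ 96) (u ^+ 144) => a b *; lra.
Qed.

Lemma numeric_r : 2 * (4 * u ^+ 137) <= u ^+ 96.
Proof.
have h := @scale_inv_pow_lt 96 137 isT.
have p : 0 <= u ^+ 137 by rewrite exprn_ge0// ltW.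
by move: h p; move: (u ^+ 96) (u ^+ 137) => a b *; lra.
Qed.

Lemma numeric_rho1 : 5 * u ^+ 144 * s ^+ 96 <= 1.
Proof.
rewrite -mulrA [X in 5 * X]mulrC scale_mul_inv//.
have h := @scale_inv_pow_lt 0 48 isT.
have p : 0 <= u ^+ 48 by rewrite exprn_ge0// ltW.
by move: h p; rewrite expr0; move: (u ^+ 48) => a *; lra.
Qed.

Lemma numeric_rhoA : (5 * u ^+ 144 * s ^+ 96) ^+ 10 * (s ^+ 97) ^+ 2 <= (u ^+ 98) ^+ 2.
Proof.
rewrite -mulrA [X in 5 * X]mulrC scale_mul_inv//.
have h := @scale_inv_pow_lt 0 1 isT.
have p u' : 0 <= u ^+ u' by rewrite exprn_ge0// ltW.
apply: (@le_trans _ _ ((u ^+ 47) ^+ 10 * (s ^+ 97) ^+ 2)).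
  rewrite ler_wpM2r ?sqr_ge0// lerXn2r// ?nnegrE ?p//.
    exact: mulr_ge0 (ler0n _ _) (p _).
  have h' := @scale_inv_pow_lt 47 48 isT.
  have := p 48; move: h'; move: (u ^+ 47) (u ^+ 48) => a b *; lra.
rewrite -!exprM mulrC scale_mul_inv// ler_wiXn2l ?(ltW u0)//.
by move: h; rewrite expr0 expr1 => h; lra.
Qed.

(** This governs gamma = s^-98: with about s^194 centres, the union bound needs gamma^2 well below
    s^-194. *)
Lemma numeric_small : 48 * u ^+ 94 / (u ^+ 144) ^+ 2 * (4 * (u ^+ 98) ^+ 2) <= 3 * u.
Proof.
have e : (u ^+ 144) ^+ 2 = u ^+ 288 by rewrite -exprM.
have un0 : u ^+ 288 != 0 by rewrite expf_neq0// gt_eqF.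
rewrite e -exprM mulrAC ler_pdivrMr ?exprn_gt0//.
rewrite [leLHS](_ : _ = 192 * (u ^+ 290)); last first.
  rewrite [RHS](_ : _ = 192 * (u ^+ 94 * u ^+ 196)); first by ring.
  by rewrite -exprD.
rewrite -mulrA -exprS; have := @scale_inv_pow_lt 289 290 isT.
move: (u ^+ 289) (u ^+ 290) => a b *; lra.
Qed.

(** About s^194 cells, each bad with probability of order s^-110 + s^-124, against the threshold
    s^95: the resulting order s^-11 leaves room for the constants. *)
Lemma numeric_bad (m : R) : s ^+ 94 <= 32 * m ->
  48 * u ^+ 94 / (u ^+ 144) ^+ 2 *
   (64 * ((u ^+ 6) ^+ 2 * (s ^+ 139) ^+ 2) / m ^+ 4 +
    8 * ((s ^+ 96) ^+ 5 / (s ^+ 271) ^+ 2) ^+ 2) / s ^+ 95 <= u.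
Proof.
move=> sm; have pu k : 0 < u ^+ k by rewrite exprn_gt0.
have ps k : 0 < s ^+ k by rewrite exprn_gt0.
have m0 : 0 < m by rewrite -(pmulr_rgt0 m (ltr0n R 32)) (lt_le_trans (ps 94)).
have iu k : (u ^+ k)^-1 = s ^+ k by rewrite /u exprVn invrK.
have is' k : (s ^+ k)^-1 = u ^+ k by rewrite /u exprVn.
have mi : (m ^+ 4)^-1 <= 32 ^+ 4 * u ^+ 376.
  rewrite -(ler_pM2r (exprn_gt0 4 m0)) mulVf ?gt_eqF ?exprn_gt0//.
  rewrite mulrAC -exprMn -[leLHS](_ : s ^+ 376 * u ^+ 376 = 1); last first.
    by rewrite scale_mul_inv// subnn.
  rewrite ler_wpM2r ?(ltW (pu _))// -[376%N]/(94 * 4)%N exprM.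
  by rewrite lerXn2r ?nnegrE ?(ltW (ps _))// mulr_ge0// ltW.
rewrite is' -!exprM iu.
have -> : (s ^+ (96 * 5) / s ^+ (271 * 2)) ^+ 2 = u ^+ 124.
  by rewrite is' scale_mul_inv// -exprM.
have -> : 48 * u ^+ 94 * s ^+ (144 * 2) = 48 * s ^+ 194.
  by rewrite -mulrA [X in 48 * X]mulrC scale_mul_inv'.
have -> : u ^+ (6 * 2) * s ^+ (139 * 2) = s ^+ 266.
  by rewrite mulrC scale_mul_inv'.
have h1 : 64 * s ^+ 266 / m ^+ 4 <= 4 * 64 ^+ 4 * u ^+ 110.
  apply: (@le_trans _ _ (64 * s ^+ 266 * (32 ^+ 4 * u ^+ 376))).
    by rewrite ler_wpM2l// mulr_ge0// ltW.
  rewrite [leLHS](_ : _ = 4 * 64 ^+ 4 * (s ^+ 266 * u ^+ 376)); last by ring.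
  by rewrite scale_mul_inv.
apply: (@le_trans _ _ (48 * s ^+ 194 * (4 * 64 ^+ 4 * u ^+ 110 + 8 * u ^+ 124) *
    u ^+ 95)).
  apply: ler_wpM2r; first exact: ltW.
  apply: ler_wpM2l; first exact: mulr_ge0 (ler0n _ _) (ltW (ps _)).
  exact: lerD.
rewrite [leLHS](_ : _ = 48 * ((s ^+ 194 * (u ^+ 95 * u ^+ 110)) * (4 * 64 ^+ 4)) +
  48 * 8 * (s ^+ 194 * (u ^+ 95 * u ^+ 124))); last by ring.
rewrite -!exprD !scale_mul_inv//.
have h2 : 64 ^+ 4 * u ^+ 11 <= u ^+ 7.
  have a1 := @scale_inv_pow_lt 7 8 isT.
  have a2 := @scale_inv_pow_lt 8 9 isT.
  have a3 := @scale_inv_pow_lt 9 10 isT.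
  have a4 := @scale_inv_pow_lt 10 11 isT.
  rewrite [leLHS](_ : _ = 64 * (64 * (64 * (64 * u ^+ 11)))); last first.
    by move: (u ^+ 11) => a; rewrite !exprS expr0 mulr1 -!mulrA.
  move: a1 a2 a3 a4.
  move: (u ^+ 7) (u ^+ 8) (u ^+ 9) (u ^+ 10) (u ^+ 11) => a b c d e *; lra.
have h3 := @scale_inv_pow_lt 7 25 isT.
have h4 := @scale_inv_pow_lt 6 7 isT.
have h5 := @scale_inv_pow_lt 1 6 isT.
have := pu 7; move: h2 h3 h4 h5; rewrite expr1.
move: (64 ^+ 4) (u ^+ 25) (u ^+ 11) (u ^+ 7) (u ^+ 6) => k a b c d *.
have : 48 * (b * (4 * k)) = 192 * (k * b) by ring.
move=> ->; lra.
Qed.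

End PowersOfScale.

(** * Bounds for expectations and for the number of events that occur *)

Section LowerIntegral.
Import HBNNSimple.
Context d (T : measurableType d) (R : realType) (P : probability T R).
Implicit Types (f : T -> \bar R) (E : R[i] -> T -> bool).

(* The integral of a nonnegative function is a supremum over the simple functions
   below it, so the expectation of betti0 is bounded without knowing that betti0
   is measurable. *)
Lemma integral_le_cst f (K : R) : (forall w, 0 <= f w)%E ->
  (forall w, f w <= K%:E)%E -> (\int[P]_w f w <= K%:E)%E.
Proof.
move=> f0 fK; rewrite ge0_integralTE//.
apply: ge_ereal_sup => _ [h /= hf <-].
rewrite -integralT_nnsfun (@le_trans _ _ (\int[P]_w K%:E)%E)//.
  apply: ge0_le_integral => //.
  - by move=> w _; rewrite lee_fin fun_ge0.
  - exact/measurable_EFinP/measurable_funP.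
  - by move=> w _; rewrite (le_trans (hf w)).
by rewrite integral_cst// [X in (_ * X)%E]probability_setT mule1.
Qed.

Lemma integral_ge_event f (K : R) (G : set T) : measurable G -> 0 <= K ->
  (forall w, 0 <= f w)%E -> (forall w, G w -> K%:E <= f w)%E ->
  (K%:E * P G <= \int[P]_w f w)%E.
Proof.
move=> mG K0 f0 fK; rewrite ge0_integralTE//.
pose h := scale_nnsfun (indic_nnsfun R mG) K0.
apply: ereal_sup_ubound; exists h => /=.
  move=> w; rewrite /h/=; have [/set_mem Gw|Gw] := boolP (w \in G).
    by rewrite mindicE mem_set// mulr1 fK.
  by rewrite mindicE (negbTE Gw) mulr0 f0.
transitivity (\int[P]_w (h w)%:E)%E; first by rewrite integralT_nnsfun.
rewrite (eq_integral (fun w => K%:E * (\1_G w)%:E)%E)//.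
rewrite ge0_integralZl_EFin//; last exact/measurable_EFinP/measurable_indicP.
by rewrite integral_indic// setIT.
Qed.

Lemma measurable_count E (zs : seq R[i]) :
  {in zs, forall z, measurable [set w | E z w]} ->
  measurable_fun [set: T] (fun w => (count (E^~ w) zs)%:R : R).
Proof.
elim: zs => [|z zs IH] mE; first exact: measurable_cst.
rewrite /= (_ : (fun _ => _) = fun w => \1_[set w | E z w] w +
   (count (E^~ w) zs)%:R); last first.
  apply/funext => w; rewrite natrD indicE; congr (_ + _).
  by congr (_%:R : R); congr nat_of_bool; apply/idP/idP => [/mem_set|/set_mem].
apply: measurable_funD; first by apply/measurable_indicP/mE; exact: mem_head.
by apply: IH => y yzs; apply: mE; rewrite inE yzs orbT.
Qed.

Lemma integral_count E (zs : seq R[i]) (q : R) :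
  {in zs, forall z, measurable [set w | E z w]} ->
  {in zs, forall z, P [set w | E z w] <= q%:E}%E ->
  (\int[P]_w ((count (E^~ w) zs)%:R)%:E <= ((size zs)%:R * q)%:E)%E.
Proof.
elim: zs => [|z zs IH] mE PE.
  by rewrite mul0r integral0.
have mE' : {in zs, forall z, measurable [set w | E z w]}.
  by move=> y yzs; apply: mE; rewrite inE yzs orbT.
have PE' : {in zs, forall z, P [set w | E z w] <= q%:E}%E.
  by move=> y yzs; apply: PE; rewrite inE yzs orbT.
have mz : measurable [set w | E z w] by apply: mE; exact: mem_head.
rewrite /= (eq_integral (fun w => ((\1_[set w | E z w] w)%:E +
   ((count (E^~ w) zs)%:R)%:E)%E)); last first.
  move=> w _; rewrite natrD indicE EFinD; congr (_%:E + _)%E.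
  by congr (_%:R : R); congr nat_of_bool; apply/idP/idP => [/mem_set|/set_mem].
rewrite ge0_integralD//; last 2 first.
- exact/measurable_EFinP/measurable_indicP.
- exact/measurable_EFinP/measurable_count.
rewrite (_ : (size zs).+1%:R * q = q + (size zs)%:R * q); last first.
  by rewrite -natr1 mulrDl mul1r addrC.
rewrite integral_indic// setIT EFinD.
by apply: leeD; [apply: PE; exact: mem_head|exact: IH].
Qed.

Lemma measurable_count_ge E (zs : seq R[i]) (k : R) :
  {in zs, forall z, measurable [set w | E z w]} ->
  measurable [set w | k <= (count (E^~ w) zs)%:R].
Proof.
move=> mE; rewrite -[X in measurable X]setTI; apply: measurable_fun_le => //.
exact: measurable_count.
Qed.

Lemma prob_count_ge E (zs : seq R[i]) (q k : R) : 0 < k ->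
  {in zs, forall z, measurable [set w | E z w]} ->
  {in zs, forall z, P [set w | E z w] <= q%:E}%E ->
  (P [set w | (k <= (count (E^~ w) zs)%:R)%R] <= ((size zs)%:R * q / k)%:E)%E.
Proof.
move=> k0 mE PE; apply: (@markov_bound _ _ _ P _
  (fun w => (count (E^~ w) zs)%:R : R)) => //.
- exact: measurable_count_ge.
- exact: measurable_count.
- exact: integral_count.
Qed.

End LowerIntegral.

(** * Components of a typical polynomial *)

Section TypicalPolynomial.
Variables (R : realType) (n : nat) (s : R) (zs : seq R[i]) (p : {poly R[i]}).
Let u := s^-1.
Hypotheses (n0 : (0 < n)%N) (s64 : 64 <= s) (ns : n%:R = s ^+ 96).
Hypothesis net : forall zeta, 1 - u ^+ 94 <= nc zeta <= 1 + u ^+ 94 ->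
  exists2 z, z \in zs & nc (z - zeta) <= 5 * u ^+ 144.
Hypothesis zs_annulus : {in zs, forall z, 1 - u ^+ 94 <= nc z <= 1 + u ^+ 94}.
Hypotheses (sp : (size p <= n.+1)%N)
  (norm_p : \sum_(k < n.+1) nc p`_k ^+ 2 <= s ^+ 97)
  (p0 : u <= nc p`_0) (pn : u <= nc p`_n).
Hypothesis nonsmall : {in zs, forall z, u ^+ 98 * wgt n z < nc p.[z]}.
Hypothesis few_bad :
  (count (bad_cell n p (u ^+ 6) (s ^+ 139) (s ^+ 271)) zs)%:R <= s ^+ 95.

Let s0 : 0 < s. Proof. exact: lt_le_trans s64. Qed.
Let u0 : 0 < u. Proof. by rewrite invr_gt0. Qed.
Let ps k : 0 < s ^+ k. Proof. exact: exprn_gt0. Qed.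
Let pu k : 0 < u ^+ k. Proof. exact: exprn_gt0. Qed.
Let u1 : u <= 1. Proof. by rewrite invf_le1// (le_trans _ s64)// ler1n. Qed.
Let uk1 k : u ^+ k <= 1. Proof. by rewrite exprn_ile1// ltW. Qed.

Let sum_coef : 4 * \sum_(l < n.+1) nc p`_l <= s ^+ 97.
Proof.
(* Summed over the n + 1 coefficients this gives s^97 / 16 + 4 (n + 1), four times which is still
   below s^97. *)
have amgm (x : R) : x <= x ^+ 2 / 16 + 4.
  have := sqr_ge0 (x / 4 - 2); rewrite [X in 0 <= X](_ : _ = x ^+ 2 / 16 + 4 - x).
    by rewrite subr_ge0.
  by field.
have h : \sum_(l < n.+1) nc p`_l <= s ^+ 97 / 16 + 4 * (s ^+ 96 + 1).
  apply: (le_trans (ler_sum _ (fun (l : 'I_n.+1) _ => amgm (nc p`_l)))).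
  rewrite big_split/= -mulr_suml sumr_const card_ord -ns natr1 mulr_natr lerD2r.
  by rewrite ler_wpM2r// invr_ge0.
have h1 : 64 * s ^+ 96 <= s ^+ 97 by exact: scale_pow_lt.
have h2 : 1 <= s ^+ 96 by rewrite exprn_ege1// (le_trans _ s64)// ler1n.
move: h h1 h2; move: (s ^+ 97) (s ^+ 96) (\sum_(l < n.+1) _) => x y z *; lra.
Qed.

Lemma betti0_typical : ((n%:R * (1 - 202 * u))%:E <= betti0 R (lemniscate p))%E.
Proof.
have size_p : size p = n.+1.
  apply/eqP; rewrite eqn_leq sp ltnNge; apply/negP => /leq_sizeP/(_ n (leqnn n)) E.
  by move: pn; rewrite E nc0 leNgt u0.
have [rs rsE] := closed_field_poly_normal p.
have srs : size rs = n.
  have : lead_coef p != 0 by rewrite lead_coef_eq0 -size_poly_eq0 size_p.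
  move=> c0; move: size_p; rewrite rsE size_scale// size_prod_XsubC; exact: succn_inj.
(* A crude exponent, of order s where log s is the truth; the choice tau = s^-94 can afford it
   because s / tau = n / s. *)
have Qexp : s ^+ 99 <= expR (99%:R * s).
  rewrite expRM_natl lerXn2r ?nnegrE ?expR_ge0 ?(ltW s0)//.
  by rewrite (le_trans _ (expR_ge1Dx _))// lerDr.
have u2 : 0 < u ^+ 2 by [].
have sq (x : R) : u <= x -> u ^+ 2 <= x ^+ 2.
  by move=> ux; rewrite lerXn2r ?nnegrE ?(ltW u0)// (le_trans (ltW u0)).
have zs2 : {in zs, forall z, nc z <= 2}.
  move=> z /zs_annulus/andP[_ /le_trans]; apply.
  by rewrite -[leRHS]/(1 + 1 : R) lerD2l.
have H := @betti0_ge_bad_cells R n p (lead_coef p) rs zs (u ^+ 94) (5 * u ^+ 144)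
  (4 * u ^+ 137) (s ^+ 137) (s ^+ 272) (s ^+ 97) (u ^+ 6) (s ^+ 139) (s ^+ 271)
  (u ^+ 98) (u ^+ 2) (s ^+ 99) (99%:R * s) n0 srs rsE net zs2 sum_coef (ps _)
  (ltW (ps _)).
rewrite ns -[s ^- 96]exprVn in H.
have t01 : 0 < u ^+ 94 <= 1 by rewrite pu uk1.
have r0 : 0 <= 5 * u ^+ 144 by exact: mulr_ge0 (ler0n _ _) (ltW (pu _)).
have r1 : 0 < 4 * u ^+ 137 by apply: mulr_gt0 (pu _); rewrite ltr0n.
have Qe : \sum_(k < n.+1) nc p`_k ^+ 2 <= u ^+ 2 * s ^+ 99.
  by rewrite mulrC scale_mul_inv'.
apply: le_trans (H r0 r1 t01 (numeric_rho s64) (numeric_r s64) (numeric_iso s64)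
  (numeric_ring s64) (numeric_cellB s64) (numeric_cell0 s64) (numeric_cell1 s64)
  (numeric_cell2 s64) (ltW (pu _)) nonsmall (numeric_rho1 s64) (numeric_rhoA s64)
  u2 (sq _ p0) (sq _ pn) Qe Qexp).
(* The loss is 2 * 99 s^95 outside the annulus and 4 s^95 in bad cells, hence 202. *)
rewrite lee_fin ns; have -> : 99%:R * s / u ^+ 94 = 99%:R * s ^+ 95.
  by rewrite -mulrA /u exprVn invrK -exprS.
have -> : s ^+ 96 * (1 - 202 * u) = s ^+ 96 - 202 * s ^+ 95.
  rewrite mulrBr mulr1 mulrCA; congr (_ - _ * _).
  exact: (@scale_mul_inv' R s s64 96 1).
have := few_bad; move: (count _ _)%:R (s ^+ 95) (s ^+ 96) => x y z *; lra.
Qed.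

End TypicalPolynomial.

Lemma betti0_ge0 (R : realType) (V : topologicalType) (A : set V) :
  (0 <= betti0 R A)%E.
Proof. by rewrite /betti0 /counting; case: asboolP => // _; rewrite lee_fin. Qed.

(** * The typical event and the expected number of components *)

Section TypicalEvent.
Context d (T : measurableType d) (R : realType) (P : probability T R).
Variables (n : nat) (a : 'I_n.+1 -> {RV P >-> R[i]}) (s : R).
Hypotheses (n0 : (0 < n)%N) (a_indep : mutually_independent P a).
Hypothesis a_gauss : forall k, std_complex_gaussian P (a k).
Hypotheses (s64 : 64 <= s) (ns : n%:R = s ^+ 96).
Let u := s^-1.
Let p := random_poly a.

Let s0 : 0 < s. Proof. exact: lt_le_trans s64. Qed.
Let u0 : 0 < u. Proof. by rewrite invr_gt0. Qed.
Let ps k : 0 < s ^+ k. Proof. exact: exprn_gt0. Qed.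
Let pu k : 0 < u ^+ k. Proof. exact: exprn_gt0. Qed.
Let u64 : 64 * u <= 1. Proof. by rewrite ler_pdivrMr// mul1r. Qed.

Let u1 : u < 1. Proof. by rewrite invf_lt1// (lt_le_trans _ s64)// ltr1n. Qed.

Let bad z w := bad_cell n (p w) (u ^+ 6) (s ^+ 139) (s ^+ 271) z.

Let measurable_value z r : measurable [set w | nc (p w).[z] <= r].
Proof.
under eq_set do rewrite eval_random_poly.
exact: measurable_linear_form_le.
Qed.

Let bad_split z : [set w | bad z w] =
  [set w | (nc (p w).[z] <= u ^+ 6 * wgt n z)%R /\
     (nc (z * tcoef (p w) z 1) <= s ^+ 139 * wgt n z)%R] `|`
  [set w | (s ^+ 271 * wgt n z <= nc (tcoef (p w) z 2))%R].
Proof.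
apply/seteqP; split => w /=.
  by move=> /orP[/andP[]|]; [left|right].
by move=> [[h1 h2]|h]; apply/orP; [left; rewrite h1|right].
Qed.

Let measurable_close z : measurable [set w |
  (nc (p w).[z] <= u ^+ 6 * wgt n z)%R /\
  (nc (z * tcoef (p w) z 1) <= s ^+ 139 * wgt n z)%R].
Proof.
apply: (@measurableI _ _ [set w | nc (p w).[z] <= u ^+ 6 * wgt n z]
  [set w | nc (z * tcoef (p w) z 1) <= s ^+ 139 * wgt n z]).
  exact: measurable_value.
under eq_set do rewrite deriv_random_poly.
exact: measurable_linear_form_le.
Qed.

Let measurable_second z :
  measurable [set w | (s ^+ 271 * wgt n z <= nc (tcoef (p w) z 2))%R].
Proof.
under eq_set do rewrite tcoef_random_poly.
exact: measurable_linear_form_ge.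
Qed.

Let measurable_bad z : measurable [set w | bad z w].
Proof. by rewrite bad_split; exact: measurableU. Qed.

Let measurable_coef k r : measurable [set w | nc (a k w) <= r].
Proof.
rewrite -[X in measurable X]setTI; apply: measurable_fun_le => //.
by apply: measurable_cnc; exact: measurable_funP.
Qed.

Let measurable_norm r : measurable [set w | r <= \sum_(k < n.+1) nc (a k w) ^+ 2].
Proof.
rewrite -[X in measurable X]setTI; apply: measurable_fun_le => //.
apply: measurable_sum => k; apply: measurable_funX.
by apply: measurable_cnc; exact: measurable_funP.
Qed.

Let bad_prob : exists m : nat, s ^+ 94 <= 32 * m%:R /\ forall z,
  1 - u ^+ 94 <= nc z <= 1 + u ^+ 94 ->
  (P [set w | bad z w] <= (64 * ((u ^+ 6) ^+ 2 * (s ^+ 139) ^+ 2) / m%:R ^+ 4 +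
    8 * ((s ^+ 96) ^+ 5 / (s ^+ 271) ^+ 2) ^+ 2)%:E)%E.
Proof.
have big : 64 <= s ^+ 94.
  by rewrite (le_trans s64)// ler_eXnr// (le_trans _ s64)// ler1n.
(* m is the integer part of s^94 / 16, the largest value with 16 m tau <= 1. *)
have /truncn_itv/andP[] : 0 <= s ^+ 94 / 16 by rewrite divr_ge0// ltW.
move: (Num.truncn _) => m ml mu.
have m16 : 16 * m%:R <= s ^+ 94 by move: ml; rewrite ler_pdivlMr// mulrC.
rewrite ltr_pdivrMr// -natr1 in mu.
have m1 : (0 < m)%N.
  rewrite -(ltr_nat R); move: mu big; move: (s ^+ 94) m%:R => x y *; lra.
have m1R : 1 <= m%:R :> R by rewrite ler1n.
exists m; split; first by move: mu m1R; move: (s ^+ 94) m%:R => x y *; lra.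
move=> z az; rewrite bad_split.
apply: le_trans (measureU2 _ _ _) _ => //; rewrite EFinD.
apply: leeD; last by rewrite -ns; exact: prob_large_second.
apply: (prob_bad_cell a_indep a_gauss (m := m) (tau := u ^+ 94)) => //.
- rewrite -(ler_nat R) natrM ns.
  have := @scale_pow_lt R s s64 94 96 isT; move: m16 (ps 94).
  move: (s ^+ 94) (s ^+ 96) m%:R => x y v *; lra.
- exact: ltW.
- have E : s ^+ 94 * u ^+ 94 = 1 by exact: (@scale_mul_inv R s s64 94 94).
  by rewrite -[leRHS]E ler_wpM2r// ltW.
- by rewrite exprn_ile1 ?ltW.
Qed.

Lemma typical_event : exists G : set T, [/\ measurable G,
  ((1 - 14 * u)%:E <= P G)%E &
  forall w, G w -> ((n%:R * (1 - 202 * u))%:E <= betti0 R (lemniscate (p w)))%E].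
Proof.
have tau1 : u ^+ 94 < 1.
  by rewrite exprn_ilt1 ?ltW.
have dt : u ^+ 144 <= u ^+ 94.
  by rewrite ler_wiXn2l ?ltW.
have [zs [szs azs net]] := annulus_net (pu 144) dt tau1.
have [m [sm Pbad]] := bad_prob.
set q := (X in X%:E) in Pbad.
(* The exceptional events: too many bad cells, a small value at some centre, a large norm, a small
   constant coefficient, a small leading coefficient. Their probabilities, at most u, 3 u, 8 u, u
   and u, add up to 14 u. *)
pose H1 := [set w | s ^+ 95 <= (count (bad^~ w) zs)%:R :> R].
pose small z w := nc (p w).[z] <= u ^+ 98 * wgt n z.
pose H2 := [set w | 1 <= (count (small^~ w) zs)%:R :> R].
pose H3 := [set w | s ^+ 97 <= \sum_(k < n.+1) nc (a k w) ^+ 2].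
pose H4 := [set w | nc (a ord0 w) <= u].
pose H5 := [set w | nc (a ord_max w) <= u].
have mH1 : measurable H1 by apply: measurable_count_ge => z _; exact: measurable_bad.
have mH2 : measurable H2 by apply: measurable_count_ge => z _; exact: measurable_value.
have mH3 : measurable H3 by exact: measurable_norm.
have mH4 : measurable H4 by exact: measurable_coef.
have mH5 : measurable H5 by exact: measurable_coef.
have q0 : 0 <= q.
  apply: addr_ge0; last by apply: mulr_ge0 => //; exact: sqr_ge0.
  apply: divr_ge0; last by rewrite exprn_ge0.
  by do 2![apply: mulr_ge0 => //]; exact: sqr_ge0.
have PH1 : (P H1 <= u%:E)%E.
  apply: le_trans (prob_count_ge (q := q) (ps 95) _ _) _.
    by move=> z _; exact: measurable_bad.
    by move=> z /azs; exact: Pbad.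
  rewrite lee_fin (le_trans _ (numeric_bad s64 sm))// ler_wpM2r ?invr_ge0 ?(ltW (ps _))//.
  by rewrite ler_wpM2r.
have PH2 : (P H2 <= (3 * u)%:E)%E.
  apply: le_trans (prob_count_ge (q := 4 * (u ^+ 98) ^+ 2) ltr01 _ _) _.
    by move=> z _; exact: measurable_value.
    by move=> z _; exact: prob_small_value.
  by rewrite lee_fin divr1 (le_trans _ (numeric_small s64))// ler_wpM2r// mulr_ge0 ?sqr_ge0.
have PH3 : (P H3 <= (8 * u)%:E)%E.
  apply: le_trans (prob_large_norm a_gauss (ps 97)) _.
  rewrite lee_fin ler_pdivrMr// -[n.+1%:R]natr1 ns.
  have -> : 8 * u * s ^+ 97 = 8 * s ^+ 96.
    by rewrite -mulrA exprS mulKf ?gt_eqF.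
  have : 1 <= s ^+ 96 by rewrite -ns ler1n.
  by move: (s ^+ 96) => x *; lra.
have sq4 : 4 * u ^+ 2 <= u.
  by rewrite expr2 mulrA ler_piMl ?(ltW u0)// (le_trans _ u64)// ler_wpM2r ?(ltW u0)// ler_nat.
have PH4 : (P H4 <= u%:E)%E.
  by apply: le_trans (prob_small_coef a_indep a_gauss ord0 u0) _; rewrite lee_fin.
have PH5 : (P H5 <= u%:E)%E.
  by apply: le_trans (prob_small_coef a_indep a_gauss ord_max u0) _; rewrite lee_fin.
pose H := H1 `|` H2 `|` H3 `|` H4 `|` H5.
have mH12 := measurableU _ _ mH1 mH2; have mH13 := measurableU _ _ mH12 mH3.
have mH14 := measurableU _ _ mH13 mH4; have mH := measurableU _ _ mH14 mH5.
have PH : (P H <= (14 * u)%:E)%E.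
  have -> : 14 * u = u + 3 * u + 8 * u + u + u by ring.
  rewrite !EFinD.
  apply: le_trans (measureU2 _ mH14 mH5) (leeD _ PH5).
  apply: le_trans (measureU2 _ mH13 mH4) (leeD _ PH4).
  apply: le_trans (measureU2 _ mH12 mH3) (leeD _ PH3).
  exact: le_trans (measureU2 _ mH1 mH2) (leeD PH1 PH2).
exists (~` H); split.
- exact: measurableC.
- by rewrite probability_setC// EFinB leeB.
move=> w nH; have coefE k : (p w)`_(nat_of_ord k) = a k w by exact: coef_random_poly.
have nH1 : ~ H1 w by move=> h; apply: nH; left; left; left; left.
have nH2 : ~ H2 w by move=> h; apply: nH; left; left; left; right.
have nH3 : ~ H3 w by move=> h; apply: nH; left; left; right.
have nH4 : ~ H4 w by move=> h; apply: nH; left; right.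
have nH5 : ~ H5 w by move=> h; apply: nH; right.
apply: (@betti0_typical R n s zs (p w) n0 s64 ns net azs).
- exact: size_random_poly.
- rewrite (eq_bigr (fun k : 'I_n.+1 => nc (a k w) ^+ 2)); last first.
    by move=> k _; rewrite coefE.
  by rewrite ltW// ltNge; apply/negP.
- by rewrite (coefE ord0) ltW// ltNge; apply/negP.
- by rewrite (coefE ord_max) ltW// ltNge; apply/negP.
- move=> z zzs; rewrite ltNge; apply/negP => sz; apply: nH2.
  by rewrite /H2/= ler1n -has_count; apply/hasP; exists z.
- by rewrite ltW// ltNge; apply/negP.
Qed.

(** The constant is 202 + 14, the loss of roots plus the exceptional probability. The condition s >=
    202 keeps the count nonnegative when it is multiplied by the probability. *)
Lemma expectation_ge : 202 <= s ->
  ((n%:R * (1 - 216 * u))%:E <= \int[P]_w betti0 R (lemniscate (p w)))%E.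
Proof.
move=> s202; have [G [mG PG bG]] := typical_event.
have u202 : 202 * u <= 1 by rewrite ler_pdivrMr// mul1r.
have K0 : 0 <= n%:R * (1 - 202 * u) by rewrite mulr_ge0// subr_ge0.
have b0 w : (0 <= betti0 R (lemniscate (p w)))%E by exact: betti0_ge0.
apply: le_trans (integral_ge_event P mG K0 b0 bG).
apply: (@le_trans _ _ ((n%:R * (1 - 202 * u))%:E * (1 - 14 * u)%:E)%E).
  rewrite -EFinM lee_fin -mulrA ler_wpM2l//.
  have : 0 <= u * u by rewrite mulr_ge0 ?(ltW u0).
  by move: u => x *; nra.
by apply: lee_wpmul2l => //; rewrite lee_fin.
Qed.


Lemma expectation_le : (\int[P]_w betti0 R (lemniscate (p w)) <= n%:R%:E)%E.
Proof.
apply: integral_le_cst => w; first exact: betti0_ge0.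
exact: betti0_le n0 (size_random_poly a w).
Qed.

End TypicalEvent.

(** * The scale and the limit *)

Section Scale.
Variable R : realType.

(** A real 96th root, so that every n is covered and not only perfect powers. *)
Definition scale (n : nat) : R := n%:R `^ 96%:R^-1.

Lemma scaleX n : scale n ^+ 96 = n%:R.
Proof. by rewrite -powR_mulrn ?powR_ge0// -powRrM mulVf// powRr1. Qed.

Lemma scale_near (M : R) : 0 <= M -> \forall n \near \oo, M <= scale n.
Proof.
move=> M0; have := @nbhs_infty_ger R (M ^+ 96).
apply: filterS => n; rewrite -scaleX => h.
by rewrite -(@ler_pXn2r _ 96)// ?nnegrE ?powR_ge0.
Qed.

Lemma cvg_scaleV : (scale n)^-1 @[n --> \oo] --> (0 : R).
Proof.
apply/cvgr0Pnorm_le => e e0; have e1 : 0 < e^-1 by rewrite invr_gt0.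
have := scale_near (ltW e1); apply: filterS => n h.
have s0 : 0 < scale n by exact: lt_le_trans h.
by rewrite ger0_norm ?invr_ge0 ?powR_ge0// -[e]invrK lef_pV2.
Qed.

End Scale.

Theorem theorem3 (R : realType) (d : nat -> measure_display)
    (T : forall n, measurableType (d n)) (P : forall n, probability (T n) R)
    (a : forall n, 'I_n.+1 -> {RV (P n) >-> R[i]})
    (a_indep : forall n, (1 <= n)%N -> mutually_independent (P n) (a n))
    (a_gauss : forall n, (1 <= n)%N ->
       forall k : 'I_n.+1, std_complex_gaussian (P n) (a n k)) :
  ((\int[P n]_w betti0 R (lemniscate (random_poly (a n) w))) / n%:R%:E)%E
    @[n --> \oo] --> 1%E.
Proof.
apply: (@squeeze_cvge _ _ _ _ (fun n => (1 - 216 * (scale R n)^-1)%:E) _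
  (cst 1%E)); last exact: cvg_cst.
- near=> n.
  have n0 : (0 < n)%N by near: n; exact: nbhs_infty_gt.
  have nR : n%:R != 0 :> R by rewrite pnatr_eq0 -lt0n.
  have s202 : 202 <= scale R n by near: n; exact: scale_near.
  have s64 : 64 <= scale R n by rewrite (le_trans _ s202)// ler_nat.
  have i0 : (0 <= (n%:R^-1)%:E :> \bar R)%E by rewrite lee_fin invr_ge0.
  rewrite inver (negbTE nR); apply/andP; split.
    have := expectation_ge n0 (a_indep n n0) (a_gauss n n0) s64 (esym (scaleX R n)) s202.
    move=> /(lee_wpmul2r i0); apply: le_trans.
    by rewrite -EFinM mulrAC divff// mul1r.
  have := expectation_le (a n) n0.
  by move=> /(lee_wpmul2r i0) /le_trans; apply; rewrite -EFinM divff.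
apply/fine_cvgP; split; first by near=> n.
rewrite [X in _ --> X](_ : 1 = 1 - 216 * 0 :> R); last by rewrite mulr0 subr0.
apply: cvgB; first exact: cvg_cst.
by apply: cvgM; [exact: cvg_cst|exact: cvg_scaleV].
Unshelve. all: by end_near.
Qed.
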